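(* Let $T$ be a centralizable Hopf monad on an autonomous category $\mathcal{C}$, with centralizer $(Z_T,\partial)$, let $\Omega\colon TZ_T\to Z_TT$ be the canonical distributive law of $T$, and let $D_T=Z_T\circ_\Omega T$ be the double of $T$. Let $\eta$ and $u$ be the units of $T$ and $Z_T$. Let $\mathcal{U}\colon\mathcal{Z}(T\text{-}\mathcal{C})\to\mathcal{C}$ be the strict monoidal forgetful functor $\mathcal{U}((M,r),\sigma)=M$, $\mathcal{U}(f)=f$, and let $I\colon D_T\text{-}\mathcal{C}\to\mathcal{Z}(T\text{-}\mathcal{C})$ be the functor defined by $I(f)=f$ and $$I(M,r)=\bigl((M,r\,u_{T(M)}),\sigma\bigr)\quad\text{with}\quad \sigma_{(N,s)}=(s\otimes r\,Z_T(\eta_M))\,\partial_{M,N}.$$ Then $I$ is a strict monoidal isomorphism of braided categories such that $\mathcal{U}I=U_{D_T}$ as monoidal functors.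
   Context: Categories are small and monoidal categories are strict, with product $\otimes$ and unit $\mathbf 1$. A monoidal category is autonomous if every object $X$ has a left dual ${}^\vee X$ (with $\mathrm{ev}_X\colon {}^\vee X\otimes X\to\mathbf 1$, $\mathrm{coev}_X\colon \mathbf 1\to X\otimes {}^\vee X$) and a right dual $X^\vee$ (with $\widetilde{\mathrm{ev}}_X\colon X\otimes X^\vee\to \mathbf 1$, $\widetilde{\mathrm{coev}}_X\colon \mathbf 1\to X^\vee\otimes X$). Duals are chosen; ${}^\vee f$, $f^\vee$ are dual morphisms; ${}^\vee T(X)$ means ${}^\vee(T(X))$. A comonoidal functor $F$ is a functor with a coassociative and counital natural transformation $F_2(X,Y)\colon F(X\otimes Y)\to F(X)\otimes F(Y)$, $F_0\colon F(\mathbf 1)\to\mathbf 1$; $F_3(X,Y,Z)=(\mathrm{id}\otimes F_2(Y,Z))F_2(X,Y\otimes Z)$. Comonoidal natural transformations are those compatible with these structures; composites are comonoidal by $(GF)_2(X,Y)=G_2(F(X),F(Y))G(F_2(X,Y))$, $(GF)_0=G_0G(F_0)$. A bimonad is a monad $(T,\mu,\eta)$ with a comonoidal structure on $T$ such that $\mu,\eta$ are comonoidal. A left antipode for $T$ is a natural transformation $s^l_X\colon T({}^\vee T(X))\to {}^\vee X$ with $T_0T(\mathrm{ev}_X)T({}^\vee\eta_X\otimes \mathrm{id}_X)=\mathrm{ev}_{T(X)}(s^l_{T(X)}T({}^\vee\mu_X)\otimes \mathrm{id})T_2({}^\vee T(X),X)$ and $(\eta_X\otimes \mathrm{id}_{{}^\vee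 X})\mathrm{coev}_XT_0=(\mu_X\otimes s^l_X)T_2(T(X),{}^\vee T(X))T(\mathrm{coev}_{T(X)})$. A right antipode is a natural transformation $s^r_X\colon T(T(X)^\vee)\to X^\vee$ with $T_0T(\widetilde{\mathrm{ev}}_X)T(\mathrm{id}_X\otimes\eta_X^\vee)=\widetilde{\mathrm{ev}}_{T(X)}(\mathrm{id}\otimes s^r_{T(X)}T(\mu_X^\vee))T_2(X,T(X)^\vee)$ and $(\mathrm{id}_{X^\vee}\otimes\eta_X)\widetilde{\mathrm{coev}}_XT_0=(s^r_X\otimes\mu_X)T_2(T(X)^\vee,T(X))T(\widetilde{\mathrm{coev}}_{T(X)})$. A Hopf monad is a bimonad on an autonomous category having a left and a right antipode. For a monad $T$, $T\text{-}\mathcal{C}$ is the category of $T$-modules $(M,r)$ ($r\colon T(M)\to M$, $rT(r)=r\mu_M$, $r\eta_M=\mathrm{id}_M$) and $T$-linear morphisms; $U_T\colon T\text{-}\mathcal{C}\to\mathcal{C}$ is the forgetful functor. If $T$ is a bimonad, $T\text{-}\mathcal{C}$ is monoidal with $(M,r)\otimes(N,s)=(M\otimes N,(r\otimes s)T_2(M,N))$ and unit $(\mathbf 1,T_0)$; if $T$ is a Hopf monad it is autonomous. A centralizer of an endofunctor $T$ is a pair $(Z_T,\partial)$ with $Z_T$ an endofunctor and $\partial_{X,Y}\colon X\otimes Y\to T(Y)\otimes Z_T(X)$ natural in $X,Y$, such that for all objects $X,W$ and every natural $\{\xi_Y\colon X\otimes Y\to T(Y)\otimes W\}_Y$ there is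 a unique $r\colon Z_T(X)\to W$ with $\xi_Y=(\mathrm{id}_{T(Y)}\otimes r)\partial_{X,Y}$ for all $Y$. $T$ is centralizable if it has a centralizer. For $T$ a Hopf monad, $Z_T$ carries the Hopf monad structure with product $m$, unit $u$ and comonoidal structure determined by $(\mathrm{id}\otimes m_X)(\mathrm{id}_{T(Y_1)}\otimes\partial_{Z_T(X),Y_2})(\partial_{X,Y_1}\otimes\mathrm{id}_{Y_2})=(T_2(Y_1,Y_2)\otimes\mathrm{id}_{Z_T(X)})\partial_{X,Y_1\otimes Y_2}$, $u_X=(T_0\otimes\mathrm{id}_{Z_T(X)})\partial_{X,\mathbf 1}$, $(\mathrm{id}_{T(Y)}\otimes(Z_T)_2(X_1,X_2))\partial_{X_1\otimes X_2,Y}=(\mu_Y\otimes\mathrm{id})(\partial_{X_1,T(Y)}\otimes\mathrm{id}_{Z_T(X_2)})(\mathrm{id}_{X_1}\otimes\partial_{X_2,Y})$, $(\mathrm{id}_{T(Y)}\otimes(Z_T)_0)\partial_{\mathbf 1,Y}=\eta_Y$. Set $i_{X,Y}=(\mathrm{ev}_{T(Y)}\otimes\mathrm{id}_{Z_T(X)})(\mathrm{id}_{{}^\vee T(Y)}\otimes\partial_{X,Y})\colon {}^\vee T(Y)\otimes X\otimes Y\to Z_T(X)$. The canonical distributive law of $T$ is the natural transformation $\Omega\colon TZ_T\to Z_TT$ determined by $\Omega_XT(i_{X,Y})=i_{T(X),T(Y)}({}^\vee\mu_Y s^l_{T(Y)}T({}^\vee\mu_Y)\otimes\mathrm{id}_{T(X)\otimes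 T(Y)})T_3({}^\vee T(Y),X,Y)$ for all $X,Y$. The double $D_T=Z_T\circ_\Omega T$ is the Hopf monad with underlying endofunctor $Z_TT$, product $p_X=m_{T(X)}Z_T^2(\mu_X)Z_T(\Omega_{T(X)})$, unit $e_X=u_{T(X)}\eta_X$, and the composite comonoidal structure. It is quasitriangular, with R-matrix $R_{X,Y}=(u_{T(Y)}\otimes Z_T(\eta_X))\partial_{X,Y}\colon X\otimes Y\to D_T(Y)\otimes D_T(X)$; accordingly $D_T\text{-}\mathcal{C}$ is braided with braiding $\tau_{(M,r),(N,s)}=(s\otimes r)R_{M,N}$. The center $\mathcal{Z}(\mathcal{A})$ of a monoidal category $\mathcal{A}$ is the braided category whose objects are pairs $(M,\sigma)$, with $\sigma=\{\sigma_Y\colon M\otimes Y\to Y\otimes M\}_Y$ a natural isomorphism satisfying $\sigma_{Y\otimes Z}=(\mathrm{id}_Y\otimes\sigma_Z)(\sigma_Y\otimes\mathrm{id}_Z)$ and $\sigma_{\mathbf 1}=\mathrm{id}_M$; morphisms $(M,\sigma)\to(M',\sigma')$ are $f\colon M\to M'$ with $(\mathrm{id}_Y\otimes f)\sigma_Y=\sigma'_Y(f\otimes\mathrm{id}_Y)$; $(M,\sigma)\otimes(N,\gamma)=(M\otimes N,(\sigma\otimes\mathrm{id}_N)(\mathrm{id}_M\otimes\gamma))$; braiding $\tau_{(M,\sigma),(N,\gamma)}=\sigma_N$. *)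

(* Defs.v *)
(* Small categories are presented by one type of objects and one type of
   morphisms with [dom] and [cod].  In this way the equations between objects
   which hold in strict monoidal categories, such as
   (X ⊠ Y) ⊠ Z = X ⊠ (Y ⊠ Z), need no transport in the types of morphisms, and
   formulas can be written exactly as on paper.

   [g ∘ f] is a total function on morphisms, about which nothing is assumed
   unless [dom g = cod f].  Morphism-valued data therefore always come with
   their source and target, recorded by [hom]. *)
From Stdlib Require Import ClassicalEpsilon ProofIrrelevance FunctionalExtensionality.

Set Implicit Arguments.
Unset Strict Implicit.
Unset Printing Implicit Defensive.

#[local] Obligation Tactic := idtac.

Reserved Notation "g ∘ f" (at level 40, left associativity).
Reserved Notation "f ⊗ g" (at level 30, right associativity).
Reserved Notation "X ⊠ Y" (at level 30, right associativity).
Reserved Notation "F $ f" (at level 20, right associativity).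

Record Category := {
  ob : Type;
  mor : Type;
  dom : mor -> ob;
  cod : mor -> ob;
  idm : ob -> mor;
  comp : mor -> mor -> mor;
  dom_id : forall X, dom (idm X) = X;
  cod_id : forall X, cod (idm X) = X;
  dom_comp : forall g f, dom g = cod f -> dom (comp g f) = dom f;
  cod_comp : forall g f, dom g = cod f -> cod (comp g f) = cod g;
  comp_id_l : forall f, comp (idm (cod f)) f = f;
  comp_id_r : forall f, comp f (idm (dom f)) = f;
  comp_assoc : forall h g f, dom h = cod g -> dom g = cod f ->
    comp h (comp g f) = comp (comp h g) f
}.
Arguments idm {c} _.
Arguments comp {c} _ _.
Arguments dom {c} _.
Arguments cod {c} _.
Notation "g ∘ f" := (comp g f).

Definition hom (C : Category) (X Y : ob C) (f : mor C) : Prop :=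
  dom f = X /\ cod f = Y.

Definition is_iso (C : Category) (f : mor C) : Prop :=
  exists g, hom (cod f) (dom f) g /\ g ∘ f = idm (dom f) /\ f ∘ g = idm (cod f).

Record Functor (C D : Category) := {
  fob :> ob C -> ob D;
  fmap : mor C -> mor D;
  dom_fmap : forall f, dom (fmap f) = fob (dom f);
  cod_fmap : forall f, cod (fmap f) = fob (cod f);
  fmap_id : forall X, fmap (idm X) = idm (fob X);
  fmap_comp : forall g f, dom g = cod f -> fmap (g ∘ f) = fmap g ∘ fmap f
}.
Notation "F $ f" := (fmap F f).

Program Definition id_functor (C : Category) : Functor C C :=
  {| fob := fun X => X; fmap := fun f => f |}.
Solve All Obligations with reflexivity.

Program Definition comp_functor (C D E : Category) (G : Functor D E) (F : Functor C D) :
    Functor C E :=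
  {| fob := fun X => G (F X); fmap := fun f => G $ (F $ f) |}.
Next Obligation. intros; cbn; now rewrite !dom_fmap. Qed.
Next Obligation. intros; cbn; now rewrite !cod_fmap. Qed.
Next Obligation. intros; cbn; now rewrite !fmap_id. Qed.
Next Obligation.
  intros; cbn; rewrite !fmap_comp; trivial. now rewrite dom_fmap, cod_fmap; f_equal.
Qed.

Definition natural (C D : Category) (F G : Functor C D) (alpha : ob C -> mor D) : Prop :=
  (forall X, hom (F X) (G X) (alpha X)) /\
  (forall f, G $ f ∘ alpha (dom f) = alpha (cod f) ∘ F $ f).

Record MonCat := {
  cat :> Category;
  tob : ob cat -> ob cat -> ob cat;
  tmor : mor cat -> mor cat -> mor cat;
  one : ob cat;
  dom_tmor : forall f g, dom (tmor f g) = tob (dom f) (dom g);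
  cod_tmor : forall f g, cod (tmor f g) = tob (cod f) (cod g);
  tmor_id : forall X Y, tmor (idm X) (idm Y) = idm (tob X Y);
  tmor_comp : forall g f g' f', dom g = cod f -> dom g' = cod f' ->
    tmor (g ∘ f) (g' ∘ f') = tmor g g' ∘ tmor f f';
  tob_assoc : forall X Y Z, tob X (tob Y Z) = tob (tob X Y) Z;
  tob_1l : forall X, tob one X = X;
  tob_1r : forall X, tob X one = X;
  tmor_assoc : forall f g h, tmor f (tmor g h) = tmor (tmor f g) h;
  tmor_1l : forall f, tmor (idm one) f = f;
  tmor_1r : forall f, tmor f (idm one) = f
}.
Arguments tob {m} _ _.
Arguments tmor {m} _ _.
Arguments one {m}.
Notation "X ⊠ Y" := (tob X Y).
Notation "f ⊗ g" := (tmor f g).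

Record AutonomousCat := {
  amon :> MonCat;
  ldual : ob amon -> ob amon;
  ev : ob amon -> mor amon;
  coev : ob amon -> mor amon;
  ev_hom : forall X, hom (ldual X ⊠ X) one (ev X);
  coev_hom : forall X, hom one (X ⊠ ldual X) (coev X);
  ldual_zigzag : forall X, (idm X ⊗ ev X) ∘ (coev X ⊗ idm X) = idm X;
  ldual_zagzig : forall X,
    (ev X ⊗ idm (ldual X)) ∘ (idm (ldual X) ⊗ coev X) = idm (ldual X);
  rdual : ob amon -> ob amon;
  rev : ob amon -> mor amon;
  rcoev : ob amon -> mor amon;
  rev_hom : forall X, hom (X ⊠ rdual X) one (rev X);
  rcoev_hom : forall X, hom one (rdual X ⊠ X) (rcoev X);
  rdual_zigzag : forall X, (rev X ⊗ idm X) ∘ (idm X ⊗ rcoev X) = idm X;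
  rdual_zagzig : forall X,
    (idm (rdual X) ⊗ rev X) ∘ (rcoev X ⊗ idm (rdual X)) = idm (rdual X)
}.
Arguments ldual {a} _.
Arguments ev {a} _.
Arguments coev {a} _.
Arguments rdual {a} _.
Arguments rev {a} _.
Arguments rcoev {a} _.

(** For f : X → Y, [ldualm f] : ldual Y → ldual X and [rdualm f] : rdual Y → rdual X. *)
Definition ldualm (C : AutonomousCat) (f : mor C) : mor C :=
  (ev (cod f) ⊗ idm (ldual (dom f)))
  ∘ (idm (ldual (cod f)) ⊗ f ⊗ idm (ldual (dom f)))
  ∘ (idm (ldual (cod f)) ⊗ coev (dom f)).

Definition rdualm (C : AutonomousCat) (f : mor C) : mor C :=
  (idm (rdual (dom f)) ⊗ rev (cod f))
  ∘ (idm (rdual (dom f)) ⊗ f ⊗ idm (rdual (cod f)))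
  ∘ (rcoev (dom f) ⊗ idm (rdual (cod f))).

Definition is_braiding (C : MonCat) (tau : ob C -> ob C -> mor C) : Prop :=
  (forall X Y, hom (X ⊠ Y) (Y ⊠ X) (tau X Y)) /\
  (forall X Y, is_iso (tau X Y)) /\
  (forall f g, (g ⊗ f) ∘ tau (dom f) (dom g) = tau (cod f) (cod g) ∘ (f ⊗ g)) /\
  (forall X Y Z, tau X (Y ⊠ Z) = (idm Y ⊗ tau X Z) ∘ (tau X Y ⊗ idm Z)) /\
  (forall X Y Z, tau (X ⊠ Y) Z = (tau X Z ⊗ idm Y) ∘ (idm X ⊗ tau Y Z)).

Record BraidedCat := {
  bmon :> MonCat;
  braid : ob bmon -> ob bmon -> mor bmon;
  braidP : is_braiding braid
}.
Arguments braid {b} _ _.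

Record MonFunctor (C D : MonCat) := {
  mfun :> Functor C D;
  mon2 : ob C -> ob C -> mor D;
  mon0 : mor D;
  mon2_hom : forall X Y, hom (mfun X ⊠ mfun Y) (mfun (X ⊠ Y)) (mon2 X Y);
  mon2_nat : forall f g,
    mfun $ (f ⊗ g) ∘ mon2 (dom f) (dom g) = mon2 (cod f) (cod g) ∘ (mfun $ f ⊗ mfun $ g);
  mon0_hom : hom one (mfun one) mon0;
  mon2_assoc : forall X Y Z,
    mon2 X (Y ⊠ Z) ∘ (idm (mfun X) ⊗ mon2 Y Z) = mon2 (X ⊠ Y) Z ∘ (mon2 X Y ⊗ idm (mfun Z));
  mon2_unit_l : forall X, mon2 one X ∘ (mon0 ⊗ idm (mfun X)) = idm (mfun X);
  mon2_unit_r : forall X, mon2 X one ∘ (idm (mfun X) ⊗ mon0) = idm (mfun X)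
}.

Definition strict (C D : MonCat) (F : MonFunctor C D) : Prop :=
  (forall X Y, F (X ⊠ Y) = F X ⊠ F Y /\ mon2 F X Y = idm (F X ⊠ F Y)) /\
  (F one = one /\ mon0 F = idm one).

Definition preserves_braiding (C D : BraidedCat) (F : MonFunctor C D) : Prop :=
  forall X Y, F $ braid X Y ∘ mon2 F X Y = mon2 F Y X ∘ braid (F X) (F Y).

Ltac dc :=
  repeat first
    [ progress (rewrite ?dom_id, ?cod_id, ?dom_tmor, ?cod_tmor, ?dom_fmap, ?cod_fmap)
    | rewrite dom_comp; [ | solve [dc] ]
    | rewrite cod_comp; [ | solve [dc] ] ];
  try congruence.

(* As [dc], modulo associativity of the product of objects. *)
Ltac dca :=
  repeat first
    [ progress (rewrite ?dom_id, ?cod_id, ?dom_tmor, ?cod_tmor, ?dom_fmap, ?cod_fmap,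
        ?tob_assoc)
    | match goal with
      | H : dom ?f = _ |- context [dom ?f] => rewrite H
      | H : cod ?f = _ |- context [cod ?f] => rewrite H
      end
    | rewrite dom_comp; [ | solve [dca] ]
    | rewrite cod_comp; [ | solve [dca] ] ];
  try congruence.

Lemma comp_id_l' (C : Category) (X : ob C) f : cod f = X -> idm X ∘ f = f.
Proof. intros <-; apply comp_id_l. Qed.

Lemma comp_id_r' (C : Category) (X : ob C) f : dom f = X -> f ∘ idm X = f.
Proof. intros <-; apply comp_id_r. Qed.

Lemma comp_hom (C : Category) (X Y Z : ob C) g f : hom Y Z g -> hom X Y f -> hom X Z (g ∘ f).
Proof. intros [] []; split; dc. Qed.

Lemma tmor_hom (C : MonCat) (X Y X' Y' : ob C) f g :
  hom X Y f -> hom X' Y' g -> hom (X ⊠ X') (Y ⊠ Y') (f ⊗ g).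
Proof. intros [] []; split; dc. Qed.

Lemma id_hom (C : Category) (X : ob C) : hom X X (idm X).
Proof. split; dc. Qed.

Lemma fmap_hom (C D : Category) (F : Functor C D) X Y f :
  hom X Y f -> hom (F X) (F Y) (F $ f).
Proof. intros []; split; dc. Qed.

Program Definition strict_functor (C D : MonCat) (F : Functor C D)
    (F2 : forall X Y, F (X ⊠ Y) = F X ⊠ F Y)
    (Fm : forall f g, F $ (f ⊗ g) = F $ f ⊗ F $ g)
    (F0 : F one = one) : MonFunctor C D :=
  {| mfun := F; mon2 := fun X Y => idm (F X ⊠ F Y); mon0 := idm one |}.
Next Obligation. intros; rewrite F2; apply id_hom. Qed.
Next Obligation.
  intros; cbn; rewrite comp_id_r', comp_id_l'; auto; rewrite ?Fm; dc.
Qed.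
Next Obligation. intros; rewrite F0; apply id_hom. Qed.
Next Obligation.
  intros; cbn; rewrite !F2, !tmor_id, tob_assoc; reflexivity.
Qed.
Next Obligation.
  intros; cbn; rewrite F0, tob_1l, tmor_1l; apply comp_id_l'; dc.
Qed.
Next Obligation.
  intros; cbn; rewrite F0, tob_1r, tmor_1r; apply comp_id_l'; dc.
Qed.

Program Definition id_mon (C : MonCat) : MonFunctor C C :=
  @strict_functor C C (id_functor C) _ _ _.
Solve All Obligations with reflexivity.

Program Definition comp_mon (C D E : MonCat) (G : MonFunctor D E) (F : MonFunctor C D) :
    MonFunctor C E :=
  {| mfun := comp_functor G F;
     mon2 := fun X Y => G $ mon2 F X Y ∘ mon2 G (F X) (F Y);
     mon0 := G $ mon0 F ∘ mon0 G |}.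
Next Obligation.
  intros; cbn; eapply comp_hom; [apply fmap_hom, mon2_hom | apply mon2_hom].
Qed.
Next Obligation.
  intros C D E G F f g; cbn.
  destruct (mon2_hom F (dom f) (dom g)), (mon2_hom G (F (dom f)) (F (dom g))).
  destruct (mon2_hom F (cod f) (cod g)), (mon2_hom G (F (cod f)) (F (cod g))).
  rewrite comp_assoc by dc. rewrite <- fmap_comp by dc. rewrite mon2_nat.
  rewrite fmap_comp by dc. rewrite <- !comp_assoc by dc. f_equal.
  pose proof (mon2_nat G (F $ f) (F $ g)) as H'.
  rewrite !dom_fmap, !cod_fmap in H'. exact H'.
Qed.
Next Obligation.
  intros; cbn; eapply comp_hom; [apply fmap_hom, mon0_hom | apply mon0_hom].
Qed.
Next Obligation.
  intros C D E G F X Y Z; cbn.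
  destruct (mon2_hom F Y Z), (mon2_hom G (F Y) (F Z)).
  destruct (mon2_hom F X Y), (mon2_hom G (F X) (F Y)).
  destruct (mon2_hom F X (Y ⊠ Z)), (mon2_hom G (F X) (F (Y ⊠ Z))).
  destruct (mon2_hom F (X ⊠ Y) Z), (mon2_hom G (F (X ⊠ Y)) (F Z)).
  destruct (mon2_hom G (F X) (F Y ⊠ F Z)), (mon2_hom G (F X ⊠ F Y) (F Z)).
  pose proof (mon2_nat G (idm (F X)) (mon2 F Y Z)) as N1.
  pose proof (mon2_nat G (mon2 F X Y) (idm (F Z))) as N2.
  rewrite !dom_id, !cod_id, fmap_id in N1, N2.
  rewrite H in N1; rewrite H0 in N1; rewrite H3 in N2; rewrite H4 in N2.
  replace (idm (G (F X)) ⊗ (G $ mon2 F Y Z ∘ mon2 G (F Y) (F Z))) with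
     ((idm (G (F X)) ⊗ G $ mon2 F Y Z) ∘ (idm (G (F X)) ⊗ mon2 G (F Y) (F Z)))
     by (rewrite <- tmor_comp by dc; f_equal; apply comp_id_l'; dc).
  replace ((G $ mon2 F X Y ∘ mon2 G (F X) (F Y)) ⊗ idm (G (F Z))) with
     ((G $ mon2 F X Y ⊗ idm (G (F Z))) ∘ (mon2 G (F X) (F Y) ⊗ idm (G (F Z))))
     by (rewrite <- tmor_comp by dc; f_equal; apply comp_id_l'; dc).
  rewrite <- (comp_assoc (h := G $ mon2 F X (Y ⊠ Z))) by dc.
  rewrite (comp_assoc (h := mon2 G (F X) (F (Y ⊠ Z)))) by dc.
  rewrite <- N1.
  rewrite <- (comp_assoc (g := mon2 G (F X) (F Y ⊠ F Z))) by dc.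
  rewrite mon2_assoc.
  rewrite <- (comp_assoc (h := G $ mon2 F (X ⊠ Y) Z)) by dc.
  rewrite (comp_assoc (h := mon2 G (F (X ⊠ Y)) (F Z))) by dc.
  rewrite <- N2.
  rewrite <- (comp_assoc (g := mon2 G (F X ⊠ F Y) (F Z))) by dc.
  pose proof (tob_assoc (F X) (F Y) (F Z)).
  rewrite (comp_assoc (h := G $ mon2 F X (Y ⊠ Z))) by dc.
  rewrite (comp_assoc (h := G $ mon2 F (X ⊠ Y) Z)) by dc.
  f_equal. rewrite <- !fmap_comp by dc. f_equal. apply mon2_assoc.
Qed.
Next Obligation.
  intros C D E G F X; cbn.
  destruct (mon2_hom F one X), (mon0_hom F), (mon0_hom G), (mon2_hom G (F one) (F X)).
  destruct (mon2_hom G one (F X)).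
  pose proof (mon2_nat G (mon0 F) (idm (F X))) as N1.
  rewrite !dom_id, !cod_id, fmap_id in N1. rewrite H1 in N1; rewrite H2 in N1.
  replace ((G $ mon0 F ∘ mon0 G) ⊗ idm (G (F X))) with
     ((G $ mon0 F ⊗ idm (G (F X))) ∘ (mon0 G ⊗ idm (G (F X))))
     by (rewrite <- tmor_comp by dc; f_equal; apply comp_id_l'; dc).
  rewrite <- comp_assoc by dc.
  rewrite (comp_assoc (h := mon2 G (F one) (F X))) by dc.
  rewrite <- N1. rewrite <- comp_assoc by dc. rewrite mon2_unit_l.
  pose proof (tob_1l (F X)).
  rewrite comp_assoc by dc. rewrite comp_id_r' by dc.
  rewrite <- fmap_comp by dc. rewrite mon2_unit_l. apply fmap_id.
Qed.
Next Obligation.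
  intros C D E G F X; cbn.
  destruct (mon2_hom F X one), (mon0_hom F), (mon0_hom G), (mon2_hom G (F X) (F one)).
  destruct (mon2_hom G (F X) one).
  pose proof (mon2_nat G (idm (F X)) (mon0 F)) as N1.
  rewrite !dom_id, !cod_id, fmap_id in N1. rewrite H1 in N1; rewrite H2 in N1.
  replace (idm (G (F X)) ⊗ (G $ mon0 F ∘ mon0 G)) with
     ((idm (G (F X)) ⊗ G $ mon0 F) ∘ (idm (G (F X)) ⊗ mon0 G))
     by (rewrite <- tmor_comp by dc; f_equal; apply comp_id_l'; dc).
  rewrite <- comp_assoc by dc.
  rewrite (comp_assoc (h := mon2 G (F X) (F one))) by dc.
  rewrite <- N1. rewrite <- comp_assoc by dc. rewrite mon2_unit_r.
  pose proof (tob_1r (F X)).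
  rewrite comp_assoc by dc. rewrite comp_id_r' by dc.
  rewrite <- fmap_comp by dc. rewrite mon2_unit_r. apply fmap_id.
Qed.

Definition braided_isomorphism (C D : BraidedCat) (F : MonFunctor C D) : Prop :=
  preserves_braiding F /\
  exists G : MonFunctor D C,
    preserves_braiding G /\ comp_mon G F = id_mon C /\ comp_mon F G = id_mon D.

Record ComonFunctorData (C D : MonCat) := {
  cfun :> Functor C D;
  com2 : ob C -> ob C -> mor D;
  com0 : mor D
}.

Definition com3 (C D : MonCat) (F : ComonFunctorData C D) (X Y Z : ob C) : mor D :=
  (idm (F X) ⊗ com2 F Y Z) ∘ com2 F X (Y ⊠ Z).

Definition is_comonoidal (C D : MonCat) (F : ComonFunctorData C D) : Prop :=
  (forall X Y, hom (F (X ⊠ Y)) (F X ⊠ F Y) (com2 F X Y)) /\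
  hom (F one) one (com0 F) /\
  (forall f g, (F $ f ⊗ F $ g) ∘ com2 F (dom f) (dom g)
               = com2 F (cod f) (cod g) ∘ F $ (f ⊗ g)) /\
  (forall X Y Z, com3 F X Y Z = (com2 F X Y ⊗ idm (F Z)) ∘ com2 F (X ⊠ Y) Z) /\
  (forall X, (idm (F X) ⊗ com0 F) ∘ com2 F X one = idm (F X)) /\
  (forall X, (com0 F ⊗ idm (F X)) ∘ com2 F one X = idm (F X)).

Definition id_comon (C : MonCat) : ComonFunctorData C C :=
  {| cfun := id_functor C; com2 := fun X Y => idm (X ⊠ Y); com0 := idm one |}.

Definition comp_comon (C D E : MonCat) (G : ComonFunctorData D E) (F : ComonFunctorData C D) :
    ComonFunctorData C E :=
  {| cfun := comp_functor G F;
     com2 := fun X Y => com2 G (F X) (F Y) ∘ G $ com2 F X Y;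
     com0 := com0 G ∘ G $ com0 F |}.

Definition comonoidal_nat (C D : MonCat) (F G : ComonFunctorData C D)
    (alpha : ob C -> mor D) : Prop :=
  natural F G alpha /\
  (forall X Y, com2 G X Y ∘ alpha (X ⊠ Y) = (alpha X ⊗ alpha Y) ∘ com2 F X Y) /\
  com0 G ∘ alpha one = com0 F.

Record BimonadData (C : MonCat) := {
  bfun :> ComonFunctorData C C;
  mu : ob C -> mor C;
  eta : ob C -> mor C
}.

Definition is_bimonad (C : MonCat) (T : BimonadData C) : Prop :=
  is_comonoidal T /\
  comonoidal_nat (comp_comon T T) T (mu T) /\
  comonoidal_nat (id_comon C) T (eta T) /\
  (forall X, mu T X ∘ T $ mu T X = mu T X ∘ mu T (T X)) /\
  (forall X, mu T X ∘ T $ eta T X = idm (T X)) /\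
  (forall X, mu T X ∘ eta T (T X) = idm (T X)).

Record Bimonad (C : MonCat) := {
  bdata :> BimonadData C;
  bimonadP : is_bimonad bdata
}.

Record HopfMonad (C : AutonomousCat) := {
  hbim :> Bimonad C;
  sl : ob C -> mor C;
  sl_hom : forall X, hom (hbim (ldual (hbim X))) (ldual X) (sl X);
  sl_nat : forall f,
    ldualm f ∘ sl (cod f) = sl (dom f) ∘ hbim $ ldualm (hbim $ f);
  sl_ev : forall X,
    com0 hbim ∘ hbim $ ev X ∘ hbim $ (ldualm (eta hbim X) ⊗ idm X)
    = ev (hbim X) ∘ ((sl (hbim X) ∘ hbim $ ldualm (mu hbim X)) ⊗ idm (hbim X))
      ∘ com2 hbim (ldual (hbim X)) X;
  sl_coev : forall X,
    (eta hbim X ⊗ idm (ldual X)) ∘ coev X ∘ com0 hbim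
    = (mu hbim X ⊗ sl X) ∘ com2 hbim (hbim X) (ldual (hbim X)) ∘ hbim $ coev (hbim X);
  sr : ob C -> mor C;
  sr_hom : forall X, hom (hbim (rdual (hbim X))) (rdual X) (sr X);
  sr_nat : forall f,
    rdualm f ∘ sr (cod f) = sr (dom f) ∘ hbim $ rdualm (hbim $ f);
  sr_ev : forall X,
    com0 hbim ∘ hbim $ rev X ∘ hbim $ (idm X ⊗ rdualm (eta hbim X))
    = rev (hbim X) ∘ (idm (hbim X) ⊗ (sr (hbim X) ∘ hbim $ rdualm (mu hbim X)))
      ∘ com2 hbim X (rdual (hbim X));
  sr_coev : forall X,
    (idm (rdual X) ⊗ eta hbim X) ∘ rcoev X ∘ com0 hbim
    = (sr X ⊗ mu hbim X) ∘ com2 hbim (rdual (hbim X)) (hbim X) ∘ hbim $ rcoev (hbim X)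
}.

Record Module (C : MonCat) (T : Bimonad C) := {
  carrier : ob C;
  act : mor C;
  act_hom : hom (T carrier) carrier act;
  act_mu : act ∘ T $ act = act ∘ mu T carrier;
  act_eta : act ∘ eta T carrier = idm carrier
}.

Record ModMor (C : MonCat) (T : Bimonad C) := {
  msrc : Module T;
  mtgt : Module T;
  mmor : mor C;
  mmor_hom : hom (carrier msrc) (carrier mtgt) mmor;
  mmor_lin : mmor ∘ act msrc = act mtgt ∘ T $ mmor
}.

Section Modules.
Variables (C : MonCat) (T : Bimonad C).

Lemma module_ext (M N : Module T) : carrier M = carrier N -> act M = act N -> M = N.
Proof.
  destruct M, N; cbn; intros -> ->; f_equal; apply proof_irrelevance.
Qed.

Lemma modmor_ext (f g : ModMor T) :
  msrc f = msrc g -> mtgt f = mtgt g -> mmor f = mmor g -> f = g.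
Proof.
  destruct f, g; cbn; intros -> -> ->; f_equal; apply proof_irrelevance.
Qed.

Program Definition mod_id (M : Module T) : ModMor T :=
  {| msrc := M; mtgt := M; mmor := idm (carrier M) |}.
Next Obligation. intros; apply id_hom. Qed.
Next Obligation.
  intros; destruct (act_hom M).
  now rewrite fmap_id, comp_id_l', comp_id_r'.
Qed.

Program Definition mod_comp_at (g f : ModMor T) (e : msrc g = mtgt f) : ModMor T :=
  {| msrc := msrc f; mtgt := mtgt g; mmor := mmor g ∘ mmor f |}.
Next Obligation.
  intros; eapply comp_hom; [apply mmor_hom | rewrite e; apply mmor_hom].
Qed.
Next Obligation.
  intros.
  destruct (mmor_hom f), (mmor_hom g), (act_hom (msrc f)), (act_hom (mtgt f)),
    (act_hom (mtgt g)).
  rewrite <- e in *.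
  rewrite <- comp_assoc, mmor_lin, comp_assoc by dc. rewrite <- e, mmor_lin.
  rewrite <- comp_assoc by dc. now rewrite fmap_comp by dc.
Qed.

(* Only the value on composable pairs matters. *)
Definition mod_comp (g f : ModMor T) : ModMor T :=
  match excluded_middle_informative (msrc g = mtgt f) with
  | left e => mod_comp_at e
  | right _ => f
  end.

Lemma mod_compE (g f : ModMor T) (e : msrc g = mtgt f) : mod_comp g f = mod_comp_at e.
Proof.
  unfold mod_comp; destruct excluded_middle_informative as [e'|n]; [|now elim n].
  now rewrite (proof_irrelevance _ e' e).
Qed.

Program Definition ModCat : Category :=
  {| ob := Module T; mor := ModMor T; dom := @msrc C T; cod := @mtgt C T;
     idm := mod_id; comp := mod_comp |}.
Solve Obligations with (try reflexivity).
Next Obligation. intros g f e; now rewrite (mod_compE e). Qed.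
Next Obligation. intros g f e; now rewrite (mod_compE e). Qed.
Next Obligation.
  intros f; rewrite (@mod_compE (mod_id (mtgt f)) f eq_refl).
  apply modmor_ext; cbn; trivial. destruct (mmor_hom f); now apply comp_id_l'.
Qed.
Next Obligation.
  intros f; rewrite (@mod_compE f (mod_id (msrc f)) eq_refl).
  apply modmor_ext; cbn; trivial. destruct (mmor_hom f); now apply comp_id_r'.
Qed.
Next Obligation.
  intros h g f e e'.
  rewrite (mod_compE e'), (mod_compE e).
  rewrite (@mod_compE h (mod_comp_at e') e), (@mod_compE (mod_comp_at e) f e').
  apply modmor_ext; cbn; trivial.
  destruct (mmor_hom f), (mmor_hom g), (mmor_hom h); apply comp_assoc; congruence.
Qed.

Program Definition mod_tensor (M N : Module T) : Module T :=
  {| carrier := carrier M ⊠ carrier N;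
     act := (act M ⊗ act N) ∘ com2 T (carrier M) (carrier N) |}.
Next Obligation.
  intros M N; destruct (bimonadP T) as [H _].
  eapply comp_hom; [apply tmor_hom; apply act_hom | apply H].
Qed.
Next Obligation.
  intros M N.
  destruct (bimonadP T) as ((H2 & _ & N2 & _) & ((Hm & _) & Hm2 & _) & _).
  destruct (act_hom M) as [dM cM], (act_hom N) as [dN cN].
  destruct (H2 (carrier M) (carrier N)) as [d2 c2].
  destruct (H2 (T (carrier M)) (T (carrier N))) as [d2' c2'].
  destruct (Hm (carrier M)) as [dm cm], (Hm (carrier N)) as [dm' cm'].
  destruct (Hm (carrier M ⊠ carrier N)) as [dm2 cm2].
  specialize (N2 (act M) (act N)); rewrite dM, cM, dN, cN in N2.
  specialize (Hm2 (carrier M) (carrier N)); cbn in *.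
  rewrite fmap_comp by dc.
  rewrite <- comp_assoc by dc. rewrite (comp_assoc (h := com2 T _ _)) by dc.
  rewrite <- N2. rewrite <- (comp_assoc (h := act M ⊗ act N)) by dc. rewrite Hm2.
  rewrite !comp_assoc by dc. f_equal. f_equal.
  rewrite <- !tmor_comp by dc. now rewrite !act_mu.
Qed.
Next Obligation.
  intros M N.
  destruct (bimonadP T) as ((H2 & _) & _ & ((He & _) & He2 & _) & _).
  destruct (act_hom M) as [dM cM], (act_hom N) as [dN cN].
  destruct (H2 (carrier M) (carrier N)) as [d2 c2].
  destruct (He (carrier M)) as [dm cm], (He (carrier N)) as [dm' cm'].
  destruct (He (carrier M ⊠ carrier N)) as [dm2 cm2].
  specialize (He2 (carrier M) (carrier N)); cbn in *.
  rewrite <- comp_assoc by dc. rewrite He2.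
  rewrite (comp_id_r' (X := carrier M ⊠ carrier N)) by dc.
  rewrite <- tmor_comp by dc. rewrite !act_eta. apply tmor_id.
Qed.

Program Definition mod_tensor_mor (f g : ModMor T) : ModMor T :=
  {| msrc := mod_tensor (msrc f) (msrc g); mtgt := mod_tensor (mtgt f) (mtgt g);
     mmor := mmor f ⊗ mmor g |}.
Next Obligation. intros; apply tmor_hom; apply mmor_hom. Qed.
Next Obligation.
  intros f g; cbn.
  destruct (bimonadP T) as ((H2 & _ & N2 & _) & _).
  destruct (mmor_hom f) as [df cf], (mmor_hom g) as [dg cg].
  destruct (act_hom (msrc f)), (act_hom (msrc g)), (act_hom (mtgt f)), (act_hom (mtgt g)).
  destruct (H2 (carrier (msrc f)) (carrier (msrc g))).
  destruct (H2 (carrier (mtgt f)) (carrier (mtgt g))).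
  specialize (N2 (mmor f) (mmor g)); rewrite df, dg, cf, cg in N2.
  rewrite comp_assoc by dc. rewrite <- tmor_comp by dc. rewrite !mmor_lin.
  rewrite <- (comp_assoc (g := com2 T _ _)) by dc. rewrite <- N2.
  rewrite comp_assoc by dc. now rewrite <- tmor_comp by dc.
Qed.

Program Definition mod_one : Module T := {| carrier := one; act := com0 T |}.
Next Obligation. destruct (bimonadP T) as [(_ & H & _) _]; exact H. Qed.
Next Obligation. destruct (bimonadP T) as (_ & (_ & _ & H) & _); cbn in H; now rewrite H. Qed.
Next Obligation. destruct (bimonadP T) as (_ & _ & (_ & _ & H) & _); exact H. Qed.

Lemma mod_tensor_assoc : forall X Y Z : Module T,
    mod_tensor X (mod_tensor Y Z) = mod_tensor (mod_tensor X Y) Z.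
Proof.
  intros X Y Z; apply module_ext; cbn; [apply tob_assoc|].
  destruct (bimonadP T) as ((H2 & _ & _ & H3 & _) & _).
  destruct (act_hom X), (act_hom Y), (act_hom Z).
  destruct (H2 (carrier X) (carrier Y)), (H2 (carrier Y) (carrier Z)).
  destruct (H2 (carrier X ⊠ carrier Y) (carrier Z)), (H2 (carrier X) (carrier Y ⊠ carrier Z)).
  specialize (H3 (carrier X) (carrier Y) (carrier Z)); unfold com3 in H3.
  rewrite <- (comp_id_r' (X := T (carrier X)) (f := act X)) at 1 by dc.
  rewrite tmor_comp by dc. rewrite <- comp_assoc by dc. rewrite H3.
  rewrite <- (comp_id_r' (X := T (carrier Z)) (f := act Z)) at 2 by dc.
  pose proof (tob_assoc (T (carrier X)) (T (carrier Y)) (T (carrier Z))).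
  rewrite tmor_comp by dc. rewrite tmor_assoc. apply comp_assoc; dc.
Qed.

Lemma mod_tensor_1l : forall X : Module T, mod_tensor mod_one X = X.
Proof.
  intros X; apply module_ext; cbn; [apply tob_1l|].
  destruct (bimonadP T) as ((H2 & H0 & _ & _ & _ & Hc) & _).
  destruct (act_hom X), H0, (H2 one (carrier X)).
  replace (com0 T ⊗ act X) with ((idm one ⊗ act X) ∘ (com0 T ⊗ idm (T (carrier X)))).
  - pose proof (tob_1l (T (carrier X))).
    rewrite <- comp_assoc by dc. rewrite Hc, tmor_1l. now apply comp_id_r'.
  - rewrite <- tmor_comp by dc. rewrite comp_id_l' by dc. now rewrite comp_id_r' by dc.
Qed.

Lemma mod_tensor_1r : forall X : Module T, mod_tensor X mod_one = X.
Proof.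
  intros X; apply module_ext; cbn; [apply tob_1r|].
  destruct (bimonadP T) as ((H2 & H0 & _ & _ & Hc & _) & _).
  destruct (act_hom X), H0, (H2 (carrier X) one).
  replace (act X ⊗ com0 T) with ((act X ⊗ idm one) ∘ (idm (T (carrier X)) ⊗ com0 T)).
  - pose proof (tob_1r (T (carrier X))).
    rewrite <- comp_assoc by dc. rewrite Hc, tmor_1r. now apply comp_id_r'.
  - rewrite <- tmor_comp by dc. rewrite comp_id_l' by dc. now rewrite comp_id_r' by dc.
Qed.

Program Definition ModMon : MonCat :=
  {| cat := ModCat; tob := mod_tensor; tmor := mod_tensor_mor; one := mod_one |}.
Solve Obligations with (try reflexivity).
Next Obligation.
  intros; apply modmor_ext; cbn; trivial. apply tmor_id.
Qed.
Next Obligation.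
  cbn; intros g f g' f' e e'.
  rewrite (mod_compE e), (mod_compE e').
  assert (e2 : msrc (mod_tensor_mor g g') = mtgt (mod_tensor_mor f f'))
    by (cbn; now rewrite e, e').
  rewrite (mod_compE e2); apply modmor_ext; cbn; trivial.
  destruct (mmor_hom f), (mmor_hom g), (mmor_hom f'), (mmor_hom g').
  apply tmor_comp; congruence.
Qed.
Next Obligation. exact mod_tensor_assoc. Qed.
Next Obligation. exact mod_tensor_1l. Qed.
Next Obligation. exact mod_tensor_1r. Qed.
Next Obligation.
  cbn; intros f g h; apply modmor_ext; cbn.
  - exact (mod_tensor_assoc (msrc f) (msrc g) (msrc h)).
  - exact (mod_tensor_assoc (mtgt f) (mtgt g) (mtgt h)).
  - apply tmor_assoc.
Qed.
Next Obligation.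
  cbn; intros f; apply modmor_ext; cbn.
  - exact (mod_tensor_1l (msrc f)).
  - exact (mod_tensor_1l (mtgt f)).
  - apply tmor_1l.
Qed.
Next Obligation.
  cbn; intros f; apply modmor_ext; cbn.
  - exact (mod_tensor_1r (msrc f)).
  - exact (mod_tensor_1r (mtgt f)).
  - apply tmor_1r.
Qed.

Program Definition mod_forget_functor : Functor ModCat C :=
  {| fob := @carrier C T : ob ModCat -> ob C; fmap := @mmor C T : mor ModCat -> mor C |}.
Next Obligation. intros; apply mmor_hom. Qed.
Next Obligation. intros; apply mmor_hom. Qed.
Next Obligation. reflexivity. Qed.
Next Obligation. cbn; intros g f e; now rewrite (mod_compE e). Qed.

Program Definition mod_forget : MonFunctor ModMon C :=
  @strict_functor ModMon C mod_forget_functor _ _ _.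
Solve All Obligations with reflexivity.

End Modules.

Record CenterOb (A : MonCat) := {
  cob : ob A;
  hb : ob A -> mor A;
  hb_hom : forall Y, hom (cob ⊠ Y) (Y ⊠ cob) (hb Y);
  hb_nat : forall f, (f ⊗ idm cob) ∘ hb (dom f) = hb (cod f) ∘ (idm cob ⊗ f);
  hb_iso : forall Y, is_iso (hb Y);
  hb_tensor : forall Y Z, hb (Y ⊠ Z) = (idm Y ⊗ hb Z) ∘ (hb Y ⊗ idm Z);
  hb_one : hb one = idm cob
}.

Record CenterMor (A : MonCat) := {
  csrc : CenterOb A;
  ctgt : CenterOb A;
  cmor : mor A;
  cmor_hom : hom (cob csrc) (cob ctgt) cmor;
  cmor_hb : forall Y, (idm Y ⊗ cmor) ∘ hb csrc Y = hb ctgt Y ∘ (cmor ⊗ idm Y)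
}.

Section Center.
Variable A : MonCat.

Lemma center_ext (M N : CenterOb A) :
  cob M = cob N -> (forall Y, hb M Y = hb N Y) -> M = N.
Proof.
  destruct M as [M s], N as [N t]; cbn; intros -> H.
  assert (s = t) as -> by now apply functional_extensionality.
  f_equal; apply proof_irrelevance.
Qed.

Lemma centermor_ext (f g : CenterMor A) :
  csrc f = csrc g -> ctgt f = ctgt g -> cmor f = cmor g -> f = g.
Proof.
  destruct f, g; cbn; intros -> -> ->; f_equal; apply proof_irrelevance.
Qed.

Program Definition center_id (M : CenterOb A) : CenterMor A :=
  {| csrc := M; ctgt := M; cmor := idm (cob M) |}.
Next Obligation. intros; apply id_hom. Qed.
Next Obligation.
  intros; destruct (hb_hom M Y). now rewrite !tmor_id, comp_id_l', comp_id_r'.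
Qed.

Program Definition center_comp_at (g f : CenterMor A) (e : csrc g = ctgt f) : CenterMor A :=
  {| csrc := csrc f; ctgt := ctgt g; cmor := cmor g ∘ cmor f |}.
Next Obligation.
  intros; eapply comp_hom; [apply cmor_hom | rewrite e; apply cmor_hom].
Qed.
Next Obligation.
  intros; cbn.
  destruct (cmor_hom f), (cmor_hom g), (hb_hom (csrc f) Y), (hb_hom (ctgt g) Y),
    (hb_hom (ctgt f) Y).
  rewrite <- e in *.
  replace (idm Y ⊗ (cmor g ∘ cmor f)) with ((idm Y ⊗ cmor g) ∘ (idm Y ⊗ cmor f))
    by (rewrite <- tmor_comp by dc; now rewrite comp_id_l' by dc).
  replace ((cmor g ∘ cmor f) ⊗ idm Y) with ((cmor g ⊗ idm Y) ∘ (cmor f ⊗ idm Y))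
    by (rewrite <- tmor_comp by dc; now rewrite comp_id_l' by dc).
  rewrite <- comp_assoc by dc. rewrite cmor_hb, <- e.
  rewrite comp_assoc by dc. rewrite cmor_hb. now rewrite <- comp_assoc by dc.
Qed.

(* Only the value on composable pairs matters. *)
Definition center_comp (g f : CenterMor A) : CenterMor A :=
  match excluded_middle_informative (csrc g = ctgt f) with
  | left e => center_comp_at e
  | right _ => f
  end.

Lemma center_compE (g f : CenterMor A) (e : csrc g = ctgt f) :
  center_comp g f = center_comp_at e.
Proof.
  unfold center_comp; destruct excluded_middle_informative as [e'|n]; [|now elim n].
  now rewrite (proof_irrelevance _ e' e).
Qed.

Program Definition CenterCat : Category :=
  {| ob := CenterOb A; mor := CenterMor A; dom := @csrc A; cod := @ctgt A;
     idm := center_id; comp := center_comp |}.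
Solve Obligations with (try reflexivity).
Next Obligation. intros g f e; now rewrite (center_compE e). Qed.
Next Obligation. intros g f e; now rewrite (center_compE e). Qed.
Next Obligation.
  intros f; rewrite (@center_compE (center_id (ctgt f)) f eq_refl).
  apply centermor_ext; cbn; trivial. destruct (cmor_hom f); now apply comp_id_l'.
Qed.
Next Obligation.
  intros f; rewrite (@center_compE f (center_id (csrc f)) eq_refl).
  apply centermor_ext; cbn; trivial. destruct (cmor_hom f); now apply comp_id_r'.
Qed.
Next Obligation.
  intros h g f e e'.
  rewrite (center_compE e'), (center_compE e).
  rewrite (@center_compE h (center_comp_at e') e), (@center_compE (center_comp_at e) f e').
  apply centermor_ext; cbn; trivial.
  destruct (cmor_hom f), (cmor_hom g), (cmor_hom h); apply comp_assoc; congruence.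
Qed.

Lemma is_iso_comp (g f : mor A) : dom g = cod f -> is_iso g -> is_iso f -> is_iso (g ∘ f).
Proof.
  intros e (g' & (d & c) & l & r) (f' & (d' & c') & l' & r').
  exists (f' ∘ g'). split; [split; dc|]. rewrite dom_comp, cod_comp by dc. split.
  - rewrite <- comp_assoc by dc. rewrite (comp_assoc (f := f)) by dc.
    rewrite l, comp_id_l' by dc. exact l'.
  - rewrite <- comp_assoc by dc. rewrite (comp_assoc (f := g')) by dc.
    rewrite r', comp_id_l' by dc. exact r.
Qed.

Lemma is_iso_tmor (f g : mor A) : is_iso f -> is_iso g -> is_iso (f ⊗ g).
Proof.
  intros (g' & (d & c) & l & r) (f' & (d' & c') & l' & r').
  exists (g' ⊗ f'). split; [split; dc|].
  rewrite <- !tmor_comp by dc. rewrite l, l', r, r'. split; rewrite tmor_id; now dc.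
Qed.

Lemma is_iso_id (X : ob A) : is_iso (idm X).
Proof.
  exists (idm X). rewrite dom_id, cod_id. split; [apply id_hom|].
  split; apply comp_id_l'; dc.
Qed.

Lemma tmor_comp_r (X : ob A) (g f : mor A) :
  dom g = cod f -> idm X ⊗ (g ∘ f) = (idm X ⊗ g) ∘ (idm X ⊗ f).
Proof. intros; rewrite <- tmor_comp by dc. now rewrite comp_id_l' by dc. Qed.

Lemma tmor_comp_l (X : ob A) (g f : mor A) :
  dom g = cod f -> (g ∘ f) ⊗ idm X = (g ⊗ idm X) ∘ (f ⊗ idm X).
Proof. intros; rewrite <- tmor_comp by dc. now rewrite comp_id_l' by dc. Qed.

Lemma tmor_exchange (f g : mor A) :
  (idm (cod f) ⊗ g) ∘ (f ⊗ idm (dom g)) = (f ⊗ idm (cod g)) ∘ (idm (dom f) ⊗ g).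
Proof.
  rewrite <- !tmor_comp by dc. now rewrite !comp_id_l, !comp_id_r.
Qed.

Program Definition center_tensor (M N : CenterOb A) : CenterOb A :=
  {| cob := cob M ⊠ cob N;
     hb := fun Y => (hb M Y ⊗ idm (cob N)) ∘ (idm (cob M) ⊗ hb N Y) |}.
Next Obligation.
  intros M N Y; destruct (hb_hom M Y), (hb_hom N Y). split; dca.
Qed.
Next Obligation.
  intros M N f; cbn.
  destruct (hb_hom M (dom f)), (hb_hom N (dom f)), (hb_hom M (cod f)), (hb_hom N (cod f)).
  rewrite <- !tmor_id. rewrite tmor_assoc.
  rewrite comp_assoc by dca. rewrite <- tmor_comp_l by dca. rewrite hb_nat.
  rewrite tmor_comp_l by dca. rewrite <- tmor_assoc.
  rewrite <- comp_assoc by dca. rewrite <- tmor_comp_r by dca. rewrite hb_nat.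
  rewrite tmor_comp_r by dca. rewrite comp_assoc by dca. now rewrite <- tmor_assoc.
Qed.
Next Obligation.
  intros M N Y; cbn. destruct (hb_hom M Y), (hb_hom N Y).
  apply is_iso_comp; [dca|..]; apply is_iso_tmor; auto using is_iso_id, hb_iso.
Qed.
Next Obligation.
  intros M N Y Z; cbn.
  destruct (hb_hom M Y), (hb_hom N Y), (hb_hom M Z), (hb_hom N Z).
  rewrite !hb_tensor.
  rewrite (tmor_comp_r (cob M)) by dca. rewrite (tmor_comp_l (cob N)) by dca.
  rewrite (tmor_comp_r Y) by dca.
  rewrite (tmor_comp_l Z) by dca.
  rewrite <- !tmor_assoc.
  assert (E : (hb M Y ⊗ idm (Z ⊠ cob N)) ∘ (idm (cob M ⊠ Y) ⊗ hb N Z)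
            = (idm (Y ⊠ cob M) ⊗ hb N Z) ∘ (hb M Y ⊗ idm (cob N ⊠ Z))).
  { pose proof (tmor_exchange (hb M Y) (hb N Z)) as E. symmetry. congruence. }
  rewrite <- !tmor_id in E. rewrite <- !tmor_assoc in E.
  rewrite <- (comp_assoc (h := idm Y ⊗ hb M Z ⊗ idm (cob N))) by dca.
  rewrite (comp_assoc (h := hb M Y ⊗ idm Z ⊗ idm (cob N))) by dca.
  rewrite E.
  rewrite <- (comp_assoc (g := hb M Y ⊗ _)) by dca.
  now rewrite (comp_assoc (h := idm Y ⊗ hb M Z ⊗ idm (cob N))) by dca.
Qed.
Next Obligation.
  intros M N; cbn. rewrite !hb_one, !tmor_id. apply comp_id_l'; dca.
Qed.

Program Definition center_tensor_mor (f g : CenterMor A) : CenterMor A :=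
  {| csrc := center_tensor (csrc f) (csrc g); ctgt := center_tensor (ctgt f) (ctgt g);
     cmor := cmor f ⊗ cmor g |}.
Next Obligation. intros; apply tmor_hom; apply cmor_hom. Qed.
Next Obligation.
  intros f g Y; cbn.
  destruct (cmor_hom f), (cmor_hom g), (hb_hom (csrc f) Y), (hb_hom (csrc g) Y),
    (hb_hom (ctgt f) Y), (hb_hom (ctgt g) Y).
  rewrite tmor_assoc.
  rewrite comp_assoc by dca. rewrite <- tmor_comp by dca.
  rewrite cmor_hb, (comp_id_r' (f := cmor g)) by dca.
  rewrite <- (comp_id_l' (X := cob (ctgt g)) (f := cmor g)) at 1 by dca.
  rewrite tmor_comp by dca. rewrite <- !tmor_assoc.
  rewrite <- comp_assoc by dca. rewrite <- tmor_comp by dca.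
  rewrite cmor_hb, (comp_id_r' (f := cmor f)) by dca.
  rewrite <- (comp_id_l' (X := cob (ctgt f)) (f := cmor f)) at 1 by dca.
  rewrite tmor_comp by dca. apply comp_assoc; dca.
Qed.

Program Definition center_one : CenterOb A := {| cob := one; hb := fun Y => idm Y |}.
Next Obligation. intros Y; cbn; rewrite tob_1l, tob_1r; apply id_hom. Qed.
Next Obligation.
  intros f; cbn; now rewrite tmor_1l, tmor_1r, comp_id_l, comp_id_r.
Qed.
Next Obligation. intros; apply is_iso_id. Qed.
Next Obligation. intros; cbn; rewrite !tmor_id; symmetry; apply comp_id_l'; dc. Qed.
Next Obligation. reflexivity. Qed.

Lemma center_tensor_assoc (X Y Z : CenterOb A) :
  center_tensor X (center_tensor Y Z) = center_tensor (center_tensor X Y) Z.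
Proof.
  apply center_ext; cbn; [apply tob_assoc|]; intros W.
  destruct (hb_hom X W), (hb_hom Y W), (hb_hom Z W).
  rewrite (tmor_comp_r (cob X)) by dca. rewrite (tmor_comp_l (cob Z)) by dca.
  rewrite <- !tmor_id, <- !tmor_assoc. apply comp_assoc; dca.
Qed.

Lemma center_tensor_1l (X : CenterOb A) : center_tensor center_one X = X.
Proof.
  apply center_ext; cbn; [apply tob_1l|]; intros W. destruct (hb_hom X W).
  rewrite tmor_id, tmor_1l. now apply comp_id_l'.
Qed.

Lemma center_tensor_1r (X : CenterOb A) : center_tensor X center_one = X.
Proof.
  apply center_ext; cbn; [apply tob_1r|]; intros W. destruct (hb_hom X W).
  rewrite tmor_id, tmor_1r. now apply comp_id_r'.
Qed.

Program Definition CenterMon : MonCat :=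
  {| cat := CenterCat; tob := center_tensor; tmor := center_tensor_mor; one := center_one |}.
Solve Obligations with (try reflexivity).
Next Obligation. intros; apply centermor_ext; cbn; trivial. apply tmor_id. Qed.
Next Obligation.
  cbn; intros g f g' f' e e'.
  rewrite (center_compE e), (center_compE e').
  assert (e2 : csrc (center_tensor_mor g g') = ctgt (center_tensor_mor f f'))
    by (cbn; now rewrite e, e').
  rewrite (center_compE e2); apply centermor_ext; cbn; trivial.
  destruct (cmor_hom f), (cmor_hom g), (cmor_hom f'), (cmor_hom g').
  apply tmor_comp; congruence.
Qed.
Next Obligation. exact center_tensor_assoc. Qed.
Next Obligation. exact center_tensor_1l. Qed.
Next Obligation. exact center_tensor_1r. Qed.
Next Obligation.
  cbn; intros f g h; apply centermor_ext; cbn;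
    auto using center_tensor_assoc, tmor_assoc.
Qed.
Next Obligation.
  cbn; intros f; apply centermor_ext; cbn; auto using center_tensor_1l, tmor_1l.
Qed.
Next Obligation.
  cbn; intros f; apply centermor_ext; cbn; auto using center_tensor_1r, tmor_1r.
Qed.

Program Definition center_braid (M N : CenterOb A) : CenterMor A :=
  {| csrc := center_tensor M N; ctgt := center_tensor N M; cmor := hb M (cob N) |}.
Next Obligation. intros; apply hb_hom. Qed.
Next Obligation.
  intros M N Y; cbn.
  destruct (hb_hom M Y), (hb_hom N Y), (hb_hom M (cob N)).
  rewrite comp_assoc by dca. rewrite <- hb_tensor.
  pose proof (hb_nat M (hb N Y)) as E.
  rewrite H1, H2 in E. rewrite <- E. rewrite hb_tensor. now rewrite comp_assoc by dca.
Qed.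

Lemma center_is_iso (f : CenterMor A) : is_iso (cmor f) -> @is_iso CenterCat f.
Proof.
  intros (g & (d & c) & l & r). destruct (cmor_hom f) as [df cf].
  rewrite df, cf in *.
  assert (H : forall Y, (idm Y ⊗ g) ∘ hb (ctgt f) Y = hb (csrc f) Y ∘ (g ⊗ idm Y)).
  { intros Y. destruct (hb_hom (csrc f) Y), (hb_hom (ctgt f) Y).
    rewrite <- (comp_id_r' (X := cob (ctgt f) ⊠ Y) (f := hb (ctgt f) Y)) by dca.
    rewrite <- (tmor_id (cob (ctgt f))), <- r, (tmor_comp_l Y) by dca.
    rewrite (comp_assoc (h := hb (ctgt f) Y)) by dca. rewrite <- cmor_hb.
    rewrite !(comp_assoc (h := idm Y ⊗ g)) by dca. rewrite <- (tmor_comp_r Y) by dca.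
    rewrite l, tmor_id. now rewrite comp_id_l' by dca. }
  exists (@Build_CenterMor A (ctgt f) (csrc f) g (conj d c) H). cbn.
  split; [now split|]. split.
  - unshelve erewrite center_compE; [reflexivity|]. now apply centermor_ext.
  - unshelve erewrite center_compE; [reflexivity|]. now apply centermor_ext.
Qed.

Lemma center_is_braiding : @is_braiding CenterMon center_braid.
Proof.
  repeat split.
  - intros M N. apply center_is_iso. apply hb_iso.
  - intros f g; cbn. unshelve erewrite !center_compE; try reflexivity.
    apply centermor_ext; cbn; trivial.
    destruct (cmor_hom f), (cmor_hom g), (hb_hom (csrc f) (cob (csrc g))),
      (hb_hom (ctgt f) (cob (csrc g))), (hb_hom (ctgt f) (cob (ctgt g))).
    pose proof (hb_nat (ctgt f) (cmor g)) as E. rewrite H1, H2 in E.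
    rewrite <- (comp_id_r' (X := cob (csrc g)) (f := cmor g)) at 1 by dca.
    rewrite <- (comp_id_l' (X := cob (ctgt f)) (f := cmor f)) at 1 by dca.
    rewrite tmor_comp by dca. rewrite <- comp_assoc by dca. rewrite cmor_hb.
    rewrite comp_assoc by dca. rewrite E. rewrite <- comp_assoc by dca.
    rewrite <- tmor_comp by dca. now rewrite comp_id_l', comp_id_r' by dca.
  - intros X Y Z; cbn.
    unshelve erewrite center_compE; [cbn; apply center_tensor_assoc|].
    apply centermor_ext; cbn; auto using center_tensor_assoc, hb_tensor.
  - intros X Y Z; cbn.
    unshelve erewrite center_compE; [cbn; symmetry; apply center_tensor_assoc|].
    apply centermor_ext; cbn; auto using center_tensor_assoc.
Qed.

Definition Center : BraidedCat := {| bmon := CenterMon; braid := _; braidP := center_is_braiding |}.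

Program Definition center_forget_functor : Functor CenterCat A :=
  {| fob := @cob A : ob CenterCat -> ob A; fmap := @cmor A : mor CenterCat -> mor A |}.
Next Obligation. intros; apply cmor_hom. Qed.
Next Obligation. intros; apply cmor_hom. Qed.
Next Obligation. reflexivity. Qed.
Next Obligation. cbn; intros g f e; now rewrite (center_compE e). Qed.

Program Definition center_forget : MonFunctor Center A :=
  @strict_functor Center A center_forget_functor _ _ _.
Solve All Obligations with reflexivity.

End Center.

Record Centralizer (C : MonCat) (T : Functor C C) := {
  cent :> Functor C C;
  del : ob C -> ob C -> mor C;
  del_hom : forall X Y, hom (X ⊠ Y) (T Y ⊠ cent X) (del X Y);
  del_nat : forall f g,
    (T $ g ⊗ cent $ f) ∘ del (dom f) (dom g) = del (cod f) (cod g) ∘ (f ⊗ g);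
  del_univ : forall (X W : ob C) (xi : ob C -> mor C),
    (forall Y, hom (X ⊠ Y) (T Y ⊠ W) (xi Y)) ->
    (forall g, (T $ g ⊗ idm W) ∘ xi (dom g) = xi (cod g) ∘ (idm X ⊗ g)) ->
    exists! r, hom (cent X) W r /\ forall Y, xi Y = (idm (T Y) ⊗ r) ∘ del X Y
}.

(* m, u, (Z_T)_2 and (Z_T)_0; by the universal property the equations determine them. *)
Record CentralizerStructure (C : AutonomousCat) (T : HopfMonad C) (Z : Centralizer T) := {
  zmu : ob C -> mor C;
  zeta : ob C -> mor C;
  zcom2 : ob C -> ob C -> mor C;
  zcom0 : mor C;
  zmu_nat : natural (comp_functor Z Z) Z zmu;
  zeta_nat : natural (id_functor C) Z zeta;
  zcom2_hom : forall X Y, hom (Z (X ⊠ Y)) (Z X ⊠ Z Y) (zcom2 X Y);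
  zcom2_nat : forall f g,
    (Z $ f ⊗ Z $ g) ∘ zcom2 (dom f) (dom g) = zcom2 (cod f) (cod g) ∘ Z $ (f ⊗ g);
  zcom0_hom : hom (Z one) one zcom0;
  zmu_eq : forall X Y1 Y2,
    (idm (T Y1 ⊠ T Y2) ⊗ zmu X) ∘ (idm (T Y1) ⊗ del Z (Z X) Y2) ∘ (del Z X Y1 ⊗ idm Y2)
    = (com2 T Y1 Y2 ⊗ idm (Z X)) ∘ del Z X (Y1 ⊠ Y2);
  zeta_eq : forall X, zeta X = (com0 T ⊗ idm (Z X)) ∘ del Z X one;
  zcom2_eq : forall X1 X2 Y,
    (idm (T Y) ⊗ zcom2 X1 X2) ∘ del Z (X1 ⊠ X2) Y
    = (mu T Y ⊗ idm (Z X1 ⊠ Z X2)) ∘ (del Z X1 (T Y) ⊗ idm (Z X2)) ∘ (idm X1 ⊗ del Z X2 Y);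
  zcom0_eq : forall Y, (idm (T Y) ⊗ zcom0) ∘ del Z one Y = eta T Y
}.

Section Double.
Variables (C : AutonomousCat) (T : HopfMonad C) (Z : Centralizer T).

Definition cent_bimonad_data (S : CentralizerStructure Z) : BimonadData C :=
  {| bfun := {| cfun := Z; com2 := zcom2 S; com0 := zcom0 S |};
     mu := zmu S; eta := zeta S |}.

(** i_{X,Y} : ldual (T Y) ⊠ X ⊠ Y → Z X *)
Definition cent_i (X Y : ob C) : mor C :=
  (ev (T Y) ⊗ idm (Z X)) ∘ (idm (ldual (T Y)) ⊗ del Z X Y).

Record CanonicalLaw := {
  Om :> ob C -> mor C;
  Om_nat : natural (comp_functor T Z) (comp_functor Z T) Om;
  Om_eq : forall X Y,
    Om X ∘ T $ cent_i X Y
    = cent_i (T X) (T Y)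
      ∘ ((ldualm (mu T Y) ∘ sl T (T Y) ∘ T $ ldualm (mu T Y)) ⊗ idm (T X ⊠ T Y))
      ∘ com3 T (ldual (T Y)) X Y
}.

Variables (S : CentralizerStructure Z) (Omega : CanonicalLaw).

Definition double : BimonadData C :=
  {| bfun := comp_comon (cent_bimonad_data S) T;
     mu := fun X => zmu S (T X) ∘ Z $ (Z $ mu T X) ∘ Z $ Omega (T X);
     eta := fun X => zeta S (T X) ∘ eta T X |}.

Definition double_R (X Y : ob C) : mor C :=
  (zeta S (T Y) ⊗ Z $ eta T X) ∘ del Z X Y.

End Double.

Program Definition center_mod_forget (C : MonCat) (T : Bimonad C) :
    MonFunctor (Center (ModMon T)) C :=
  @strict_functor (Center (ModMon T)) C
    (comp_functor (mod_forget_functor T) (center_forget_functor (ModMon T))) _ _ _.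
Solve All Obligations with reflexivity.

(* Main.v *)
(** A module over the double [D_T] amounts to a module over [T] with a compatible action [ρ] of
    [Z_T], and by the universal property of [∂] an action of [Z_T] amounts to the half braiding
    [(s ⊗ ρ) ∂], which is determined by its values on free [T]-modules; the inverse of the half
    braiding of [N] is given by the half braiding of the right dual of [N].

    The axioms of [D_T] and the compatibility conditions are equations between morphisms from
    objects such as [T (Z_T X)].  They are tested by families [P_i → Q_i ⊗ V] obtained from [∂].
    Such families remain jointly faithful after application of [T], because the antipodes recover
    [f : T V → W] from [s^r ∘ T(f^∨) : T(W^∨) → V^∨].  The canonical law satisfies
    [(μ_Y ⊗ Ω_X) T_2 T(∂_{X,Y}) = (μ_Y ⊗ id) ∂_{TX,TY} T_2], which says what these tests give
    on [Ω], and all the properties of [Ω] follow from this equation. *)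
From Stdlib Require Import List Arith Bool.
From Stdlib Require Import ClassicalEpsilon ProofIrrelevance FunctionalExtensionality.
Require Import Defs.
Import ListNotations.

Set Implicit Arguments.
Unset Strict Implicit.
Unset Printing Implicit Defensive.

#[local] Obligation Tactic := idtac.

(** * String diagrams *)

(* A morphism is represented by the list of the slices [idm l ⊗ g ⊗ idm r] of a string diagram,
   read from source to target; equality is decided by means of a normal form with respect to
   the exchange of independent slices.  Objects are words, so that the product is strictly
   associative and unital, and [WApp k u w] is [F_k u ⊠ w]. *)

(** The obstacle is that [del] is universal in [C], whereas most equations to be tested start from
    an object [T V]. Joint faithfulness alone is carried over to [T V], by duality: bending the
    wires of [sr T V ∘ T $ rdualm f] gives a morphism from [V] to [ldual (T (rdual W))], naturally
    in [V], and [f] can be recovered from it. So morphisms from [T V] to [W] embed into morphisms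
    from [V] to [ldual (T (rdual W))]; this is the injective half of an adjunction between [T] and
    [ldual (T (rdual -))].

    A test family has the form [P → Q ⊠ V], but after [T] and [com2] its left factor is [T Q]. If
    [Q] carries a module, its action absorbs this [T], and the construction can be iterated. This is
    the origin of [mu T Y] in the equation for [Omega] without antipode: the module there is the
    free one on [Y].

    The braiding on modules over the double is transported from the center, so its axioms are
    inherited, and what remains is to compare its formula with the R-matrix. *)

Inductive oexp := OOne | OVar (n : nat) | OTen (a b : oexp) | OApp (k : nat) (a : oexp).

Inductive exp :=
| EId (o : oexp) | EVar (n : nat) | EComp (g f : exp) | ETen (f g : exp) | EApp (k : nat) (f : exp).

Inductive word := WNil | WVar (n : nat) (w : word) | WApp (k : nat) (u w : word).

(** The functors are arbitrary, so a slice inside [F_k] cannot be spread over separate wires: its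
    image under [F_k] counts as a single generator, with all its surrounding wires. *)
Inductive gen := GVar (n : nat) | GApp (k : nat) (l : word) (g : gen) (r : word).

Definition slice : Type := word * gen * word.

Fixpoint wapp (u v : word) : word :=
  match u with
  | WNil => v
  | WVar n u => WVar n (wapp u v)
  | WApp k a u => WApp k a (wapp u v)
  end.

Fixpoint weqb (u v : word) : bool :=
  match u, v with
  | WNil, WNil => true
  | WVar n u, WVar m v => Nat.eqb n m && weqb u v
  | WApp k a u, WApp j b v => Nat.eqb k j && weqb a b && weqb u v
  | _, _ => false
  end.

Fixpoint geqb (g h : gen) : bool :=
  match g, h with
  | GVar n, GVar m => Nat.eqb n m
  | GApp k l g r, GApp j l' h r' => Nat.eqb k j && weqb l l' && geqb g h && weqb r r'
  | _, _ => false
  end.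

Definition seqb (s t : slice) : bool :=
  let '(l, g, r) := s in let '(l', h, r') := t in weqb l l' && geqb g h && weqb r r'.

Fixpoint sseqb (s t : list slice) : bool :=
  match s, t with
  | [], [] => true
  | a :: s, b :: t => seqb a b && sseqb s t
  | _, _ => false
  end.

Fixpoint flat (o : oexp) : word :=
  match o with
  | OOne => WNil
  | OVar n => WVar n WNil
  | OTen a b => wapp (flat a) (flat b)
  | OApp k a => WApp k (flat a) WNil
  end.

Definition sig := list (oexp * oexp).

Fixpoint gdom (sg : sig) (g : gen) : word :=
  match g with
  | GVar n => flat (fst (nth n sg (OOne, OOne)))
  | GApp k l g r => WApp k (wapp l (wapp (gdom sg g) r)) WNil
  end.

Fixpoint gcod (sg : sig) (g : gen) : word :=
  match g with
  | GVar n => flat (snd (nth n sg (OOne, OOne)))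
  | GApp k l g r => WApp k (wapp l (wapp (gcod sg g) r)) WNil
  end.

Definition wh (u v : word) (s : slice) : slice :=
  let '(l, g, r) := s in (wapp u l, g, wapp r v).

Definition fapp (k : nat) (s : slice) : slice :=
  let '(l, g, r) := s in (WNil, GApp k l g r, WNil).

Fixpoint nf (sg : sig) (e : exp) : option (word * list slice * word) :=
  match e with
  | EId o => Some (flat o, [], flat o)
  | EVar n => let '(d, c) := nth n sg (OOne, OOne) in
      Some (flat d, [(WNil, GVar n, WNil)], flat c)
  | EComp g f =>
      match nf sg f, nf sg g with
      | Some (a, s, b), Some (b', t, c) => if weqb b b' then Some (a, s ++ t, c) else None
      | _, _ => None
      end
  | ETen f g =>
      match nf sg f, nf sg g with
      | Some (a, s, b), Some (a', t, b') =>
          Some (wapp a a', map (wh WNil a') s ++ map (wh b WNil) t, wapp b b')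
      | _, _ => None
      end
  | EApp k f =>
      match nf sg f with
      | Some (a, s, b) => Some (WApp k a WNil, map (fapp k) s, WApp k b WNil)
      | None => None
      end
  end.

Fixpoint strip (u v : word) : option word :=
  match u, v with
  | WNil, _ => Some v
  | WVar n u, WVar m v => if Nat.eqb n m then strip u v else None
  | WApp k a u, WApp j b v => if Nat.eqb k j && weqb a b then strip u v else None
  | _, _ => None
  end.

(** Exchange of two consecutive slices [s] and [t], when [t] lies on the left of [s]. *)
Definition swap (sg : sig) (s t : slice) : option (slice * slice) :=
  let '(l1, g1, r1) := s in let '(l2, g2, r2) := t in
  match strip (wapp l2 (gdom sg g2)) l1 with
  | Some m =>
      if weqb r2 (wapp m (wapp (gcod sg g1) r1)) then
        Some ((l2, g2, wapp m (wapp (gdom sg g1) r1)), (wapp l2 (wapp (gcod sg g2) m), g1, r1))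
      else None
  | None => None
  end.

Fixpoint bubble (sg : sig) (s : slice) (ss : list slice) : list slice :=
  match ss with
  | [] => [s]
  | t :: ss => match swap sg s t with
               | Some (a, b) => a :: bubble sg b ss
               | None => s :: bubble sg t ss
               end
  end.

Definition pass (sg : sig) (ss : list slice) : list slice :=
  match ss with [] => [] | s :: ss => bubble sg s ss end.

Fixpoint sort (sg : sig) (fuel : nat) (ss : list slice) : list slice :=
  match fuel with
  | 0 => ss
  | S n => let ss' := pass sg ss in if sseqb ss ss' then ss else sort sg n ss'
  end.

(** The value bears only on how far the search goes: [sort_sound] holds for every number of passes,
    so a bound that is too small makes [check] fail, never accept a false equation. *)
Definition fuel := 200.

Definition check (sg : sig) (e e' : exp) : bool :=
  match nf sg e, nf sg e' with
  | Some (a, s, b), Some (a', s', b') =>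
      weqb a a' && weqb b b' && sseqb (sort sg fuel s) (sort sg fuel s')
  | _, _ => false
  end.

Definition check_hom (sg : sig) (x y : oexp) (e : exp) : bool :=
  match nf sg e with
  | Some (a, _, b) => weqb a (flat x) && weqb b (flat y)
  | None => false
  end.

Lemma weqb_eq u v : weqb u v = true -> u = v.
Proof.
  revert v; induction u as [|n u IH|k a IHa u IH]; intros [|m v|j b v]; cbn; try easy;
    rewrite ?andb_true_iff, ?Nat.eqb_eq.
  - intros [-> H]; f_equal; auto.
  - intros [[-> H] H']; f_equal; auto.
Qed.

Lemma geqb_eq g h : geqb g h = true -> g = h.
Proof.
  revert h; induction g as [n|k l g IH r]; intros [m|j l' h r']; cbn; try easy;
    rewrite ?andb_true_iff, ?Nat.eqb_eq.
  - now intros ->.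
  - intros [[[-> H] H'] H'']; f_equal; auto using weqb_eq.
Qed.

Lemma sseqb_eq s t : sseqb s t = true -> s = t.
Proof.
  revert t; induction s as [|[[l g] r] s IH]; intros [|[[l' h] r'] t]; cbn; try easy.
  rewrite !andb_true_iff. intros [[[H1 H2] H3] H4].
  f_equal; auto. f_equal; auto using weqb_eq. f_equal; auto using weqb_eq, geqb_eq.
Qed.

Lemma wapp_nil u : wapp u WNil = u.
Proof. induction u; cbn; congruence. Qed.

Lemma wapp_assoc u v w : wapp u (wapp v w) = wapp (wapp u v) w.
Proof. induction u; cbn; congruence. Qed.

Lemma strip_eq u v w : strip u v = Some w -> v = wapp u w.
Proof.
  revert v; induction u as [|n u IH|k a IHa u IH]; intros [|m v|j b v]; cbn;
    try easy; try congruence.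
  - destruct (Nat.eqb n m) eqn:E; [|easy]. apply Nat.eqb_eq in E as ->.
    intros; f_equal; auto.
  - destruct (Nat.eqb k j) eqn:E; [|easy]. apply Nat.eqb_eq in E as ->. cbn.
    destruct (weqb a b) eqn:E'; [|easy]. apply weqb_eq in E' as ->.
    intros; f_equal; auto.
Qed.

Section Denotation.
Variables (C : MonCat) (fs : list (Functor C C)) (os : list (ob C)).

Definition fn (k : nat) : Functor C C := nth k fs (id_functor C).

Fixpoint oden (o : oexp) : ob C :=
  match o with
  | OOne => one
  | OVar n => nth n os one
  | OTen a b => oden a ⊠ oden b
  | OApp k a => fn k (oden a)
  end.

Variables (ms : list (mor C)).

Fixpoint eden (e : exp) : mor C :=
  match e with
  | EId o => idm (oden o)
  | EVar n => nth n ms (idm one)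
  | EComp g f => eden g ∘ eden f
  | ETen f g => eden f ⊗ eden g
  | EApp k f => fn k $ eden f
  end.

Fixpoint wden (w : word) : ob C :=
  match w with
  | WNil => one
  | WVar n w => nth n os one ⊠ wden w
  | WApp k u w => fn k (wden u) ⊠ wden w
  end.

Fixpoint gden (g : gen) : mor C :=
  match g with
  | GVar n => nth n ms (idm one)
  | GApp k l g r => fn k $ (idm (wden l) ⊗ gden g ⊗ idm (wden r))
  end.

Definition sden (s : slice) : mor C :=
  let '(l, g, r) := s in idm (wden l) ⊗ gden g ⊗ idm (wden r).

Fixpoint run (c : word) (ss : list slice) : mor C :=
  match ss with
  | [] => idm (wden c)
  | s :: ss => run c ss ∘ sden s
  end.

Lemma wden_app u v : wden (wapp u v) = wden u ⊠ wden v.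
Proof.
  induction u; cbn; [now rewrite tob_1l | |]; rewrite IHu || rewrite IHu2; apply tob_assoc.
Qed.

Lemma flat_den o : wden (flat o) = oden o.
Proof.
  induction o; cbn; rewrite ?wden_app, ?tob_1r; congruence.
Qed.

Variable sg : sig.
Definition sig_ok := Forall2 (fun m dc => hom (oden (fst dc)) (oden (snd dc)) m) ms sg.
Hypothesis ok : sig_ok.

(** Beyond the end of the lists the defaults match: [idm one] has the type that [(OOne, OOne)]
    prescribes. *)
Lemma var_hom n :
  hom (wden (flat (fst (nth n sg (OOne, OOne))))) (wden (flat (snd (nth n sg (OOne, OOne)))))
    (nth n ms (idm one)).
Proof.
  rewrite !flat_den. revert n. unfold sig_ok in ok.
  induction ok as [|m dc ms' sg' H1 H2 IH]; intros [|n]; cbn; auto using id_hom.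
Qed.

Lemma whisker_hom l r X Y f :
  hom (wden X) (wden Y) f ->
  hom (wden (wapp l (wapp X r))) (wden (wapp l (wapp Y r))) (idm (wden l) ⊗ f ⊗ idm (wden r)).
Proof. intros; rewrite !wden_app. auto using tmor_hom, id_hom. Qed.

Lemma gen_hom g : hom (wden (gdom sg g)) (wden (gcod sg g)) (gden g).
Proof.
  induction g; cbn; [apply var_hom|].
  rewrite !tob_1r. now apply fmap_hom, whisker_hom.
Qed.

Definition sdom (s : slice) : word := let '(l, g, r) := s in wapp l (wapp (gdom sg g) r).
Definition scod (s : slice) : word := let '(l, g, r) := s in wapp l (wapp (gcod sg g) r).

Lemma slice_hom s : hom (wden (sdom s)) (wden (scod s)) (sden s).
Proof. destruct s as [[l g] r]. apply whisker_hom, gen_hom. Qed.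

Fixpoint typed (a : word) (ss : list slice) (c : word) : Prop :=
  match ss with
  | [] => a = c
  | s :: ss => a = sdom s /\ typed (scod s) ss c
  end.

Lemma run_hom a ss c : typed a ss c -> hom (wden a) (wden c) (run c ss).
Proof.
  revert a; induction ss as [|s ss IH]; cbn.
  - intros a ->; apply id_hom.
  - intros a [-> H]. eapply comp_hom; [apply IH, H | apply slice_hom].
Qed.

Lemma typed_app a s b t c : typed a s b -> typed b t c -> typed a (s ++ t) c.
Proof.
  revert a; induction s as [|x s IH]; cbn; [now intros a ->|]. intros a [-> H]; auto.
Qed.

Lemma run_app a s b t c :
  typed a s b -> typed b t c -> run c (s ++ t) = run c t ∘ run b s.
Proof.
  intros Hs Ht; revert a Hs; induction s as [|x s IH]; cbn; intros a Hs.
  - destruct (run_hom Ht). now rewrite comp_id_r'.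
  - destruct Hs as [-> Hs]. rewrite (IH _ Hs).
    destruct (run_hom Ht), (run_hom Hs), (slice_hom x). symmetry; apply comp_assoc; congruence.
Qed.

Lemma sdom_wh u v s : sdom (wh u v s) = wapp u (wapp (sdom s) v).
Proof. destruct s as [[l g] r]; cbn. now rewrite !wapp_assoc. Qed.

Lemma scod_wh u v s : scod (wh u v s) = wapp u (wapp (scod s) v).
Proof. destruct s as [[l g] r]; cbn. now rewrite !wapp_assoc. Qed.

Lemma typed_wh u v a ss c :
  typed a ss c -> typed (wapp u (wapp a v)) (map (wh u v) ss) (wapp u (wapp c v)).
Proof.
  revert a; induction ss as [|s ss IH]; cbn; [now intros a ->|]. intros a [-> H].
  rewrite sdom_wh, scod_wh; auto.
Qed.

Lemma sden_wh u v s : sden (wh u v s) = idm (wden u) ⊗ sden s ⊗ idm (wden v).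
Proof.
  destruct s as [[l g] r]; cbn. rewrite !wden_app, <- !tmor_id. now rewrite <- !tmor_assoc.
Qed.

Lemma run_wh u v a ss c : typed a ss c ->
  run (wapp u (wapp c v)) (map (wh u v) ss) = idm (wden u) ⊗ run c ss ⊗ idm (wden v).
Proof.
  revert a; induction ss as [|s ss IH]; cbn; intros a H.
  - now rewrite !wden_app, !tmor_id.
  - destruct H as [-> H]. rewrite (IH _ H), sden_wh.
    destruct (run_hom H), (slice_hom s).
    rewrite <- tmor_comp by dc. rewrite <- tmor_comp by dc.
    now rewrite !comp_id_l' by dc.
Qed.

Lemma typed_fapp k a ss c :
  typed a ss c -> typed (WApp k a WNil) (map (fapp k) ss) (WApp k c WNil).
Proof.
  revert a; induction ss as [|s ss IH]; cbn; [now intros a ->|]. intros a [-> H].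
  destruct s as [[l g] r]; cbn in *. split; auto.
Qed.

Lemma run_fapp k a ss c : typed a ss c ->
  run (WApp k c WNil) (map (fapp k) ss) = fn k $ run c ss.
Proof.
  revert a; induction ss as [|s ss IH]; cbn; intros a H.
  - now rewrite fmap_id, tob_1r.
  - destruct H as [-> H]. rewrite (IH _ H). destruct (run_hom H), (slice_hom s).
    rewrite fmap_comp by congruence. f_equal. destruct s as [[l g] r]; cbn.
    now rewrite tmor_1l, tmor_1r.
Qed.

Lemma nf_sound e a ss c :
  nf sg e = Some (a, ss, c) ->
  typed a ss c /\ wden a = dom (eden e) /\ wden c = cod (eden e) /\ eden e = run c ss.
Proof.
  enough (nf sg e = Some (a, ss, c) -> typed a ss c /\ eden e = run c ss) as H.
  { intros E; destruct (H E) as [H1 ->]. destruct (run_hom H1). auto. }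
  revert a ss c; induction e as [o|n|g IHg f IHf|f IHf g IHg|k f IHf]; cbn; intros a ss c.
  - intros [= <- <- <-]. cbn. now rewrite flat_den.
  - destruct (nth n sg (OOne, OOne)) as [d c'] eqn:E. intros [= <- <- <-]. cbn.
    rewrite E, !wapp_nil. repeat split.
    pose proof (var_hom n) as [H1 H2]; rewrite E in H1, H2; cbn in *.
    rewrite tmor_1l, tmor_1r. now rewrite comp_id_l'.
  - destruct (nf sg f) as [[[a1 s1] b1]|]; [|easy].
    destruct (nf sg g) as [[[a2 s2] b2]|]; [|easy].
    destruct (weqb b1 a2) eqn:E; [|easy]. apply weqb_eq in E as ->.
    intros [= <- <- <-].
    destruct (IHf _ _ _ eq_refl) as [H1 ->], (IHg _ _ _ eq_refl) as [H2 ->].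
    split; [eauto using typed_app|]. symmetry; eapply run_app; eauto.
  - destruct (nf sg f) as [[[a1 s1] b1]|]; [|easy].
    destruct (nf sg g) as [[[a2 s2] b2]|]; [|easy].
    intros [= <- <- <-].
    destruct (IHf _ _ _ eq_refl) as [H1 ->], (IHg _ _ _ eq_refl) as [H2 ->].
    pose proof (typed_wh WNil a2 H1) as T1. pose proof (typed_wh b1 WNil H2) as T2.
    pose proof (run_wh WNil a2 H1) as R1. pose proof (run_wh b1 WNil H2) as R2.
    cbn in T1, R1. rewrite !wapp_nil in T2. rewrite wapp_nil in R2.
    split; [eauto using typed_app|]. rewrite (run_app T1 T2), R1, R2. cbn.
    destruct (run_hom H1), (run_hom H2).
    rewrite tmor_1l, tmor_1r, <- tmor_comp by dc. now rewrite comp_id_l', comp_id_r' by dc.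
  - destruct (nf sg f) as [[[a1 s1] b1]|]; [|easy]. intros [= <- <- <-].
    destruct (IHf _ _ _ eq_refl) as [H1 ->]. split; [now apply typed_fapp|].
    symmetry; eapply run_fapp; eauto.
Qed.

(** The exchange law: both composites denote [g2] beside [g1], each acting on wires which the other
    leaves alone. *)
Lemma swap_sound s t s' t' a b :
  swap sg s t = Some (s', t') -> typed a [s; t] b ->
  typed a [s'; t'] b /\ sden t ∘ sden s = sden t' ∘ sden s'.
Proof.
  destruct s as [[l1 g1] r1], t as [[l2 g2] r2]; cbn -[typed].
  destruct (strip _ _) as [m|] eqn:E; [|easy]. apply strip_eq in E as ->.
  destruct (weqb _ _) eqn:E; [|easy]. apply weqb_eq in E as ->.
  intros [= <- <-]. cbn. intros (-> & _ & <-). rewrite !wapp_assoc. repeat split.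
  rewrite !wden_app, <- !tmor_id, <- !tmor_assoc.
  destruct (gen_hom g1), (gen_hom g2).
  rewrite <- !tmor_comp by dc.
  now rewrite !comp_id_l', !comp_id_r' by dc.
Qed.

Lemma bubble_sound s ss a c :
  typed a (s :: ss) c ->
  typed a (bubble sg s ss) c /\ run c (bubble sg s ss) = run c (s :: ss).
Proof.
  revert s a; induction ss as [|t ss IH]; intros s a; [easy|].
  intros H. cbn [bubble]. destruct (swap sg s t) as [[s' t']|] eqn:E.
  - destruct H as (Ha & Hst & H).
    destruct (@swap_sound s t s' t' a (scod t) E) as [(Ha' & Hst' & Ht') E'].
    { repeat split; assumption. }
    rewrite <- Ht' in H. destruct (IH t' (scod s') (conj Hst' H)) as [H1 H2].
    split; [split; auto|]. change (run c (s' :: bubble sg t' ss)) with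
      (run c (bubble sg t' ss) ∘ sden s'). rewrite H2. cbn [run].
    destruct (run_hom H), (slice_hom s), (slice_hom t), (slice_hom s'), (slice_hom t').
    rewrite <- !comp_assoc by congruence. now rewrite E'.
  - destruct H as (Ha & H). destruct (IH t _ H) as [H1 H2].
    split; [split; auto|]. cbn [run] in *. now rewrite H2.
Qed.

Lemma sort_sound n a ss c :
  typed a ss c -> typed a (sort sg n ss) c /\ run c (sort sg n ss) = run c ss.
Proof.
  revert ss; induction n as [|n IH]; intros ss H; cbn; [auto|].
  destruct (sseqb _ _); [auto|].
  assert (typed a (pass sg ss) c /\ run c (pass sg ss) = run c ss) as [H1 <-].
  { destruct ss as [|s ss]; [auto|]. now apply bubble_sound. }
  auto.
Qed.

Lemma check_sound e e' : check sg e e' = true -> eden e = eden e'.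
Proof.
  unfold check. destruct (nf sg e) as [[[a s] b]|] eqn:E; [|easy].
  destruct (nf sg e') as [[[a' s'] b']|] eqn:E'; [|easy].
  rewrite !andb_true_iff. intros [[H1 H2] H3].
  apply weqb_eq in H1, H2; apply sseqb_eq in H3; subst.
  apply nf_sound in E as (T1 & _ & _ & ->), E' as (T2 & _ & _ & ->).
  destruct (sort_sound fuel T1) as [_ <-], (sort_sound fuel T2) as [_ <-]. congruence.
Qed.

Lemma check_hom_sound x y e : check_hom sg x y e = true -> hom (oden x) (oden y) (eden e).
Proof.
  unfold check_hom. destruct (nf sg e) as [[[a s] b]|] eqn:E; [|easy].
  rewrite !andb_true_iff. intros [H1 H2]. apply weqb_eq in H1, H2; subst.
  apply nf_sound in E as (_ & E1 & E2 & _). rewrite !flat_den in E1, E2. now split.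
Qed.

End Denotation.

(** * Search for an occurrence of one diagram in another *)

Fixpoint strip_suffix (u v : word) : option word :=
  if weqb u v then Some WNil else
  match u with
  | WNil => None
  | WVar n u => option_map (WVar n) (strip_suffix u v)
  | WApp k a u => option_map (WApp k a) (strip_suffix u v)
  end.

(* The search for occurrences is heuristic: its result is checked in [rewrite_sound]. *)
Inductive ctx := Hole (u v : word) | Under (u : word) (k : nat) (c : ctx) (v : word).

Definition match_slice (s p : slice) : option (word * word) :=
  let '(l, g, r) := s in let '(l', g', r') := p in
  if geqb g g' then
    match strip_suffix l l', strip r' r with
    | Some u, Some v => Some (u, v)
    | _, _ => None
    end
  else None.

Fixpoint find_ctx (g : gen) (l r : word) (p : slice) : list ctx :=
  (match match_slice (l, g, r) p with Some (u, v) => [Hole u v] | None => [] end)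
  ++ match g with
     | GVar _ => []
     | GApp k l' g' r' => map (fun c => Under l k c r) (find_ctx g' l' r' p)
     end.

Fixpoint plug_slices (c : ctx) (ss : list slice) : list slice :=
  match c with
  | Hole u v => map (wh u v) ss
  | Under u k c v => map (wh u v) (map (fapp k) (plug_slices c ss))
  end.

(** [swap], or its mirror image. *)
Definition swap2 (sg : sig) (s t : slice) : option (slice * slice) :=
  match swap sg s t with
  | Some p => Some p
  | None =>
      let '(l1, g1, r1) := s in let '(l2, g2, r2) := t in
      match strip (wapp l1 (gcod sg g1)) l2 with
      | Some m => Some ((wapp l1 (wapp (gdom sg g1) m), g2, r2),
                        (l1, g1, wapp m (wapp (gcod sg g2) r2)))
      | None => None
      end
  end.

Fixpoint move (sg : sig) (ss : list slice) (t : slice) : option (slice * list slice) :=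
  match ss with
  | [] => Some (t, [])
  | s :: ss =>
      match move sg ss t with
      | Some (t', ss') =>
          match swap2 sg s t' with
          | Some (t'', s') => Some (t'', s' :: ss')
          | None => None
          end
      | None => None
      end
  end.

(** When a slice is moved in front of an occurrence, the wires beside the occurrence change; the
    outermost words of the context are then read off again from its first slice. *)
Definition rewh (c : ctx) (s p : slice) : ctx :=
  match match_slice s p with
  | Some (u, v) =>
      match c with
      | Hole u' v' => Hole u v
      | Under u' k c v' => Under u k c v
      end
  | None => c
  end.

(** [blk] consists of the slices of the pattern [P] found so far, in the context [c]; the slices
    in [pre] come before the occurrence, and those in [aft] have to come after [blk]. *)
Fixpoint gather (sg : sig) (n : nat) (P : list slice) (c : ctx) (pre blk aft rest : list slice)
    : option (list slice * ctx * list slice) :=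
  match n with
  | 0 => None
  | S n =>
      match nth_error (plug_slices c P) (length blk) with
      | None => Some (pre, c, aft ++ rest)
      | Some p =>
          match rest with
          | [] => None
          | t :: rest =>
              match move sg aft t with
              | None => gather sg n P c pre blk (aft ++ [t]) rest
              | Some (t', aft') =>
                  (* The slices set aside are examined again, since the next slice of the pattern
                     may be among them. *)
                  if seqb t' p then gather sg n P c pre (blk ++ [t']) [] (aft' ++ rest)
                  else match move sg blk t' with
                       | Some (t'', blk') =>
                           let c' :=
                             match plug_slices
                               (match c with Hole _ _ => Hole WNil WNil
                                           | Under _ k c _ => Under WNil k c WNil end) P, blk' with
                             | q :: _, b :: _ => rewh c b q
                             | _, _ => c
                             end in
                           gather sg n P c' (pre ++ [t'']) blk' aft' rest
                       | None => gather sg n P c pre blk (aft ++ [t]) rest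
                       end
              end
          end
      end
  end.

Fixpoint try_ctxs (sg : sig) (P : list slice) (pre : list slice) (s : slice) (rest : list slice)
    (cs : list ctx) : option (list slice * ctx * list slice) :=
  match cs with
  | [] => None
  | c :: cs =>
      match gather sg fuel P c pre [s] [] rest with
      | Some x => Some x
      | None => try_ctxs sg P pre s rest cs
      end
  end.

(** Occurrences whose first slice is [s], possibly after some slices of [rest] have been moved
    before [s]. *)
Fixpoint occurrence_at (sg : sig) (P : list slice) (p : slice) (pre : list slice) (s : slice)
    (aft rest : list slice) : option (list slice * ctx * list slice) :=
  let '(l, g, r) := s in
  match try_ctxs sg P pre s (aft ++ rest) (find_ctx g l r p) with
  | Some x => Some x
  | None =>
      match rest with
      | [] => None
      | t :: rest =>
          match move sg aft t with
          | Some (t', aft') =>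
              match swap2 sg s t' with
              | Some (t'', s') => occurrence_at sg P p (pre ++ [t'']) s' aft' rest
              | None => occurrence_at sg P p pre s (aft ++ [t]) rest
              end
          | None => occurrence_at sg P p pre s (aft ++ [t]) rest
          end
      end
  end.

Fixpoint occurrence (sg : sig) (P : list slice) (pre D : list slice)
    : option (list slice * ctx * list slice) :=
  match P, D with
  | p :: _, s :: rest =>
      match occurrence_at sg P p pre s [] rest with
      | Some x => Some x
      | None => occurrence sg P (pre ++ [s]) rest
      end
  | _, _ => None
  end.

Fixpoint wquote (w : word) : oexp :=
  match w with
  | WNil => OOne
  | WVar n WNil => OVar n
  | WVar n w => OTen (OVar n) (wquote w)
  | WApp k u WNil => OApp k (wquote u)
  | WApp k u w => OTen (OApp k (wquote u)) (wquote w)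
  end.

Definition squote (l r : word) (e : exp) : exp :=
  match l, r with
  | WNil, WNil => e
  | WNil, _ => ETen e (EId (wquote r))
  | _, WNil => ETen (EId (wquote l)) e
  | _, _ => ETen (EId (wquote l)) (ETen e (EId (wquote r)))
  end.

Fixpoint gquote (g : gen) : exp :=
  match g with
  | GVar n => EVar n
  | GApp k l g r => EApp k (squote l r (gquote g))
  end.

Definition dquote (a : word) (ss : list slice) : exp :=
  match ss with
  | [] => EId (wquote a)
  | (l, g, r) :: ss =>
      fold_left (fun e s => let '(l, g, r) := s in EComp (squote l r (gquote g)) e) ss
        (squote l r (gquote g))
  end.

Fixpoint plug (c : ctx) (e : exp) : exp :=
  match c with
  | Hole u v => squote u v e
  | Under u k c v => squote u v (EApp k (plug c e))
  end.

(** The slices before and after the occurrence of [l] in [e], its context, and the result of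
    the replacement of [l] by [r]. *)
Definition rewrite_plan (sg : sig) (e l r : exp) : option (exp * ctx * exp * exp) :=
  match nf sg e, nf sg l with
  | Some (a, s, b), Some (_, p, _) =>
      match occurrence sg (sort sg fuel p) [] (sort sg fuel s) with
      | Some (pre, c, post) =>
          let f := dquote a pre in
          let g := match post with
                   | [] => EId (wquote b)
                   | _ => dquote WNil post
                   end in
          match nf sg (EComp g (EComp (plug c r) f)) with
          | Some (a', s', _) => Some (f, c, g, dquote a' (sort sg fuel s'))
          | None => None
          end
      | None => None
      end
  | _, _ => None
  end.

Lemma plug_congr (C : MonCat) fs os (ms : list (mor C)) c l r :
  eden fs os ms l = eden fs os ms r -> eden fs os ms (plug c l) = eden fs os ms (plug c r).
Proof.
  intros H; induction c as [u v|u k c IH v]; cbn; destruct u, v; cbn; congruence.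
Qed.

Lemma rewrite_sound (C : MonCat) fs os (ms : list (mor C)) sg (ok : sig_ok fs os ms sg)
    e l r f c g e' :
  check sg e (EComp g (EComp (plug c l) f)) = true ->
  check sg (EComp g (EComp (plug c r) f)) e' = true ->
  eden fs os ms l = eden fs os ms r -> eden fs os ms e = eden fs os ms e'.
Proof.
  intros H1 H2 H. apply (check_sound ok) in H1, H2. rewrite H1, <- H2. cbn.
  now rewrite (plug_congr c H).
Qed.

(** * Types of atomic morphisms, and rewriting of diagrams *)

Class Hom (C : Category) (f : mor C) (X Y : ob C) := homP : hom X Y f.
Arguments homP {C} f {X Y} {_}.
#[export] Hint Mode Hom + + - - : typeclass_instances.
#[export] Hint Extern 0 (Hom ?f _ _) =>
  match goal with H : hom _ _ f |- _ => exact H end : typeclass_instances.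

Ltac add_to x l :=
  lazymatch l with
  | context [cons x _] => l
  | _ => constr:(cons x l)
  end.

Ltac index_of x l :=
  lazymatch l with
  | cons x _ => constr:(O)
  | cons _ ?l => let n := index_of x l in constr:(S n)
  end.

Ltac collect_ob X env :=
  lazymatch X with
  | @one _ => env
  | @tob _ ?A ?B => let env := collect_ob A env in collect_ob B env
  | @fob _ _ ?F ?A =>
      lazymatch env with
      | (?fs, ?os, ?ms) => let fs := add_to F fs in collect_ob A constr:((fs, os, ms))
      end
  | _ =>
      lazymatch env with
      | (?fs, ?os, ?ms) => let os := add_to X os in constr:((fs, os, ms))
      end
  end.

Ltac collect_mor f env :=
  lazymatch f with
  | @idm _ ?X => collect_ob X env
  | @comp _ ?g ?f => let env := collect_mor g env in collect_mor f env
  | @tmor _ ?g ?f => let env := collect_mor g env in collect_mor f env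
  | @fmap _ _ ?F ?f =>
      lazymatch env with
      | (?fs, ?os, ?ms) => let fs := add_to F fs in collect_mor f constr:((fs, os, ms))
      end
  | _ =>
      lazymatch env with
      | (?fs, ?os, ?ms) =>
          lazymatch ms with
          | context [cons f _] => env
          | _ =>
              let p := constr:(homP f) in
              lazymatch type of p with
              | hom ?X ?Y _ =>
                  let env := collect_ob X constr:((fs, os, cons f ms)) in
                  collect_ob Y env
              end
          end
      end
  end.

Ltac reify_ob fs os X :=
  lazymatch X with
  | @one _ => constr:(OOne)
  | @tob _ ?A ?B =>
      let a := reify_ob fs os A in let b := reify_ob fs os B in constr:(OTen a b)
  | @fob _ _ ?F ?A =>
      let k := index_of F fs in let a := reify_ob fs os A in constr:(OApp k a)
  | _ => let n := index_of X os in constr:(OVar n)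
  end.

Ltac reify_mor fs os ms f :=
  lazymatch f with
  | @idm _ ?X => let o := reify_ob fs os X in constr:(EId o)
  | @comp _ ?g ?f =>
      let a := reify_mor fs os ms g in let b := reify_mor fs os ms f in constr:(EComp a b)
  | @tmor _ ?g ?f =>
      let a := reify_mor fs os ms g in let b := reify_mor fs os ms f in constr:(ETen a b)
  | @fmap _ _ ?F ?f =>
      let k := index_of F fs in let a := reify_mor fs os ms f in constr:(EApp k a)
  | _ => let n := index_of f ms in constr:(EVar n)
  end.

Ltac reify_sig fs os ms :=
  lazymatch ms with
  | nil => constr:(@nil (oexp * oexp))
  | cons ?f ?ms =>
      let p := constr:(homP f) in
      lazymatch type of p with
      | hom ?X ?Y _ =>
          let a := reify_ob fs os X in let b := reify_ob fs os Y in
          let sg := reify_sig fs os ms in constr:(cons (a, b) sg)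
      end
  end.

Ltac sig_proof fs os ms sg :=
  lazymatch ms with
  | nil => constr:(Forall2_nil (fun m dc => hom (oden fs os (fst dc)) (oden fs os (snd dc)) m))
  | cons ?f ?ms =>
      lazymatch sg with
      | cons ?q ?sg =>
          let p := sig_proof fs os ms sg in
          constr:(@Forall2_cons _ _
            (fun m dc => hom (oden fs os (fst dc)) (oden fs os (snd dc)) m)
            f q _ _ (homP f) p)
      end
  end.

Ltac empty_env C :=
  constr:((@nil (Functor C C), @nil (ob C), @nil (mor C))).

Ltac mon_of f :=
  lazymatch type of f with mor (cat ?C) => C end.

(** Proves equations that follow from the laws of strict monoidal categories and functoriality; all
    other equations enter through [drw]. *)
Ltac diag :=
  lazymatch goal with
  | |- ?l = ?r =>
      let C := mon_of l in
      let env := empty_env C in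
      let env := collect_mor l env in
      let env := collect_mor r env in
      lazymatch env with
      | (?fs, ?os, ?ms) =>
          let sg := reify_sig fs os ms in
          let p := sig_proof fs os ms sg in
          let a := reify_mor fs os ms l in
          let b := reify_mor fs os ms r in
          refine (@check_sound C fs os ms sg p a b _);
          vm_compute; reflexivity
      end
  end.

Ltac homt :=
  lazymatch goal with
  | |- hom ?X ?Y ?f =>
      let C := mon_of f in
      let env := empty_env C in
      let env := collect_mor f env in
      let env := collect_ob X env in
      let env := collect_ob Y env in
      lazymatch env with
      | (?fs, ?os, ?ms) =>
          let sg := reify_sig fs os ms in
          let p := sig_proof fs os ms sg in
          let e := reify_mor fs os ms f in
          let x := reify_ob fs os X in
          let y := reify_ob fs os Y in
          refine (@check_hom_sound C fs os ms sg p x y e _);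
          vm_compute; reflexivity
      end
  end.

(** Rewrites in the left side of the goal, at an occurrence found modulo exchange and possibly under
    functors. The right side is left untouched, hence the frequent [symmetry]. *)
Ltac drw E :=
  lazymatch goal with
  | |- ?t = ?rhs =>
      let C := mon_of t in
      lazymatch type of E with
      | ?l = ?r =>
          let env := empty_env C in
          let env := collect_mor t env in
          let env := collect_mor l env in
          let env := collect_mor r env in
          lazymatch env with
          | (?fs, ?os, ?ms) =>
              let sg := reify_sig fs os ms in
              let p := sig_proof fs os ms sg in
              let e := reify_mor fs os ms t in
              let a := reify_mor fs os ms l in
              let b := reify_mor fs os ms r in
              let plan := eval vm_compute in (rewrite_plan sg e a b) in
              lazymatch plan with
              | Some (?f, ?c, ?g, ?e') =>
                  let t' := eval cbv [eden oden fn nth] in (eden fs os ms e') in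
                  transitivity t';
                  [ refine (@rewrite_sound C fs os ms sg p e a b f c g e' _ _ E);
                    vm_compute; reflexivity
                  | ]
              | None => fail 1 "no occurrence"
              end
          end
      end
  end.

(** * Dual modules *)

#[export] Instance Hom_fmap (C D : Category) (F : Functor C D) X Y f (Hf : Hom f X Y) :
  Hom (F $ f) (F X) (F Y) := fmap_hom F Hf.

Section Duals.
Variable C : AutonomousCat.

#[export] Instance Hom_ev (X : ob C) : Hom (ev X) (ldual X ⊠ X) one := ev_hom X.
#[export] Instance Hom_coev (X : ob C) : Hom (coev X) one (X ⊠ ldual X) := coev_hom X.
#[export] Instance Hom_rev (X : ob C) : Hom (rev X) (X ⊠ rdual X) one := rev_hom X.
#[export] Instance Hom_rcoev (X : ob C) : Hom (rcoev X) one (rdual X ⊠ X) := rcoev_hom X.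

#[export] Instance Hom_ldualm (X Y : ob C) f (Hf : Hom f X Y) :
  Hom (ldualm f) (ldual Y) (ldual X).
Proof. unfold ldualm. destruct (Hf) as [-> ->]. unfold Hom. homt. Qed.

#[export] Instance Hom_rdualm (X Y : ob C) f (Hf : Hom f X Y) :
  Hom (rdualm f) (rdual Y) (rdual X).
Proof. unfold rdualm. destruct (Hf) as [-> ->]. unfold Hom. homt. Qed.

Lemma ev_ldualm (X Y : ob C) f : hom X Y f ->
  ev X ∘ (ldualm f ⊗ idm X) = ev Y ∘ (idm (ldual Y) ⊗ f).
Proof.
  intros H. pose proof H as [E1 E2]. unfold ldualm. rewrite E1, E2.
  transitivity ((ev Y ⊗ idm one) ∘ (idm (ldual Y) ⊗ f ⊗ idm one)
    ∘ (idm (ldual Y) ⊗ ((idm X ⊗ ev X) ∘ (coev X ⊗ idm X)))); [diag|].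
  rewrite ldual_zigzag. diag.
Qed.

Lemma coev_ldualm (X Y : ob C) f : hom X Y f ->
  (f ⊗ idm (ldual X)) ∘ coev X = (idm Y ⊗ ldualm f) ∘ coev Y.
Proof.
  intros H. pose proof H as [E1 E2]. unfold ldualm. rewrite E1, E2. symmetry.
  transitivity ((((idm Y ⊗ ev Y) ∘ (coev Y ⊗ idm Y)) ⊗ idm (ldual X))
    ∘ (f ⊗ idm (ldual X)) ∘ coev X); [diag|].
  rewrite ldual_zigzag. diag.
Qed.

Lemma rev_rdualm (X Y : ob C) f : hom X Y f ->
  rev X ∘ (idm X ⊗ rdualm f) = rev Y ∘ (f ⊗ idm (rdual Y)).
Proof.
  intros H. pose proof H as [E1 E2]. unfold rdualm. rewrite E1, E2.
  drw (rdual_zigzag X). diag.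
Qed.

Lemma rcoev_rdualm (X Y : ob C) f : hom X Y f ->
  (idm (rdual X) ⊗ f) ∘ rcoev X = (rdualm f ⊗ idm Y) ∘ rcoev Y.
Proof.
  intros H. pose proof H as [E1 E2]. unfold rdualm. rewrite E1, E2. symmetry.
  drw (rdual_zigzag Y). diag.
Qed.

Lemma ldualm_comp (X Y W : ob C) g f : hom X Y f -> hom Y W g ->
  ldualm (g ∘ f) = ldualm f ∘ ldualm g.
Proof.
  intros Hf Hg. pose proof Hf as [E1 E2]. pose proof Hg as [E3 E4].
  destruct (comp_hom Hg Hf) as [E5 E6]. symmetry.
  unfold ldualm at 1. rewrite E1, E2. unfold ldualm at 2. rewrite E5, E6.
  drw (ev_ldualm Hg). diag.
Qed.

Lemma rdualm_comp (X Y W : ob C) g f : hom X Y f -> hom Y W g ->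
  rdualm (g ∘ f) = rdualm f ∘ rdualm g.
Proof.
  intros Hf Hg. pose proof Hf as [E1 E2]. pose proof Hg as [E3 E4].
  destruct (comp_hom Hg Hf) as [E5 E6]. symmetry.
  unfold rdualm at 1. rewrite E1, E2. unfold rdualm at 2. rewrite E5, E6.
  drw (rev_rdualm Hg). diag.
Qed.

End Duals.

Section Bimonad.
Variables (C : MonCat) (T : Bimonad C).

#[export] Instance Hom_com2 X Y : Hom (com2 T X Y) (T (X ⊠ Y)) (T X ⊠ T Y).
Proof. apply (bimonadP T). Qed.
#[export] Instance Hom_com0 : Hom (com0 T) (T one) one.
Proof. apply (bimonadP T). Qed.
#[export] Instance Hom_mu X : Hom (mu T X) (T (T X)) (T X).
Proof. apply (bimonadP T). Qed.
#[export] Instance Hom_eta X : Hom (eta T X) X (T X).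
Proof. apply (bimonadP T). Qed.
#[export] Instance Hom_act (M : Module T) : Hom (act M) (T (carrier M)) (carrier M) := act_hom M.

Lemma com2_nat X X' Y Y' f g : hom X X' f -> hom Y Y' g ->
  (T $ f ⊗ T $ g) ∘ com2 T X Y = com2 T X' Y' ∘ T $ (f ⊗ g).
Proof. intros [<- <-] [<- <-]. apply (bimonadP T). Qed.

Lemma com2_assoc X Y W :
  (idm (T X) ⊗ com2 T Y W) ∘ com2 T X (Y ⊠ W) = (com2 T X Y ⊗ idm (T W)) ∘ com2 T (X ⊠ Y) W.
Proof. apply (bimonadP T). Qed.

Lemma com2_unit_r X : (idm (T X) ⊗ com0 T) ∘ com2 T X one = idm (T X).
Proof. apply (bimonadP T). Qed.

Lemma com2_unit_l X : (com0 T ⊗ idm (T X)) ∘ com2 T one X = idm (T X).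
Proof. apply (bimonadP T). Qed.

Lemma mu_nat X Y f : hom X Y f -> T $ f ∘ mu T X = mu T Y ∘ T $ (T $ f).
Proof. intros [<- <-]. apply (bimonadP T). Qed.

Lemma eta_nat X Y f : hom X Y f -> T $ f ∘ eta T X = eta T Y ∘ f.
Proof. intros [<- <-]. apply (bimonadP T). Qed.

Lemma mu_com2 X Y :
  com2 T X Y ∘ mu T (X ⊠ Y)
  = (mu T X ⊗ mu T Y) ∘ com2 T (T X) (T Y) ∘ T $ com2 T X Y.
Proof.
  destruct (bimonadP T) as (_ & (_ & H & _) & _). cbn in H. rewrite H. diag.
Qed.

Lemma mu_com0 : com0 T ∘ mu T one = com0 T ∘ T $ com0 T.
Proof. apply (bimonadP T). Qed.

Lemma eta_com2 X Y : com2 T X Y ∘ eta T (X ⊠ Y) = eta T X ⊗ eta T Y.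
Proof.
  destruct (bimonadP T) as (_ & _ & (_ & H & _) & _). cbn in H. rewrite H. diag.
Qed.

Lemma eta_com0 : com0 T ∘ eta T one = idm one.
Proof. apply (bimonadP T). Qed.

Lemma mu_mu X : mu T X ∘ T $ mu T X = mu T X ∘ mu T (T X).
Proof. apply (bimonadP T). Qed.

Lemma mu_Teta X : mu T X ∘ T $ eta T X = idm (T X).
Proof. apply (bimonadP T). Qed.

Lemma mu_eta X : mu T X ∘ eta T (T X) = idm (T X).
Proof. apply (bimonadP T). Qed.

Definition free_mod (X : ob C) : Module T :=
  {| carrier := T X : ob C; act := mu T X; act_hom := Hom_mu X;
     act_mu := mu_mu X; act_eta := mu_eta X |}.

End Bimonad.

(** * Actions on the duals of a module, obtained from the antipodes *)

Section Hopf.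
Variables (C : AutonomousCat) (T : HopfMonad C).

#[export] Instance Hom_sl X : Hom (sl T X) (T (ldual (T X))) (ldual X) := sl_hom T X.
#[export] Instance Hom_sr X : Hom (sr T X) (T (rdual (T X))) (rdual X) := sr_hom T X.

Lemma sl_natural X Y f : hom X Y f -> ldualm f ∘ sl T Y = sl T X ∘ T $ ldualm (T $ f).
Proof. intros [<- <-]; apply sl_nat. Qed.

Lemma sr_natural X Y f : hom X Y f -> rdualm f ∘ sr T Y = sr T X ∘ T $ rdualm (T $ f).
Proof. intros [<- <-]; apply sr_nat. Qed.

(** The usual actions of [T] on the two duals of [N]. For a free module they are the composites of
    an antipode with the dual of [mu] that occur in [sl_ev] and [sr_ev]. *)
Definition lact (N : Module T) : mor C := sl T (carrier N) ∘ T $ ldualm (act N).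
Definition ract (N : Module T) : mor C := sr T (carrier N) ∘ T $ rdualm (act N).

#[export] Instance Hom_lact N : Hom (lact N) (T (ldual (carrier N))) (ldual (carrier N)).
Proof. unfold lact, Hom; homt. Qed.
#[export] Instance Hom_ract N : Hom (ract N) (T (rdual (carrier N))) (rdual (carrier N)).
Proof. unfold ract, Hom; homt. Qed.

Lemma ldualm_act (N : Module T) :
  ldualm (T $ act N) ∘ ldualm (act N) = ldualm (mu T (carrier N)) ∘ ldualm (act N).
Proof.
  rewrite <- (ldualm_comp (Hom_fmap T (act_hom N)) (act_hom N)).
  rewrite <- (ldualm_comp (Hom_mu T (carrier N)) (act_hom N)).
  now rewrite act_mu.
Qed.

Lemma rdualm_act (N : Module T) :
  rdualm (T $ act N) ∘ rdualm (act N) = rdualm (mu T (carrier N)) ∘ rdualm (act N).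
Proof.
  rewrite <- (rdualm_comp (Hom_fmap T (act_hom N)) (act_hom N)).
  rewrite <- (rdualm_comp (Hom_mu T (carrier N)) (act_hom N)).
  now rewrite act_mu.
Qed.

Lemma ldualm_eta (N : Module T) :
  ldualm (eta T (carrier N)) ∘ ldualm (act N) = idm (ldual (carrier N)).
Proof.
  rewrite <- (ldualm_comp (Hom_eta T (carrier N)) (act_hom N)), act_eta.
  unfold ldualm. rewrite dom_id, cod_id. drw (ldual_zagzig (carrier N)). diag.
Qed.

Lemma rdualm_eta (N : Module T) :
  rdualm (eta T (carrier N)) ∘ rdualm (act N) = idm (rdual (carrier N)).
Proof.
  rewrite <- (rdualm_comp (Hom_eta T (carrier N)) (act_hom N)), act_eta.
  unfold rdualm. rewrite dom_id, cod_id. drw (rdual_zagzig (carrier N)). diag.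
Qed.

(** Linearity of [ev]. Naturality of [sl] along [act N] leads to the free module on the carrier,
    where [sl_ev] applies, and the dualized unit law [ldualm_eta] leads back to [N]. The next three
    lemmas are the linearity of the other duality morphisms. *)
Lemma lact_ev (N : Module T) :
  ev (carrier N) ∘ (lact N ⊗ act N) ∘ com2 T (ldual (carrier N)) (carrier N)
  = com0 T ∘ T $ ev (carrier N).
Proof.
  unfold lact.
  drw (eq_sym (ev_ldualm (act_hom N))).
  drw (sl_natural (act_hom N)).
  drw (ldualm_act N).
  drw (com2_nat T (Hom_ldualm (act_hom N)) (id_hom (carrier N))).
  drw (eq_sym (sl_ev T (carrier N))).
  drw (ldualm_eta N). diag.
Qed.

Lemma lact_coev (N : Module T) :
  (act N ⊗ lact N) ∘ com2 T (carrier N) (ldual (carrier N)) ∘ T $ coev (carrier N)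
  = coev (carrier N) ∘ com0 T.
Proof.
  unfold lact.
  drw (com2_nat T (id_hom (carrier N)) (Hom_ldualm (act_hom N))).
  drw (eq_sym (coev_ldualm (act_hom N))).
  drw (eq_sym (com2_nat T (act_hom N) (id_hom (ldual (T (carrier N)))))).
  drw (act_mu N).
  drw (eq_sym (sl_coev T (carrier N))).
  drw (act_eta N). diag.
Qed.

Lemma ract_rev (N : Module T) :
  rev (carrier N) ∘ (act N ⊗ ract N) ∘ com2 T (carrier N) (rdual (carrier N))
  = com0 T ∘ T $ rev (carrier N).
Proof.
  unfold ract.
  drw (eq_sym (rev_rdualm (act_hom N))).
  drw (sr_natural (act_hom N)).
  drw (rdualm_act N).
  drw (com2_nat T (id_hom (carrier N)) (Hom_rdualm (act_hom N))).
  drw (eq_sym (sr_ev T (carrier N))).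
  drw (rdualm_eta N). diag.
Qed.

Lemma ract_rcoev (N : Module T) :
  (ract N ⊗ act N) ∘ com2 T (rdual (carrier N)) (carrier N) ∘ T $ rcoev (carrier N)
  = rcoev (carrier N) ∘ com0 T.
Proof.
  unfold ract.
  drw (com2_nat T (Hom_rdualm (act_hom N)) (id_hom (carrier N))).
  drw (eq_sym (rcoev_rdualm (act_hom N))).
  drw (eq_sym (com2_nat T (id_hom (rdual (T (carrier N)))) (act_hom N))).
  drw (act_mu N).
  drw (eq_sym (sr_coev T (carrier N))).
  drw (act_eta N). diag.
Qed.

(** After pairing with [rev], the comonoidality of [eta] makes this an instance of the linearity of
    [rev]; the snake identity then removes the pairing. *)
Lemma ract_eta (N : Module T) : ract N ∘ eta T (rdual (carrier N)) = idm (rdual (carrier N)).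
Proof.
  transitivity ((idm (rdual (carrier N)) ⊗ rev (carrier N))
    ∘ (rcoev (carrier N) ⊗ (ract N ∘ eta T (rdual (carrier N))))).
  { symmetry. drw (rdual_zagzig (carrier N)). diag. }
  transitivity ((idm (rdual (carrier N)) ⊗ (rev (carrier N) ∘ (act N ⊗ ract N)
      ∘ (eta T (carrier N) ⊗ eta T (rdual (carrier N)))))
    ∘ (rcoev (carrier N) ⊗ idm (rdual (carrier N)))).
  { symmetry. drw (act_eta N). diag. }
  drw (eq_sym (eta_com2 T (carrier N) (rdual (carrier N)))).
  drw (ract_rev N). drw (eta_nat T (rev_hom (carrier N))). drw (eta_com0 T).
  drw (rdual_zagzig (carrier N)). diag.
Qed.

#[local] Notation P N := (rdual (carrier N)).

(* Convolution argument: both sides are inverse to the action of [T (T N)] on [N]. *)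
Lemma ract_mu (N : Module T) :
  ract N ∘ T $ ract N = ract N ∘ mu T (rdual (carrier N)).
Proof.
  pose (K := (idm (P N) ⊗ rev (carrier N))
    ∘ ((ract N ∘ mu T (P N)) ⊗ (act N ∘ mu T (carrier N)) ⊗ (ract N ∘ T $ ract N))
    ∘ (idm (T (T (P N))) ⊗ (com2 T (T (carrier N)) (T (P N)) ∘ T $ com2 T (carrier N) (P N)))
    ∘ com2 T (T (P N)) (T (carrier N ⊠ P N)) ∘ T $ com2 T (P N) (carrier N ⊠ P N)
    ∘ T $ (T $ (rcoev (carrier N) ⊗ idm (P N)))).
  transitivity K; [symmetry|]; unfold K; clear K.
  (* Of the three factors of [K], the first two cancel here by linearity of [rcoev]; in the other
     case the last two cancel by linearity of [rev]. *)
  - drw (com2_nat T (id_hom (T (P N))) (Hom_com2 T (carrier N) (P N))).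
    drw (com2_assoc T (T (P N)) (T (carrier N)) (T (P N))).
    drw (com2_assoc T (P N) (carrier N) (P N)).
    drw (eq_sym (com2_nat T (Hom_com2 T (P N) (carrier N)) (id_hom (T (P N))))).
    drw (eq_sym (com2_nat T (rcoev_hom (carrier N)) (id_hom (P N)))).
    drw (eq_sym (com2_nat T (Hom_fmap T (rcoev_hom (carrier N))) (id_hom (T (P N))))).
    drw (eq_sym (mu_com2 T (P N) (carrier N))).
    drw (eq_sym (mu_nat T (rcoev_hom (carrier N)))).
    drw (ract_rcoev N). drw (mu_com0 T).
    drw (com2_nat T (Hom_com0 T) (id_hom (T (P N)))).
    drw (com2_unit_l T (P N)). drw (com2_unit_l T (T (P N))).
    drw (rdual_zagzig (carrier N)). diag.
  - drw (eq_sym (act_mu N)).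
    drw (com2_nat T (act_hom N) (Hom_ract N)).
    drw (ract_rev N). drw (ract_rev N).
    drw (com2_nat T (id_hom (T (P N))) (Hom_fmap T (rev_hom (carrier N)))).
    drw (com2_nat T (id_hom (T (P N))) (Hom_com0 T)).
    drw (com2_nat T (id_hom (P N)) (rev_hom (carrier N))).
    drw (com2_unit_r T (P N)). drw (com2_unit_r T (T (P N))).
    drw (rdual_zagzig (carrier N)). diag.
Qed.
End Hopf.

(** * Jointly faithful families *)

Section Density.
Variable C : AutonomousCat.

(** By left duality this says that the mates [ldual (Q i) ⊠ P i → V] are jointly epic. The form with
    [Q i] on the target side is the one in which [del] is given. *)
Definition dense (I : Type) (V : ob C) (P Q : I -> ob C) (t : I -> mor C) : Prop :=
  (forall i, hom (P i) (Q i ⊠ V) (t i)) /\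
  forall W h h', hom V W h -> hom V W h' ->
    (forall i, (idm (Q i) ⊗ h) ∘ t i = (idm (Q i) ⊗ h') ∘ t i) -> h = h'.

(** The wire [Y] is bent to the target by [coev Y], which leaves a morphism out of [V], and is
    straightened afterwards. *)
Lemma dense_whisker I V P Q t (Y : ob C) : @dense I V P Q t ->
  dense (V ⊠ Y) (fun i => P i ⊠ Y) Q (fun i => t i ⊗ idm Y).
Proof.
  intros [Ht D]; split.
  - intros i; specialize (Ht i). homt.
  - intros W h h' Hh Hh' E.
    assert (F : (h ⊗ idm (ldual Y)) ∘ (idm V ⊗ coev Y) = (h' ⊗ idm (ldual Y)) ∘ (idm V ⊗ coev Y)).
    { apply (D (W ⊠ ldual Y)); try homt. intros i; specialize (Ht i).
      transitivity ((((idm (Q i) ⊗ h) ∘ (t i ⊗ idm Y)) ⊗ idm (ldual Y))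
        ∘ (idm (P i) ⊗ coev Y)); [diag|].
      rewrite E. diag. }
    transitivity ((idm W ⊗ ev Y) ∘ (((h ⊗ idm (ldual Y)) ∘ (idm V ⊗ coev Y)) ⊗ idm Y)).
    + symmetry. drw (ldual_zigzag Y). diag.
    + rewrite F. drw (ldual_zigzag Y). diag.
Qed.

Lemma dense_comp I J V (P Q : I -> J -> ob C) t (P' Q' : J -> ob C) u :
  dense V P' Q' u -> (forall j, dense (P' j) (fun i => P i j) (fun i => Q i j) (fun i => t i j)) ->
  dense V (fun ij : I * J => P (fst ij) (snd ij)) (fun ij => Q (fst ij) (snd ij) ⊠ Q' (snd ij))
    (fun ij => (idm (Q (fst ij) (snd ij)) ⊗ u (snd ij)) ∘ t (fst ij) (snd ij)).
Proof.
  intros [Hu Du] Ht; split.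
  - intros [i j]; cbn. pose proof (proj1 (Ht j) i). specialize (Hu j). cbn in *. homt.
  - intros W h h' Hh Hh' E. apply (Du W); trivial. intros j. destruct (Ht j) as [Htj Dt].
    specialize (Hu j). apply (Dt (Q' j ⊠ W)); try homt. intros i; specialize (Htj i).
    specialize (E (i, j)); cbn in *.
    transitivity ((idm (Q i j ⊠ Q' j) ⊗ h) ∘ ((idm (Q i j) ⊗ u j) ∘ t i j)); [diag|].
    rewrite E. diag.
Qed.

Lemma dense_del (T : Functor C C) (Z : Centralizer T) X :
  dense (Z X) (fun Y => X ⊠ Y) T (del Z X).
Proof.
  split; [apply del_hom|]. intros W h h' Hh Hh' E.
  pose (xi := fun Y => (idm (T Y) ⊗ h) ∘ del Z X Y).
  destruct (@del_univ _ _ Z X W xi) as (r & _ & U).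
  - intros Y; unfold xi. pose proof (del_hom Z X Y). homt.
  - intros g; unfold xi. pose proof (del_hom Z X (dom g)). pose proof (del_hom Z X (cod g)).
    assert (hom (dom g) (cod g) g) by now split.
    pose proof (del_nat Z (idm X) g) as N. rewrite dom_id, cod_id, fmap_id in N.
    drw N. diag.
  - transitivity r; [symmetry|]; apply U; split; trivial.
Qed.

End Density.

(** * Jointly faithful families under a Hopf monad *)

Section DensityHopf.
Variables (C : AutonomousCat) (T : HopfMonad C).

(** Expresses the antipode through an action, for which [ract_mu] and [ract_eta] provide
    associativity and unit laws. *)
Lemma sr_eq X : sr T X = rdualm (eta T X) ∘ ract (free_mod T X).
Proof.
  unfold ract; cbn. symmetry. drw (sr_natural T (Hom_eta T X)).
  transitivity (sr T X ∘ T $ (rdualm (T $ eta T X) ∘ rdualm (mu T X))); [diag|].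
  rewrite <- (rdualm_comp (Hom_fmap T (Hom_eta T X)) (Hom_mu T X)), mu_Teta.
  transitivity (sr T X ∘ T $ idm (rdual (T X))); [|diag]. do 2 f_equal.
  unfold rdualm. rewrite dom_id, cod_id. drw (rdual_zagzig (T X)). diag.
Qed.

(* [f] is recovered from [sr T V ∘ T $ rdualm f] by means of the left antipode. *)
Lemma sl_sr V W f : hom (T V) W f ->
  sl T (rdual W)
  ∘ T $ (((rev V ∘ (idm V ⊗ (sr T V ∘ T $ rdualm f))) ⊗ idm (ldual (T (rdual W))))
         ∘ (idm V ⊗ coev (T (rdual W))))
  = ((rev W ∘ (f ⊗ idm (rdual W))) ⊗ idm (ldual (rdual W))) ∘ (idm (T V) ⊗ coev (rdual W)).
Proof.
  intros Hf.
  pose proof (ract_mu (free_mod T V)) as Rmu. pose proof (ract_eta (free_mod T V)) as Reta.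
  pose proof (sr_ev T V) as E.
  rewrite sr_eq. pose proof (Hom_ract (free_mod T V)) as Ha.
  change (sr T (T V) ∘ T $ rdualm (mu T V)) with (ract (free_mod T V)) in E.
  cbn [carrier free_mod] in *. set (a := ract (free_mod T V)) in *. clearbody a.
  transitivity (((com0 T ∘ T $ rev V ∘ T $ (idm V ⊗ (rdualm (eta T V) ∘ a ∘ T $ rdualm f)))
    ⊗ sl T (rdual W)) ∘ com2 T (V ⊠ T (rdual W)) (ldual (T (rdual W)))
    ∘ T $ (idm V ⊗ coev (T (rdual W)))).
  - symmetry.
    assert (hom (T (rdual W)) (rdual V) (rdualm (eta T V) ∘ a ∘ T $ rdualm f)) as Hk by homt.
    set (k := rdualm (eta T V) ∘ a ∘ T $ rdualm f) in *. clearbody k.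
    drw (com2_nat T (tmor_hom (id_hom V) Hk) (id_hom (ldual (T (rdual W))))).
    drw (com2_nat T (rev_hom V) (id_hom (ldual (T (rdual W))))).
    drw (com2_unit_l T (ldual (T (rdual W)))). diag.
  (* The axiom [E] of the right antipode introduces a second [a]; [Rmu] merges the two into
     [a ∘ mu], and the coevaluation axiom of [sl] consumes this [mu] and leaves [a ∘ eta], an
     identity. *)
  - drw E.
    drw (eq_sym (com2_nat T (id_hom V) Ha)). drw Rmu.
    drw (eq_sym (com2_nat T (id_hom V) (Hom_fmap T (Hom_rdualm Hf)))).
    drw (eq_sym (mu_nat T (Hom_rdualm Hf))).
    drw (eq_sym (com2_assoc T V (T (rdual W)) (ldual (T (rdual W))))).
    drw (eq_sym (com2_nat T (id_hom V) (coev_hom (T (rdual W))))).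
    drw (eq_sym (sl_coev T (rdual W))).
    drw (com2_unit_r T V). drw (eta_nat T (Hom_rdualm Hf)). drw Reta.
    drw (rev_rdualm Hf). diag.
Qed.

(** [K] is the naturality in [V] of the assignment [f ↦ sr T V ∘ T $ rdualm f], and [sl_sr] is its
    injectivity. *)
Lemma fmap_joint_epi (I : Type) (V : ob C) (P : I -> ob C) (e : I -> mor C) :
  (forall i, hom (P i) V (e i)) ->
  (forall W h h', hom V W h -> hom V W h' -> (forall i, h ∘ e i = h' ∘ e i) -> h = h') ->
  forall W f f', hom (T V) W f -> hom (T V) W f' ->
    (forall i, f ∘ T $ e i = f' ∘ T $ e i) -> f = f'.
Proof.
  intros He D W f f' Hf Hf' E.
  assert (K : forall i, rdualm (e i) ∘ (sr T V ∘ T $ rdualm f)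
                      = rdualm (e i) ∘ (sr T V ∘ T $ rdualm f')).
  { intros i; specialize (He i).
    assert (G : forall g, hom (T V) W g ->
      rdualm (e i) ∘ (sr T V ∘ T $ rdualm g) = sr T (P i) ∘ T $ rdualm (g ∘ T $ e i)).
    { intros g Hg. drw (sr_natural T He). rewrite (rdualm_comp (Hom_fmap T He) Hg). diag. }
    rewrite !G, E; trivial. }
  (* Bending turns [T (rdual W) → rdual V] into a morphism from [V] to [ldual (T (rdual W))], to
     which [D] applies. *)
  assert (L : ((rev W ∘ (f ⊗ idm (rdual W))) ⊗ idm (ldual (rdual W))) ∘ (idm (T V) ⊗ coev (rdual W))
            = ((rev W ∘ (f' ⊗ idm (rdual W))) ⊗ idm (ldual (rdual W)))
              ∘ (idm (T V) ⊗ coev (rdual W))).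
  { rewrite <- !sl_sr by assumption. do 2 f_equal.
    apply (D (ldual (T (rdual W)))); try homt. intros i; specialize (He i).
    assert (G : forall k, hom (T (rdual W)) (rdual V) k ->
      ((rev V ∘ (idm V ⊗ k)) ⊗ idm (ldual (T (rdual W)))) ∘ (idm V ⊗ coev (T (rdual W))) ∘ e i
      = ((rev (P i) ∘ (idm (P i) ⊗ (rdualm (e i) ∘ k))) ⊗ idm (ldual (T (rdual W))))
        ∘ (idm (P i) ⊗ coev (T (rdual W)))).
    { intros k Hk. symmetry. drw (rev_rdualm He). diag. }
    rewrite !G by homt. now rewrite K. }
  assert (G : forall g, hom (T V) W g -> g =
    (((idm one ⊗ ev (rdual W)) ∘ ((((rev W ∘ (g ⊗ idm (rdual W))) ⊗ idm (ldual (rdual W)))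
       ∘ (idm (T V) ⊗ coev (rdual W))) ⊗ idm (rdual W))) ⊗ idm W) ∘ (idm (T V) ⊗ rcoev W)).
  { intros g Hg. symmetry. drw (ldual_zigzag (rdual W)). drw (rdual_zigzag W). diag. }
  rewrite (G f), (G f') by assumption. now rewrite L.
Qed.

(** Since [ev] is linear, it can be taken out of [T]. This links [T] of the mate of [t], which
    [fmap_joint_epi] needs, to the family of [dense_fmap]. *)
Lemma fmap_pairing (N : Module T) (P V W : ob C) t g :
  hom P (carrier N ⊠ V) t -> hom (T V) W g ->
  g ∘ T $ ((ev (carrier N) ⊗ idm V) ∘ (idm (ldual (carrier N)) ⊗ t))
  = (ev (carrier N) ⊗ idm W)
    ∘ (lact N ⊗ ((idm (carrier N) ⊗ g) ∘ ((act N ⊗ idm (T V)) ∘ com2 T (carrier N) V ∘ T $ t)))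
    ∘ com2 T (ldual (carrier N)) P.
Proof.
  intros Ht Hg. symmetry.
  drw (com2_nat T (id_hom (ldual (carrier N))) Ht).
  drw (com2_assoc T (ldual (carrier N)) (carrier N) V).
  drw (lact_ev N).
  drw (com2_nat T (ev_hom (carrier N)) (id_hom V)).
  drw (com2_unit_l T V). diag.
Qed.

(** The mates of [t] are jointly epic, hence so are their images under [T]. The left factors of the
    new family are again the carriers of the [N i], so the lemma can be applied to its own
    result. *)
Lemma dense_fmap I V P t (N : I -> Module T) :
  dense V P (fun i => carrier (N i)) t ->
  dense (T V) (fun i => T (P i)) (fun i => carrier (N i))
    (fun i => (act (N i) ⊗ idm (T V)) ∘ com2 T (carrier (N i)) V ∘ T $ t i).
Proof.
  intros [Ht D]; split.
  - intros i; specialize (Ht i). cbn in Ht. homt.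
  - intros W f f' Hf Hf' E.
    apply (@fmap_joint_epi I V (fun i => ldual (carrier (N i)) ⊠ P i)
      (fun i => (ev (carrier (N i)) ⊗ idm V) ∘ (idm (ldual (carrier (N i))) ⊗ t i))) with W;
      trivial.
    + intros i; specialize (Ht i); cbn in Ht. homt.
    + intros W' h h' Hh Hh' E'. apply (D W'); trivial. intros i. specialize (E' i).
      specialize (Ht i); cbn in Ht.
      assert (G : forall g, hom V W' g -> (idm (carrier (N i)) ⊗ g) ∘ t i
        = (idm (carrier (N i)) ⊗ (g ∘ ((ev (carrier (N i)) ⊗ idm V)
           ∘ (idm (ldual (carrier (N i))) ⊗ t i)))) ∘ (coev (carrier (N i)) ⊗ idm (P i))).
      { intros g Hg. symmetry. drw (ldual_zigzag (carrier (N i))). diag. }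
      rewrite !G by assumption. now rewrite E'.
    + intros i; specialize (Ht i); specialize (E i); cbn in Ht, E.
      rewrite (fmap_pairing (N := N i) Ht Hf), (fmap_pairing (N := N i) Ht Hf'). now rewrite E.
Qed.

End DensityHopf.

(** * The centralizer and the canonical law *)

Section Centralizer.
Variables (C : AutonomousCat) (T : HopfMonad C) (Z : Centralizer T)
  (S : CentralizerStructure Z).

#[export] Instance Hom_del X Y : Hom (del Z X Y) (X ⊠ Y) (T Y ⊠ Z X) := del_hom Z X Y.
#[export] Instance Hom_zmu X : Hom (zmu S X) (Z (Z X)) (Z X).
Proof. apply (zmu_nat S). Qed.
#[export] Instance Hom_zeta X : Hom (zeta S X) X (Z X).
Proof. apply (zeta_nat S). Qed.
#[export] Instance Hom_zcom2 X Y : Hom (zcom2 S X Y) (Z (X ⊠ Y)) (Z X ⊠ Z Y) := zcom2_hom S X Y.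
#[export] Instance Hom_zcom0 : Hom (zcom0 S) (Z one) one := zcom0_hom S.

Lemma zmu_natural X Y f : hom X Y f -> Z $ f ∘ zmu S X = zmu S Y ∘ Z $ (Z $ f).
Proof. intros [<- <-]. apply (zmu_nat S). Qed.

Lemma zeta_natural X Y f : hom X Y f -> Z $ f ∘ zeta S X = zeta S Y ∘ f.
Proof. intros [<- <-]. apply (zeta_nat S). Qed.

Lemma zcom2_natural X X' Y Y' f g : hom X X' f -> hom Y Y' g ->
  (Z $ f ⊗ Z $ g) ∘ zcom2 S X Y = zcom2 S X' Y' ∘ Z $ (f ⊗ g).
Proof. intros [<- <-] [<- <-]. apply (zcom2_nat S). Qed.

Lemma del_nat_l X X' Y f : hom X X' f ->
  (idm (T Y) ⊗ Z $ f) ∘ del Z X Y = del Z X' Y ∘ (f ⊗ idm Y).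
Proof.
  intros [<- <-]. pose proof (del_nat Z f (idm Y)) as N.
  now rewrite fmap_id, dom_id, cod_id in N.
Qed.

Lemma del_nat_r X Y Y' g : hom Y Y' g ->
  (T $ g ⊗ idm (Z X)) ∘ del Z X Y = del Z X Y' ∘ (idm X ⊗ g).
Proof.
  intros [<- <-]. pose proof (del_nat Z (idm X) g) as N.
  now rewrite fmap_id, dom_id, cod_id in N.
Qed.

Lemma dense_del2 X :
  dense (Z (Z X)) (fun Y : ob C * ob C => (X ⊠ fst Y) ⊠ snd Y)
    (fun Y => T (fst Y) ⊠ T (snd Y))
    (fun Y => (idm (T (fst Y)) ⊗ del Z (Z X) (snd Y)) ∘ (del Z X (fst Y) ⊗ idm (snd Y))).
Proof.
  refine (dense_comp (P := fun Y Y' => (X ⊠ Y) ⊠ Y') (Q := fun Y _ => T Y)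
    (t := fun Y Y' => del Z X Y ⊗ idm Y') (dense_del Z (Z X)) _).
  intros Y. exact (dense_whisker Y (dense_del Z X)).
Qed.

Lemma dense_del3 X :
  dense (Z (Z (Z X))) (fun Y : (ob C * ob C) * ob C => ((X ⊠ fst (fst Y)) ⊠ snd (fst Y)) ⊠ snd Y)
    (fun Y => (T (fst (fst Y)) ⊠ T (snd (fst Y))) ⊠ T (snd Y))
    (fun Y => (idm (T (fst (fst Y)) ⊠ T (snd (fst Y))) ⊗ del Z (Z (Z X)) (snd Y))
      ∘ (((idm (T (fst (fst Y))) ⊗ del Z (Z X) (snd (fst Y)))
          ∘ (del Z X (fst (fst Y)) ⊗ idm (snd (fst Y)))) ⊗ idm (snd Y))).
Proof.
  refine (dense_comp (P := fun Y Y' => ((X ⊠ fst Y) ⊠ snd Y) ⊠ Y')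
    (Q := fun Y _ => T (fst Y) ⊠ T (snd Y))
    (t := fun Y Y' => ((idm (T (fst Y)) ⊗ del Z (Z X) (snd Y))
      ∘ (del Z X (fst Y) ⊗ idm (snd Y))) ⊗ idm Y') (dense_del Z (Z (Z X))) _).
  intros Y. exact (dense_whisker Y (dense_del2 X)).
Qed.

(** Composition with [del] exchanges the two structures: an axiom on [zcom2] and [zcom0] becomes one
    on [mu] and [eta], and an axiom on [zmu] and [zeta] becomes one on [com2] and [com0]. The
    following lemmas have the same pattern. *)
Lemma zcom2_assoc X Y W :
  (idm (Z X) ⊗ zcom2 S Y W) ∘ zcom2 S X (Y ⊠ W)
  = (zcom2 S X Y ⊗ idm (Z W)) ∘ zcom2 S (X ⊠ Y) W.
Proof.
  apply (proj2 (dense_del Z (X ⊠ Y ⊠ W)) (Z X ⊠ Z Y ⊠ Z W)); [homt|homt|]. intros V.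
  transitivity ((mu T V ⊗ idm (Z X ⊠ Z Y ⊠ Z W)) ∘ (mu T (T V) ⊗ idm (Z X ⊠ Z Y ⊠ Z W))
    ∘ (del Z X (T (T V)) ⊗ idm (Z Y ⊠ Z W)) ∘ (idm X ⊗ del Z Y (T V) ⊗ idm (Z W))
    ∘ (idm (X ⊠ Y) ⊗ del Z W V)).
  - drw (zcom2_eq S X (Y ⊠ W) V). drw (zcom2_eq S Y W V).
    drw (eq_sym (del_nat_r X (Hom_mu T V))). drw (mu_mu T V). diag.
  - rewrite (tob_assoc X Y W). symmetry. drw (zcom2_eq S (X ⊠ Y) W V).
    drw (zcom2_eq S X Y (T V)). diag.
Qed.

Lemma zcom2_unit_r X : (idm (Z X) ⊗ zcom0 S) ∘ zcom2 S X one = idm (Z X).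
Proof.
  apply (proj2 (dense_del Z (X ⊠ one)) (Z X)); [homt|homt|]. intros V.
  drw (zcom2_eq S X one V). drw (zcom0_eq S V).
  drw (eq_sym (del_nat_r X (Hom_eta T V))). drw (mu_Teta T V). rewrite tob_1r. diag.
Qed.

Lemma zcom2_unit_l X : (zcom0 S ⊗ idm (Z X)) ∘ zcom2 S one X = idm (Z X).
Proof.
  apply (proj2 (dense_del Z (one ⊠ X)) (Z X)); [homt|homt|]. intros V.
  drw (zcom2_eq S one X V). drw (zcom0_eq S (T V)). drw (mu_eta T V). rewrite tob_1l. diag.
Qed.

Lemma zmu_com2 X Y :
  zcom2 S X Y ∘ zmu S (X ⊠ Y)
  = (zmu S X ⊗ zmu S Y) ∘ zcom2 S (Z X) (Z Y) ∘ Z $ zcom2 S X Y.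
Proof.
  apply (proj2 (dense_del2 (X ⊠ Y)) (Z X ⊠ Z Y)); [homt|homt|]. intros [U V]; cbn [fst snd].
  drw (zmu_eq S (X ⊠ Y) U V). drw (zcom2_eq S X Y (U ⊠ V)).
  drw (mu_com2 T U V). drw (del_nat_r X (Hom_com2 T U V)).
  drw (eq_sym (zmu_eq S Y U V)). drw (eq_sym (zmu_eq S X (T U) (T V))).
  symmetry. drw (del_nat_l V (Hom_zcom2 X Y)). drw (zcom2_eq S X Y U).
  drw (zcom2_eq S (Z X) (Z Y) V). diag.
Qed.

Lemma zmu_com0 : zcom0 S ∘ zmu S one = zcom0 S ∘ Z $ zcom0 S.
Proof.
  apply (proj2 (dense_del2 one) one); [homt|homt|]. intros [U V]; cbn [fst snd].
  drw (zmu_eq S one U V). drw (zcom0_eq S (U ⊠ V)). drw (eta_com2 T U V).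
  symmetry. drw (del_nat_l V Hom_zcom0). drw (zcom0_eq S U). drw (zcom0_eq S V). diag.
Qed.

Lemma zeta_com2 X Y : zcom2 S X Y ∘ zeta S (X ⊠ Y) = zeta S X ⊗ zeta S Y.
Proof.
  rewrite !zeta_eq. drw (zcom2_eq S X Y one). drw (mu_com0 T).
  drw (del_nat_r X (Hom_com0 T)). diag.
Qed.

Lemma zeta_com0 : zcom0 S ∘ zeta S one = idm one.
Proof. rewrite zeta_eq. drw (zcom0_eq S one). drw (eta_com0 T). diag. Qed.

Lemma zmu_zmu X : zmu S X ∘ Z $ zmu S X = zmu S X ∘ zmu S (Z X).
Proof.
  apply (proj2 (dense_del3 X) (Z X)); [homt|homt|]. intros [[U V] W]; cbn [fst snd].
  drw (del_nat_l W (Hom_zmu X)). drw (zmu_eq S X U V). drw (zmu_eq S X (U ⊠ V) W).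
  symmetry. drw (zmu_eq S (Z X) V W). drw (zmu_eq S X U (V ⊠ W)).
  drw (com2_assoc T U V W). rewrite tob_assoc. diag.
Qed.

Lemma zmu_Zzeta X : zmu S X ∘ Z $ zeta S X = idm (Z X).
Proof.
  apply (proj2 (dense_del Z X) (Z X)); [homt|homt|]. intros V.
  drw (del_nat_l V (Hom_zeta X)). rewrite zeta_eq. drw (zmu_eq S X one V).
  drw (com2_unit_l T V). rewrite tob_1l. diag.
Qed.

Lemma zmu_zeta X : zmu S X ∘ zeta S (Z X) = idm (Z X).
Proof.
  apply (proj2 (dense_del Z X) (Z X)); [homt|homt|]. intros V.
  rewrite zeta_eq. drw (zmu_eq S X V one).
  drw (com2_unit_r T V). rewrite tob_1r. diag.
Qed.


(** * The canonical law is a comonoidal distributive law *)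

Variable Omega : CanonicalLaw Z.

#[export] Instance Hom_Om X : Hom (Omega X) (T (Z X)) (Z (T X)).
Proof. apply (Om_nat Omega). Qed.

Lemma Om_natural X Y f : hom X Y f -> Z $ (T $ f) ∘ Omega X = Omega Y ∘ T $ (Z $ f).
Proof. intros [<- <-]. apply (Om_nat Omega). Qed.

(* A form of the definition of [Omega] which does not involve the antipode. *)
Lemma Om_del X Y :
  (mu T Y ⊗ Omega X) ∘ com2 T (T Y) (Z X) ∘ T $ del Z X Y
  = (mu T Y ⊗ idm (Z (T X))) ∘ del Z (T X) (T Y) ∘ com2 T X Y.
Proof.
  pose proof (lact_coev (free_mod T Y)) as Ec.
  pose proof (fun W t =>
    fmap_pairing (N := free_mod T Y) (P := X ⊠ Y) (V := Z X) (W := W) (t := t)) as Ep.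
  pose proof (Om_eq Omega X Y) as Eo. unfold cent_i, com3 in Eo.
  pose proof (Hom_lact (free_mod T Y)) as Ha.
  rewrite <- (comp_assoc (h := ldualm _) (g := sl T (T Y))) in Eo.
  2, 3: destruct (Hom_sl T (T Y)), (Hom_ldualm (Hom_mu T Y)); dc.
  change (sl T (T Y) ∘ T $ ldualm (mu T Y)) with (lact (free_mod T Y)) in Eo.
  cbn [carrier free_mod act] in *.
  rewrite (Ep (Z (T X)) _ _ (Hom_del X Y) (Hom_Om X)) in Eo.
  set (a := lact (free_mod T Y)) in *. clearbody a.
  (* [Om_eq] concerns morphisms paired with [a] by [ev (T Y)]. The linearity [Ec] of [coev (T Y)]
     recovers [A] from such a pairing. *)
  assert (G : forall A, hom (T (X ⊠ Y)) (T Y ⊠ Z (T X)) A ->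
    A = (idm (T Y) ⊗ ((ev (T Y) ⊗ idm (Z (T X))) ∘ (a ⊗ A) ∘ com2 T (ldual (T Y)) (X ⊠ Y)))
      ∘ (mu T Y ⊗ idm (T (ldual (T Y) ⊠ X ⊠ Y)))
      ∘ com2 T (T Y) (ldual (T Y) ⊠ X ⊠ Y) ∘ T $ (coev (T Y) ⊗ idm (X ⊠ Y))).
  { intros A HA. symmetry.
    drw (com2_assoc T (T Y) (ldual (T Y)) (X ⊠ Y)).
    drw (eq_sym (com2_nat T (coev_hom (T Y)) (id_hom (X ⊠ Y)))).
    drw Ec. drw (com2_unit_l T (X ⊠ Y)). drw (ldual_zigzag (T Y)). diag. }
  etransitivity; [apply G; homt|]. symmetry. etransitivity; [apply G; homt|].
  symmetry; do 4 f_equal.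
  transitivity ((ev (T Y) ⊗ idm (Z (T X)))
   ∘ (a ⊗ ((idm (T Y) ⊗ Omega X) ∘ ((mu T Y ⊗ idm (T (Z X))) ∘ com2 T (T Y) (Z X) ∘ T $ del Z X Y)))
   ∘ com2 T (ldual (T Y)) (X ⊠ Y)); [diag|].
  rewrite Eo. drw (ev_ldualm (Hom_mu T Y)). diag.
Qed.

(** This lemma and the next three are the axioms of a distributive law; [Om_com2] and [Om_com0] add
    that it is comonoidal. *)
Lemma Om_eta X : Omega X ∘ eta T (Z X) = Z $ eta T X.
Proof.
  apply (proj2 (dense_del Z X) (Z (T X))); [homt|homt|]. intros V. symmetry.
  drw (del_nat_l V (Hom_eta T X)).
  (* The inserted identity supplies the factor [mu T V] of [Om_del], and its [eta] passes through
     [del] to join the other one in [com2 ∘ eta]. *)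
  transitivity (((mu T V ∘ T $ eta T V) ⊗ idm (Z (T X))) ∘ del Z (T X) V ∘ (eta T X ⊗ idm V)).
  { rewrite mu_Teta. diag. }
  drw (del_nat_r (T X) (Hom_eta T V)). drw (eq_sym (eta_com2 T X V)).
  drw (eq_sym (Om_del X V)). drw (eta_nat T (Hom_del X V)). drw (eta_com2 T (T V) (Z X)).
  drw (mu_eta T V). diag.
Qed.

Lemma Om_zeta X : Omega X ∘ T $ zeta S X = zeta S (T X).
Proof.
  rewrite !zeta_eq. symmetry.
  (* The counit law supplies the factor [com2 T X one] with which the right side of [Om_del]
     begins. *)
  transitivity ((com0 T ⊗ idm (Z (T X))) ∘ del Z (T X) one ∘
    ((idm (T X) ⊗ com0 T) ∘ com2 T X one)).
  { rewrite com2_unit_r. diag. }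
  drw (eq_sym (del_nat_r (T X) (Hom_com0 T))). drw (eq_sym (mu_com0 T)).
  drw (eq_sym (Om_del X one)). drw (mu_com0 T). drw (com2_nat T (Hom_com0 T) (id_hom (Z X))).
  drw (com2_unit_l T (Z X)). diag.
Qed.

(** Both sides start from [T (T (Z X))], so the family [del] is passed through [T] twice, with the
    same free modules. *)
Lemma Om_mu X : Omega X ∘ mu T (Z X) = Z $ mu T X ∘ Omega (T X) ∘ T $ Omega X.
Proof.
  apply (proj2 (dense_fmap (N := free_mod T) (dense_fmap (N := free_mod T) (dense_del Z X)))
    (Z (T X))); [homt|homt|]. intros V; cbn [carrier act free_mod].
  drw (eq_sym (com2_nat T (Hom_mu T V) (id_hom (T (Z X))))).
  drw (mu_mu T V). drw (eq_sym (mu_com2 T (T V) (Z X))).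
  drw (eq_sym (mu_nat T (Hom_del X V))). drw (Om_del X V). drw (mu_com2 T X V).
  symmetry.
  drw (com2_nat T (id_hom (T V)) (Hom_Om X)). drw (Om_del X V).
  drw (eq_sym (com2_nat T (Hom_mu T V) (id_hom (Z (T X))))). drw (mu_mu T V).
  drw (Om_del (T X) (T V)). drw (del_nat_l (T (T V)) (Hom_mu T X)).
  drw (eq_sym (mu_mu T V)). drw (del_nat_r (T X) (Hom_mu T V)). diag.
Qed.

(** For the source [T (Z (Z X))] two copies of [del] are needed; their left factor [T U ⊠ T V]
    carries the tensor product of free modules. *)
Lemma Om_zmu X : Omega X ∘ T $ zmu S X = zmu S (T X) ∘ Z $ Omega X ∘ Omega (Z X).
Proof.
  apply (proj2 (dense_fmap
    (N := fun Y : ob C * ob C => mod_tensor (free_mod T (fst Y)) (free_mod T (snd Y)))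
    (dense_del2 X)) (Z (T X))); [homt|homt|].
  intros [U V]; cbn [carrier act free_mod mod_tensor fst snd].
  drw (com2_nat T (id_hom (T U ⊠ T V)) (Hom_zmu X)). drw (zmu_eq S X U V).
  drw (eq_sym (com2_nat T (Hom_com2 T U V) (id_hom (Z X)))).
  drw (eq_sym (mu_com2 T U V)). drw (Om_del X (U ⊠ V)).
  drw (mu_com2 T U V). drw (del_nat_r (T X) (Hom_com2 T U V)).
  drw (com2_assoc T X U V). drw (eq_sym (zmu_eq S (T X) (T U) (T V))).
  symmetry.
  drw (eq_sym (com2_assoc T (T U) (T V) (Z (Z X)))).
  drw (eq_sym (com2_nat T (id_hom (T U)) (Hom_del (Z X) V))).
  drw (Om_del (Z X) V). drw (com2_assoc T (T U) (Z X) V).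
  drw (eq_sym (com2_nat T (Hom_del X U) (id_hom V))).
  drw (del_nat_l (T V) (Hom_Om X)). drw (Om_del X U). diag.
Qed.

Lemma Om_com2 X Y :
  zcom2 S (T X) (T Y) ∘ Z $ com2 T X Y ∘ Omega (X ⊠ Y)
  = (Omega X ⊗ Omega Y) ∘ com2 T (Z X) (Z Y) ∘ T $ zcom2 S X Y.
Proof.
  apply (proj2 (dense_fmap (N := free_mod T) (dense_del Z (X ⊠ Y))) (Z (T X) ⊠ Z (T Y)));
    [homt|homt|]. intros V; cbn [carrier act free_mod].
  drw (Om_del (X ⊠ Y) V). drw (del_nat_l (T V) (Hom_com2 T X Y)).
  drw (zcom2_eq S (T X) (T Y) (T V)). drw (eq_sym (mu_mu T V)).
  drw (del_nat_r (T X) (Hom_mu T V)). drw (eq_sym (com2_assoc T X Y V)).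
  symmetry.
  drw (com2_nat T (id_hom (T V)) (Hom_zcom2 X Y)). drw (zcom2_eq S X Y V).
  drw (eq_sym (com2_nat T (Hom_mu T V) (id_hom (Z X ⊠ Z Y)))). drw (mu_mu T V).
  drw (com2_assoc T (T (T V)) (Z X) (Z Y)).
  drw (eq_sym (com2_nat T (Hom_del X (T V)) (id_hom (Z Y)))).
  drw (Om_del X (T V)). drw (eq_sym (com2_assoc T X (T V) (Z Y))).
  drw (eq_sym (com2_nat T (id_hom X) (Hom_del Y V))).
  drw (eq_sym (mu_mu T V)). drw (del_nat_r (T X) (Hom_mu T V)).
  drw (Om_del Y V). diag.
Qed.

Lemma Om_com0 : zcom0 S ∘ Z $ com0 T ∘ Omega one = com0 T ∘ T $ zcom0 S.
Proof.
  apply (proj2 (dense_fmap (N := free_mod T) (dense_del Z one)) one);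
    [homt|homt|]. intros V; cbn [carrier act free_mod].
  drw (Om_del one V). drw (del_nat_l (T V) (Hom_com0 T)). drw (zcom0_eq S (T V)).
  drw (com2_unit_l T V). drw (mu_eta T V).
  symmetry.
  drw (com2_nat T (id_hom (T V)) Hom_zcom0). drw (zcom0_eq S V).
  drw (com2_unit_r T (T V)). drw (mu_Teta T V). diag.
Qed.

End Centralizer.

(** * The double as a bimonad *)

Section Double.
Variables (C : AutonomousCat) (T : HopfMonad C) (Z : Centralizer T)
  (S : CentralizerStructure Z) (Omega : CanonicalLaw Z).

Lemma double_comonoidal : is_comonoidal (comp_comon (cent_bimonad_data S) T).
Proof.
  split; [|split; [|split; [|split; [|split]]]]; unfold com3; cbn.
  - intros X Y. homt.
  - homt.
  - intros f g. assert (Hf : hom (dom f) (cod f) f) by now split.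
    assert (Hg : hom (dom g) (cod g) g) by now split.
    drw (zcom2_natural S (Hom_fmap T Hf) (Hom_fmap T Hg)). drw (com2_nat T Hf Hg). diag.
  - intros X Y W.
    drw (zcom2_natural S (id_hom (T X)) (Hom_com2 T Y W)).
    drw (zcom2_assoc S (T X) (T Y) (T W)). drw (com2_assoc T X Y W).
    symmetry. drw (zcom2_natural S (Hom_com2 T X Y) (id_hom (T W))). diag.
  - intros X. drw (zcom2_natural S (id_hom (T X)) (Hom_com0 T)).
    drw (zcom2_unit_r S (T X)). drw (com2_unit_r T X). diag.
  - intros X. drw (zcom2_natural S (Hom_com0 T) (id_hom (T X))).
    drw (zcom2_unit_l S (T X)). drw (com2_unit_l T X). diag.
Qed.

Lemma double_mu_comonoidal :
  comonoidal_nat (comp_comon (double S Omega) (double S Omega)) (double S Omega)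
    (mu (double S Omega)).
Proof.
  split; [split|split]; cbn.
  - intros X; homt.
  - intros f. assert (Hf : hom (dom f) (cod f) f) by now split.
    drw (zmu_natural S (Hom_fmap T Hf)). drw (mu_nat T Hf).
    drw (Om_natural Omega (Hom_fmap T Hf)). diag.
  - intros X Y.
    drw (zmu_natural S (Hom_com2 T X Y)). drw (zmu_com2 S (T X) (T Y)).
    drw (mu_com2 T X Y). drw (Om_natural Omega (Hom_com2 T X Y)).
    drw (eq_sym (zcom2_natural S (Hom_mu T X) (Hom_mu T Y))).
    drw (Om_com2 S Omega (T X) (T Y)).
    drw (eq_sym (zcom2_natural S (Hom_fmap Z (Hom_mu T X)) (Hom_fmap Z (Hom_mu T Y)))).
    drw (eq_sym (zcom2_natural S (Hom_Om Omega (T X)) (Hom_Om Omega (T Y)))). diag.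
  - drw (zmu_natural S (Hom_com0 T)). drw (zmu_com0 S). drw (mu_com0 T).
    drw (Om_natural Omega (Hom_com0 T)). drw (Om_com0 S Omega). diag.
Qed.

Lemma double_eta_comonoidal :
  comonoidal_nat (id_comon C) (double S Omega) (eta (double S Omega)).
Proof.
  split; [split|split]; cbn.
  - intros X; homt.
  - intros f. assert (Hf : hom (dom f) (cod f) f) by now split.
    drw (zeta_natural S (Hom_fmap T Hf)). drw (eta_nat T Hf). diag.
  - intros X Y. drw (zeta_natural S (Hom_com2 T X Y)). drw (zeta_com2 S (T X) (T Y)).
    drw (eta_com2 T X Y). diag.
  - drw (zeta_natural S (Hom_com0 T)). drw (zeta_com0 S). drw (eta_com0 T). diag.
Qed.

(** The monad laws are those of Beck's composite monad: each axiom of a distributive law moves one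
    structure morphism of [T] or [Z] across [Omega]. *)
Lemma double_bimonad : is_bimonad (double S Omega).
Proof.
  split; [exact double_comonoidal|]. split; [exact double_mu_comonoidal|].
  split; [exact double_eta_comonoidal|]. split; [|split]; cbn; intros X.
  - drw (Om_zmu S Omega (T X)). drw (zmu_natural S (Hom_mu T X)).
    drw (eq_sym (Om_natural Omega (Hom_fmap Z (Hom_mu T X)))).
    drw (eq_sym (Om_natural Omega (Hom_Om Omega (T X)))).
    drw (eq_sym (Om_natural Omega (Hom_mu T X))). drw (mu_mu T X).
    symmetry.
    drw (zmu_natural S (Hom_Om Omega (T X))). drw (zmu_natural S (Hom_fmap Z (Hom_mu T X))).
    drw (eq_sym (zmu_zmu S (T X))). drw (Om_mu Omega (T X)). diag.
  - drw (Om_zeta S Omega (T X)). drw (zeta_natural S (Hom_mu T X)). drw (zmu_Zzeta S (T X)).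
    drw (mu_Teta T X). diag.
  - drw (zeta_natural S (Hom_Om Omega (T X))). drw (zeta_natural S (Hom_fmap Z (Hom_mu T X))).
    drw (zmu_zeta S (T X)). drw (Om_eta Omega (T X)). drw (mu_eta T X). diag.
Qed.

End Double.

(** * Modules over the double and objects of the center *)

Section Modules.
Variables (C : MonCat) (T : Bimonad C).

Lemma mmor_comp (g f : ModMor T) :
  msrc g = mtgt f -> mmor (mod_comp g f) = mmor g ∘ mmor f.
Proof. intros e; exact (fmap_comp (mod_forget_functor T) e). Qed.

Lemma msrc_comp (g f : ModMor T) : msrc g = mtgt f -> msrc (mod_comp g f) = msrc f.
Proof. exact (@dom_comp (ModCat T) g f). Qed.

Lemma mtgt_comp (g f : ModMor T) : msrc g = mtgt f -> mtgt (mod_comp g f) = mtgt g.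
Proof. exact (@cod_comp (ModCat T) g f). Qed.

#[export] Instance Hom_mmor (f : ModMor T) :
  Hom (mmor f) (carrier (msrc f)) (carrier (mtgt f)) := mmor_hom f.

(** The inverse of a linear morphism is linear, so half braidings may be inverted in [C]. *)
Lemma mod_is_iso (f : ModMor T) : is_iso (mmor f) -> @is_iso (ModCat T) f.
Proof.
  destruct f as [M N f Hf L]; cbn. intros (g & Hg & l & r). destruct (Hf) as [df cf].
  rewrite df, cf in *.
  assert (Lg : g ∘ act N = act M ∘ T $ g).
  { transitivity (g ∘ (act N ∘ T $ (f ∘ g))); [rewrite r; diag|].
    drw (eq_sym L). drw l. diag. }
  exists (@Build_ModMor C T N M g Hg Lg). split; [now split|]. split; cbn.
  - apply modmor_ext; [rewrite msrc_comp | rewrite mtgt_comp | rewrite mmor_comp]; trivial.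
  - apply modmor_ext; [rewrite msrc_comp | rewrite mtgt_comp | rewrite mmor_comp]; trivial.
Qed.

End Modules.

Lemma functor_ext (C D : Category) (F G : Functor C D) :
  (forall X, F X = G X) -> (forall f, F $ f = G $ f) -> F = G.
Proof.
  destruct F as [Fo Fm ? ? ? ?], G as [Go Gm ? ? ? ?]; cbn. intros E1 E2.
  assert (Fo = Go) as -> by now apply functional_extensionality.
  assert (Fm = Gm) as -> by now apply functional_extensionality.
  f_equal; apply proof_irrelevance.
Qed.

Lemma monfunctor_ext (C D : MonCat) (F G : MonFunctor C D) :
  (forall X, F X = G X) -> (forall f, F $ f = G $ f) ->
  (forall X Y, mon2 F X Y = mon2 G X Y) -> mon0 F = mon0 G -> F = G.
Proof.
  intros E1 E2. pose proof (functor_ext E1 E2) as E. clear E1 E2. revert E.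
  destruct F as [F F2 F0 ? ? ? ? ? ?], G as [G G2 G0 ? ? ? ? ? ?]; cbn. intros -> E3 E4.
  assert (F2 = G2) as ->.
  { apply functional_extensionality; intros X. now apply functional_extensionality. }
  subst G0. f_equal; apply proof_irrelevance.
Qed.

(** * Compatible pairs of actions and their half braidings *)

Section Paired.
Variables (C : AutonomousCat) (T : HopfMonad C) (Z : Centralizer T)
  (S : CentralizerStructure Z) (Omega : CanonicalLaw Z).

(** Beck's description of modules over a composite monad: [pact_act] says that [pact] is linear when
    [Z (carrier pmod)] carries the action [Z $ act pmod ∘ Omega (carrier pmod)]. *)
Record PairedModule := {
  pmod :> Module T;
  pact : mor C;
  pact_hom : hom (Z (carrier pmod)) (carrier pmod) pact;
  pact_mu : pact ∘ Z $ pact = pact ∘ zmu S (carrier pmod);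
  pact_zeta : pact ∘ zeta S (carrier pmod) = idm (carrier pmod);
  pact_act : act pmod ∘ T $ pact = pact ∘ Z $ act pmod ∘ Omega (carrier pmod)
}.

#[export] Instance Hom_pact (M : PairedModule) : Hom (pact M) (Z (carrier M)) (carrier M) :=
  pact_hom M.

Lemma paired_ext (M N : PairedModule) : pmod M = pmod N -> pact M = pact N -> M = N.
Proof. destruct M, N; cbn; intros -> ->; f_equal; apply proof_irrelevance. Qed.

Definition pbraid (M : PairedModule) (N : Module T) : mor C :=
  (act N ⊗ pact M) ∘ del Z (carrier M) (carrier N).

#[export] Instance Hom_pbraid M N :
  Hom (pbraid M N) (carrier M ⊠ carrier N) (carrier N ⊠ carrier M).
Proof. unfold pbraid, Hom. homt. Qed.

(** [pact_act] introduces [Omega], [Om_del] eliminates it, and the associativity of [act N] accounts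
    for the two occurrences of [mu]. *)
Lemma pbraid_lin (M : PairedModule) (N : Module T) :
  pbraid M N ∘ ((act M ⊗ act N) ∘ com2 T (carrier M) (carrier N))
  = ((act N ⊗ act M) ∘ com2 T (carrier N) (carrier M)) ∘ T $ pbraid M N.
Proof.
  unfold pbraid. symmetry.
  drw (eq_sym (com2_nat T (act_hom N) (pact_hom M))).
  drw (act_mu N). drw (pact_act M). drw (Om_del Omega (carrier M) (carrier N)).
  drw (eq_sym (act_mu N)). drw (del_nat_l Z (T (carrier N)) (act_hom M)).
  drw (del_nat_r Z (carrier M) (act_hom N)). diag.
Qed.

Lemma pbraid_nat (M : PairedModule) (f : ModMor T) :
  (mmor f ⊗ idm (carrier M)) ∘ pbraid M (msrc f) = pbraid M (mtgt f) ∘ (idm (carrier M) ⊗ mmor f).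
Proof.
  unfold pbraid. drw (mmor_lin f). drw (del_nat_r Z (carrier M) (mmor_hom f)). diag.
Qed.

(** Comes from the associativity of [pact], as [pbraid_one] comes from its unit law, because [zmu]
    and [zeta] are read off from [del] at a product and at [one]. *)
Lemma pbraid_tensor (M : PairedModule) (N N' : Module T) :
  pbraid M (mod_tensor N N')
  = (idm (carrier N) ⊗ pbraid M N') ∘ (pbraid M N ⊗ idm (carrier N')).
Proof.
  unfold pbraid; cbn [act carrier mod_tensor]. symmetry.
  drw (eq_sym (del_nat_l Z (carrier N') (pact_hom M))).
  drw (pact_mu M). drw (zmu_eq S (carrier M) (carrier N) (carrier N')). diag.
Qed.

Lemma pbraid_one (M : PairedModule) : pbraid M (mod_one T) = idm (carrier M).
Proof.
  unfold pbraid; cbn [act carrier mod_one].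
  transitivity (pact M ∘ ((com0 T ⊗ idm (Z (carrier M))) ∘ del Z (carrier M) one)); [diag|].
  rewrite <- (zeta_eq S). apply pact_zeta.
Qed.

(* The inverse is given by the half braiding of the right dual of [N]. *)
Lemma pbraid_iso (M : PairedModule) (N : Module T) : is_iso (pbraid M N).
Proof.
  (* [A] and [B] are the naturality of the half braiding along [rcoev] and [rev], with its value at
     a product expanded and its value at the unit trivial. *)
  assert (A : (idm (rdual (carrier N)) ⊗ pbraid M N)
    ∘ (((ract N ⊗ pact M) ∘ del Z (carrier M) (rdual (carrier N))) ⊗ idm (carrier N))
    ∘ (idm (carrier M) ⊗ rcoev (carrier N)) = rcoev (carrier N) ⊗ idm (carrier M)).
  { unfold pbraid. drw (eq_sym (del_nat_l Z (carrier N) (pact_hom M))).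
    drw (pact_mu M). drw (zmu_eq S (carrier M) (rdual (carrier N)) (carrier N)).
    drw (eq_sym (del_nat_r Z (carrier M) (rcoev_hom (carrier N)))).
    drw (ract_rcoev N). drw (eq_sym (zeta_eq S (carrier M))). drw (pact_zeta M). diag. }
  assert (B : (rev (carrier N) ⊗ idm (carrier M))
    ∘ (idm (carrier N) ⊗ ((ract N ⊗ pact M) ∘ del Z (carrier M) (rdual (carrier N))))
    ∘ (pbraid M N ⊗ idm (rdual (carrier N))) = idm (carrier M) ⊗ rev (carrier N)).
  { unfold pbraid. drw (eq_sym (del_nat_l Z (rdual (carrier N)) (pact_hom M))).
    drw (pact_mu M). drw (zmu_eq S (carrier M) (carrier N) (rdual (carrier N))).
    drw (ract_rev N).
    drw (del_nat_r Z (carrier M) (rev_hom (carrier N))).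
    drw (eq_sym (zeta_eq S (carrier M))). drw (pact_zeta M). diag. }
  exists ((rev (carrier N) ⊗ idm (carrier M ⊠ carrier N))
    ∘ (idm (carrier N) ⊗ ((ract N ⊗ pact M) ∘ del Z (carrier M) (rdual (carrier N)))
       ⊗ idm (carrier N))
    ∘ (idm (carrier N ⊠ carrier M) ⊗ rcoev (carrier N))).
  destruct (Hom_pbraid M N) as [-> ->]. split; [homt|]. split.
  - drw B. drw (rdual_zigzag (carrier N)). diag.
  - drw A. drw (rdual_zigzag (carrier N)). diag.
Qed.

Definition pbraid_mor (M : PairedModule) (N : Module T) : ModMor T :=
  @Build_ModMor _ _ (mod_tensor M N) (mod_tensor N M) (pbraid M N) (Hom_pbraid M N)
    (pbraid_lin M N).

Program Definition center_of (M : PairedModule) : CenterOb (ModMon T) :=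
  {| cob := pmod M : ob (ModMon T); hb := pbraid_mor M |}.
Next Obligation. intros; split; reflexivity. Qed.
Next Obligation.
  intros M f; cbn. apply modmor_ext;
    [rewrite !msrc_comp | rewrite !mtgt_comp | rewrite !mmor_comp]; trivial.
  apply pbraid_nat.
Qed.
Next Obligation. intros; apply mod_is_iso, pbraid_iso. Qed.
Next Obligation.
  intros M N N'; cbn in *.
  assert (E : mod_tensor N (mod_tensor M N') = mod_tensor (mod_tensor N M) N')
    by apply mod_tensor_assoc.
  apply modmor_ext.
  - rewrite msrc_comp by exact E. apply mod_tensor_assoc.
  - rewrite mtgt_comp by exact E. symmetry; apply mod_tensor_assoc.
  - rewrite mmor_comp by exact E. apply pbraid_tensor.
Qed.
Next Obligation.
  intros M; cbn in *. apply modmor_ext; cbn.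
  - apply mod_tensor_1r.
  - apply mod_tensor_1l.
  - apply pbraid_one.
Qed.

Section DoubleAction.
Variables (X : ob C) (q : mor C).
Hypothesis Hq : hom (Z (T X)) X q.
Hypothesis q_mu : q ∘ Z $ (T $ q) = q ∘ (zmu S (T X) ∘ Z $ (Z $ mu T X) ∘ Z $ Omega (T X)).
Hypothesis q_eta : q ∘ (zeta S (T X) ∘ eta T X) = idm X.

(** The action [q] is restricted along [zeta S (T X)] and [Z $ eta T X], the components of the monad
    morphisms from [T] and [Z] to the double. Its source is written [Z (T X)], so that diagrams see
    two functors. *)
Lemma double_act_T_hom : hom (T X) X (q ∘ zeta S (T X)).
Proof. homt. Qed.

Lemma double_act_Z_hom : hom (Z X) X (q ∘ Z $ eta T X).
Proof. homt. Qed.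

Lemma double_act_T_mu :
  (q ∘ zeta S (T X)) ∘ T $ (q ∘ zeta S (T X)) = (q ∘ zeta S (T X)) ∘ mu T X.
Proof.
  drw (eq_sym (zeta_natural S (Hom_fmap T Hq))). drw q_mu.
  drw (zeta_natural S (Hom_Om Omega (T X))). drw (zeta_natural S (Hom_fmap Z (Hom_mu T X))).
  drw (zmu_zeta S (T X)). drw (Om_zeta S Omega (T X)). drw (zeta_natural S (Hom_mu T X)). diag.
Qed.

Lemma double_act_T_eta : (q ∘ zeta S (T X)) ∘ eta T X = idm X.
Proof. drw q_eta. diag. Qed.

Lemma double_act_Z_mu :
  (q ∘ Z $ eta T X) ∘ Z $ (q ∘ Z $ eta T X) = (q ∘ Z $ eta T X) ∘ zmu S X.
Proof.
  drw (eq_sym (eta_nat T Hq)). drw q_mu.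
  drw (Om_eta Omega (T X)). drw (mu_eta T X).
  symmetry. drw (zmu_natural S (Hom_eta T X)). diag.
Qed.

Lemma double_act_Z_zeta : (q ∘ Z $ eta T X) ∘ zeta S X = idm X.
Proof. drw (zeta_natural S (Hom_eta T X)). drw q_eta. diag. Qed.

(** Inside the double, multiplying the images of [Z] and [T] gives the identity of [Z (T X)]; hence
    the two restrictions determine [q]. *)
Lemma double_actE : (q ∘ Z $ eta T X) ∘ Z $ (q ∘ zeta S (T X)) = q.
Proof.
  drw (eq_sym (eta_nat T Hq)). drw q_mu.
  drw (Om_eta Omega (T X)). drw (mu_eta T X). drw (zmu_Zzeta S (T X)). diag.
Qed.

Lemma double_act_compat :
  (q ∘ zeta S (T X)) ∘ T $ (q ∘ Z $ eta T X)
  = (q ∘ Z $ eta T X) ∘ Z $ (q ∘ zeta S (T X)) ∘ Omega X.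
Proof.
  rewrite double_actE.
  drw (eq_sym (zeta_natural S (Hom_fmap T Hq))). drw q_mu.
  drw (zeta_natural S (Hom_Om Omega (T X))). drw (zeta_natural S (Hom_fmap Z (Hom_mu T X))).
  drw (zmu_zeta S (T X)). drw (eq_sym (Om_natural Omega (Hom_eta T X))).
  drw (mu_Teta T X). diag.
Qed.

End DoubleAction.

Definition DT : Bimonad C := {| bdata := double S Omega; bimonadP := double_bimonad S Omega |}.

Program Definition paired_of_double (M : Module DT) : PairedModule :=
  {| pmod := {| carrier := carrier M; act := act M ∘ zeta S (T (carrier M)) |};
     pact := act M ∘ Z $ eta T (carrier M) |}.
Next Obligation. intros M. exact (double_act_T_hom (act_hom M)). Qed.
Next Obligation. intros M. exact (double_act_T_mu (act_hom M) (act_mu M)). Qed.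
Next Obligation. intros M. exact (double_act_T_eta (act_hom M) (act_eta M)). Qed.
Next Obligation. intros M. exact (double_act_Z_hom (act_hom M)). Qed.
Next Obligation. intros M. exact (double_act_Z_mu (act_hom M) (act_mu M)). Qed.
Next Obligation. intros M. exact (double_act_Z_zeta (act_hom M) (act_eta M)). Qed.
Next Obligation. intros M. exact (double_act_compat (act_hom M) (act_mu M)). Qed.

Program Definition double_of_paired (M : PairedModule) : Module DT :=
  {| carrier := carrier M; act := pact M ∘ Z $ act M |}.
Next Obligation. intros M; cbn. homt. Qed.
Next Obligation.
  intros M; cbn. drw (pact_act M).
  drw (eq_sym (Om_natural Omega (act_hom M))). drw (act_mu M). drw (pact_mu M).
  drw (eq_sym (zmu_natural S (act_hom M))). diag.
Qed.
Next Obligation.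
  intros M; cbn. drw (zeta_natural S (act_hom M)). drw (act_eta M). drw (pact_zeta M). diag.
Qed.

Lemma paired_of_doubleK M : double_of_paired (paired_of_double M) = M.
Proof.
  apply module_ext; [reflexivity|]. exact (double_actE (act_hom M) (act_mu M)).
Qed.

Lemma double_of_pairedK M : paired_of_double (double_of_paired M) = M.
Proof.
  apply paired_ext; [apply module_ext; [reflexivity|]|]; cbn.
  - drw (zeta_natural S (act_hom M)). drw (pact_zeta M). diag.
  - drw (act_eta M). diag.
Qed.

(** * The action of the centralizer recovered from a half braiding *)

Section FromCenter.
Variable c : CenterOb (ModMon T).
Let M : Module T := cob c.

Definition chb (N : Module T) : mor C := mmor (hb c N : ModMor T).

Lemma hb_src N : msrc (hb c N) = mod_tensor M N.
Proof. apply (hb_hom c N). Qed.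

Lemma hb_tgt N : mtgt (hb c N) = mod_tensor N M.
Proof. apply (hb_hom c N). Qed.

#[local] Instance Hom_chb N : Hom (chb N) (carrier M ⊠ carrier N) (carrier N ⊠ carrier M).
Proof.
  pose proof (mmor_hom (hb c N)) as H. rewrite hb_src, hb_tgt in H. exact H.
Qed.

Lemma chb_lin N :
  chb N ∘ ((act M ⊗ act N) ∘ com2 T (carrier M) (carrier N))
  = ((act N ⊗ act M) ∘ com2 T (carrier N) (carrier M)) ∘ T $ chb N.
Proof.
  pose proof (mmor_lin (hb c N)) as H. rewrite hb_src, hb_tgt in H. exact H.
Qed.

Lemma chb_nat (f : ModMor T) :
  (mmor f ⊗ idm (carrier M)) ∘ chb (msrc f) = chb (mtgt f) ∘ (idm (carrier M) ⊗ mmor f).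
Proof.
  pose proof (f_equal (@mmor C T) (hb_nat c f)) as H.
  cbn in H; rewrite !mmor_comp in H; [exact H|..];
    cbn; now rewrite ?hb_src, ?hb_tgt.
Qed.

Lemma chb_tensor N N' :
  chb (mod_tensor N N') = (idm (carrier N) ⊗ chb N') ∘ (chb N ⊗ idm (carrier N')).
Proof.
  pose proof (f_equal (@mmor C T) (hb_tensor c N N')) as H.
  cbn in H; rewrite !mmor_comp in H; [exact H|].
  cbn. rewrite hb_src, hb_tgt. apply mod_tensor_assoc.
Qed.

Lemma chb_one : chb (mod_one T) = idm (carrier M).
Proof. exact (f_equal (@mmor C T) (hb_one c)). Qed.

Definition free_mor (X Y : ob C) g (Hg : hom X Y g) : ModMor T.
Proof.
  refine (@Build_ModMor _ _ (free_mod T X) (free_mod T Y) (T $ g) (fmap_hom T Hg) _).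
  exact (mu_nat T Hg).
Defined.

Definition free_act (N : Module T) : ModMor T.
Proof.
  refine (@Build_ModMor _ _ (free_mod T (carrier N)) N (act N) (act_hom N) _).
  symmetry; exact (act_mu N).
Defined.

(** On free modules the half braiding is natural in [Y]; precomposed with [eta] it is a family out
    of [carrier M ⊠ Y], which factors through [del]. *)
Lemma center_act_exists :
  exists r, hom (Z (carrier M)) (carrier M) r /\
    forall Y, chb (free_mod T Y) ∘ (idm (carrier M) ⊗ eta T Y)
              = (idm (T Y) ⊗ r) ∘ del Z (carrier M) Y.
Proof.
  destruct (@del_univ _ _ Z (carrier M) (carrier M)
    (fun Y => chb (free_mod T Y) ∘ (idm (carrier M) ⊗ eta T Y))) as (r & H & _).
  - intros Y. pose proof (Hom_chb (free_mod T Y)) as H. cbn in H. homt.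
  - intros g. assert (Hg : hom (dom g) (cod g) g) by now split.
    pose proof (Hom_chb (free_mod T (dom g))) as H1.
    pose proof (Hom_chb (free_mod T (cod g))) as H2. cbn in H1, H2.
    pose proof (chb_nat (free_mor Hg)) as N; cbn in N.
    drw N. drw (eta_nat T Hg). diag.
  - now exists r.
Qed.

Definition center_act : mor C :=
  proj1_sig (constructive_indefinite_description _ center_act_exists).

#[local] Instance Hom_center_act : Hom center_act (Z (carrier M)) (carrier M).
Proof. unfold center_act. now destruct constructive_indefinite_description. Qed.

Lemma center_actE Y :
  chb (free_mod T Y) ∘ (idm (carrier M) ⊗ eta T Y)
  = (idm (T Y) ⊗ center_act) ∘ del Z (carrier M) Y.
Proof. unfold center_act. now destruct constructive_indefinite_description. Qed.

(** [act N] is a linear morphism from the free module on [carrier N], split in [C] by [eta], so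
    naturality along it determines the half braiding at [N]. *)
Lemma chbE N : chb N = (act N ⊗ center_act) ∘ del Z (carrier M) (carrier N).
Proof.
  pose proof (center_actE (carrier N)) as E. pose proof (chb_nat (free_act N)) as F. cbn in F.
  pose proof (Hom_chb (free_mod T (carrier N))) as H. cbn in H.
  symmetry. drw (eq_sym E). drw F. drw (act_eta N). diag.
Qed.

Lemma center_act_zeta : center_act ∘ zeta S (carrier M) = idm (carrier M).
Proof. rewrite <- chb_one, chbE, zeta_eq. cbn. diag. Qed.

(** The converse of [pbraid_tensor]: the tensor axiom at two free modules, restricted along
    [eta T U ⊗ eta T V], is the claim tested on two copies of [del]. *)
Lemma center_act_mu : center_act ∘ Z $ center_act = center_act ∘ zmu S (carrier M).
Proof.
  apply (proj2 (dense_del2 Z (carrier M)) (carrier M)); [homt|homt|].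
  intros [U V]; cbn [fst snd].
  pose proof (chb_tensor (free_mod T U) (free_mod T V)) as E. rewrite !chbE in E.
  cbn [carrier act mod_tensor free_mod] in E.
  symmetry. drw (zmu_eq S (carrier M) U V).
  transitivity (((((mu T U ⊗ mu T V) ∘ com2 T (T U) (T V)) ⊗ center_act)
    ∘ del Z (carrier M) (T U ⊠ T V)) ∘ (idm (carrier M) ⊗ eta T U ⊗ eta T V)).
  - symmetry. drw (eq_sym (del_nat_r Z (carrier M) (tmor_hom (Hom_eta T U) (Hom_eta T V)))).
    drw (eq_sym (com2_nat T (Hom_eta T U) (Hom_eta T V))).
    drw (mu_Teta T U). drw (mu_Teta T V). diag.
  - rewrite E.
    drw (eq_sym (del_nat_r Z (carrier M) (Hom_eta T U))).
    drw (eq_sym (del_nat_r Z (carrier M) (Hom_eta T V))).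
    drw (mu_Teta T U). drw (mu_Teta T V).
    symmetry. drw (del_nat_l Z V Hom_center_act). diag.
Qed.

(** The converse of [pbraid_lin]: linearity of the half braiding at free modules, restricted along
    [eta], is the claim tested on the image of [del] under [T]. *)
Lemma center_act_compat :
  act M ∘ T $ center_act = center_act ∘ Z $ act M ∘ Omega (carrier M).
Proof.
  apply (proj2 (dense_fmap (N := free_mod T) (dense_del Z (carrier M))) (carrier M));
    [homt|homt|]. intros V; cbn [carrier act free_mod].
  pose proof (chb_lin (free_mod T V)) as L. cbn [carrier act free_mod] in L.
  pose proof (center_actE V) as E. pose proof (chbE (free_mod T V)) as F.
  cbn [carrier act free_mod] in F.
  pose proof (Hom_chb (free_mod T V)) as H; cbn in H.
  drw (com2_nat T (id_hom (T V)) Hom_center_act). drw (eq_sym E).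
  drw (eq_sym L). drw (eq_sym (com2_nat T (id_hom (carrier M)) (Hom_eta T V))).
  drw (mu_Teta T V). drw F.
  symmetry. drw (Om_del Omega (carrier M) V).
  drw (del_nat_l Z (T V) (act_hom M)). diag.
Qed.

Definition paired_of_center : PairedModule :=
  {| pmod := M; pact := center_act; pact_hom := Hom_center_act; pact_mu := center_act_mu;
     pact_zeta := center_act_zeta; pact_act := center_act_compat |}.

Lemma paired_of_centerK : center_of paired_of_center = c.
Proof.
  apply center_ext; [reflexivity|]. intros N. apply modmor_ext; cbn.
  - symmetry; apply hb_src.
  - symmetry; apply hb_tgt.
  - symmetry; exact (chbE N).
Qed.

End FromCenter.

Lemma center_ofK (M : PairedModule) : paired_of_center (center_of M) = M.
Proof.
  apply paired_ext; [reflexivity|]. cbn.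
  apply (proj2 (dense_del Z (carrier M)) (carrier M)).
  - exact (Hom_center_act (center_of M)).
  - exact (pact_hom M).
  - intros V. etransitivity; [symmetry; exact (center_actE (center_of M) V)|].
    unfold chb; cbn. unfold pbraid; cbn.
    drw (eq_sym (del_nat_r Z (carrier M) (Hom_eta T V))). drw (mu_Teta T V). diag.
Qed.

End Paired.

(** * The isomorphism *)

Lemma fmap_iso (C D : Category) (F : Functor C D) f : is_iso f -> is_iso (F $ f).
Proof.
  intros (g & (d & c) & l & r). exists (F $ g).
  rewrite !dom_fmap, !cod_fmap, <- !fmap_comp, l, r, !fmap_id by congruence.
  split; [|auto]. split; [rewrite dom_fmap | rewrite cod_fmap]; congruence.
Qed.

(** * Transport of a braiding along a strict isomorphism *)

Section Transport.
Variables (A : MonCat) (B : BraidedCat) (I : Functor A B) (G : Functor B A).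
Hypotheses (GI_ob : forall X, G (I X) = X) (IG_ob : forall X, I (G X) = X)
  (GI_mor : forall f, G $ (I $ f) = f) (IG_mor : forall f, I $ (G $ f) = f)
  (I_tob : forall X Y, I (X ⊠ Y) = I X ⊠ I Y) (I_tmor : forall f g, I $ (f ⊗ g) = I $ f ⊗ I $ g)
  (I_one : I one = one).

Lemma G_tob X Y : G (X ⊠ Y) = G X ⊠ G Y.
Proof. now rewrite <- (IG_ob X), <- (IG_ob Y), <- I_tob, !GI_ob. Qed.

Lemma G_tmor f g : G $ (f ⊗ g) = G $ f ⊗ G $ g.
Proof. now rewrite <- (IG_mor f), <- (IG_mor g), <- I_tmor, !GI_mor. Qed.

Lemma G_one : G one = one.
Proof. now rewrite <- I_one, GI_ob. Qed.

(** With this choice the axioms are images under [G] of those in [B]; that the result is the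
    braiding of the R-matrix is the content of [double_braid]. *)
Definition transport_braid (X Y : ob A) : mor A := G $ braid (I X) (I Y).

Lemma transport_is_braiding : is_braiding transport_braid.
Proof.
  destruct (braidP B) as (Hh & Hi & Hn & Hr & Hl). unfold transport_braid.
  repeat split.
  - destruct (Hh (I X) (I Y)) as [E _]. now rewrite dom_fmap, E, G_tob, !GI_ob.
  - destruct (Hh (I X) (I Y)) as [_ E]. now rewrite cod_fmap, E, G_tob, !GI_ob.
  - intros X Y. apply fmap_iso, Hi.
  - intros f g. pose proof (Hn (I $ f) (I $ g)) as E. rewrite !dom_fmap, !cod_fmap in E.
    apply (f_equal (fmap G)) in E.
    destruct (Hh (I (dom f)) (I (dom g))), (Hh (I (cod f)) (I (cod g))).
    rewrite !fmap_comp, !G_tmor, !GI_mor in E; [exact E|..]; dc.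
  - intros X Y W. rewrite I_tob, Hr.
    destruct (Hh (I X) (I Y)), (Hh (I X) (I W)).
    rewrite fmap_comp, !G_tmor, !fmap_id, !GI_ob; [reflexivity|]. dca.
  - intros X Y W. rewrite I_tob, Hl.
    destruct (Hh (I X) (I W)), (Hh (I Y) (I W)).
    rewrite fmap_comp, !G_tmor, !fmap_id, !GI_ob; [reflexivity|]. dca.
Qed.

Lemma transport_isomorphism :
  @braided_isomorphism {| bmon := A; braid := transport_braid; braidP := transport_is_braiding |} B
    (strict_functor I_tob I_tmor I_one).
Proof.
  destruct (braidP B) as (Hh & _).
  split.
  - intros X Y; cbn. unfold transport_braid. rewrite IG_mor.
    destruct (Hh (I X) (I Y)). now rewrite comp_id_l', comp_id_r'.
  - exists (strict_functor G_tob G_tmor G_one). repeat split.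
    + intros X Y; cbn. unfold transport_braid. rewrite !IG_ob.
      destruct (Hh X Y). rewrite comp_id_l', comp_id_r'; trivial.
      * rewrite dom_fmap, H, G_tob; reflexivity.
      * rewrite cod_fmap, H0, G_tob; reflexivity.
    + apply monfunctor_ext; cbn; auto.
      * intros X Y. rewrite fmap_id, G_tob, !GI_ob. apply comp_id_l'. dc.
      * rewrite fmap_id, G_one. apply comp_id_l'. dc.
    + apply monfunctor_ext; cbn; auto.
      * intros X Y. rewrite fmap_id, I_tob, !IG_ob. apply comp_id_l'. dc.
      * rewrite fmap_id, I_one. apply comp_id_l'. dc.
Qed.

End Transport.

(** * The two inverse functors and their monoidal structure *)

Section Isomorphism.
Variables (C : AutonomousCat) (T : HopfMonad C) (Z : Centralizer T)
  (S : CentralizerStructure Z) (Omega : CanonicalLaw Z).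
#[local] Notation DT := (DT S Omega).

Definition I_ob (M : Module DT) : CenterOb (ModMon T) := center_of (paired_of_double M).
Definition G_ob (c : CenterOb (ModMon T)) : Module DT :=
  double_of_paired (paired_of_center S Omega c).

Lemma I_obK M : G_ob (I_ob M) = M.
Proof. unfold G_ob, I_ob. rewrite center_ofK. apply paired_of_doubleK. Qed.

Lemma G_obK c : I_ob (G_ob c) = c.
Proof. unfold G_ob, I_ob. rewrite double_of_pairedK. apply paired_of_centerK. Qed.

Lemma center_ext_chb (c c' : CenterOb (ModMon T)) :
  cob c = cob c' -> (forall N, chb c N = chb c' N) -> c = c'.
Proof.
  intros E F. apply center_ext; [exact E|]. intros N.
  apply modmor_ext; [| |apply F].
  - rewrite !hb_src. now rewrite E.
  - rewrite !hb_tgt. now rewrite E.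
Qed.

Lemma chb_center_tensor (c c' : CenterOb (ModMon T)) (N : Module T) :
  chb (center_tensor c c') N
  = (chb c N ⊗ idm (carrier (cob c'))) ∘ (idm (carrier (cob c)) ⊗ chb c' N).
Proof.
  unfold chb; cbn. rewrite mmor_comp; [reflexivity|]. cbn. rewrite hb_src, hb_tgt.
  symmetry; apply mod_tensor_assoc.
Qed.

Section Tensor.
Variables (X X' : ob C) (q q' : mor C).
Hypotheses (Hq : hom (Z (T X)) X q) (Hq' : hom (Z (T X')) X' q').

Lemma double_tensor_T :
  ((q ⊗ q') ∘ (zcom2 S (T X) (T X') ∘ Z $ com2 T X X')) ∘ zeta S (T (X ⊠ X'))
  = ((q ∘ zeta S (T X)) ⊗ (q' ∘ zeta S (T X'))) ∘ com2 T X X'.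
Proof.
  drw (zeta_natural S (Hom_com2 T X X')). drw (zeta_com2 S (T X) (T X')). diag.
Qed.

(** [zcom2_eq] produces two copies of [del] joined by [mu]; [act_mu] splits this into two successive
    actions on [N], one for each half braiding. *)
Lemma double_tensor_Z (N : Module T) :
  (act N ⊗ ((q ⊗ q') ∘ (zcom2 S (T X) (T X') ∘ Z $ com2 T X X') ∘ Z $ eta T (X ⊠ X')))
  ∘ del Z (X ⊠ X') (carrier N)
  = (((act N ⊗ (q ∘ Z $ eta T X)) ∘ del Z X (carrier N)) ⊗ idm X')
    ∘ (idm X ⊗ ((act N ⊗ (q' ∘ Z $ eta T X')) ∘ del Z X' (carrier N))).
Proof.
  drw (eta_com2 T X X'). drw (eq_sym (zcom2_natural S (Hom_eta T X) (Hom_eta T X'))).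
  drw (zcom2_eq S X X' (carrier N)). symmetry.
  drw (eq_sym (del_nat_r Z X (act_hom N))). drw (act_mu N). diag.
Qed.

End Tensor.

Lemma I_ob_tensor M N : I_ob (mod_tensor M N) = center_tensor (I_ob M) (I_ob N).
Proof.
  apply center_ext_chb.
  - apply module_ext; [reflexivity|]. exact (double_tensor_T (act_hom M) (act_hom N)).
  - intros W. rewrite chb_center_tensor. exact (double_tensor_Z (act_hom M) (act_hom N) W).
Qed.

Lemma I_ob_one : I_ob (mod_one DT) = center_one (ModMon T).
Proof.
  apply center_ext_chb.
  - apply module_ext; [reflexivity|]; cbn.
    drw (zeta_natural S (Hom_com0 T)). drw (zeta_com0 S). diag.
  - intros N. unfold chb; cbn. unfold pbraid; cbn.
    drw (eta_com0 T). drw (zcom0_eq S (carrier N)). drw (act_eta N). diag.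
Qed.

Lemma pbraid_natl (M M' : PairedModule S Omega) f : hom (carrier M) (carrier M') f ->
  f ∘ pact M = pact M' ∘ Z $ f ->
  forall N, (idm (carrier N) ⊗ f) ∘ pbraid M N = pbraid M' N ∘ (f ⊗ idm (carrier N)).
Proof.
  intros Hf E N. unfold pbraid. drw E. drw (del_nat_l Z (carrier N) Hf). diag.
Qed.

Section DoubleMor.
Variables (X X' : ob C) (q q' f : mor C).
Hypotheses (Hq : hom (Z (T X)) X q) (Hq' : hom (Z (T X')) X' q') (Hf : hom X X' f)
  (f_lin : f ∘ q = q' ∘ Z $ (T $ f)).

Lemma double_mor_T : f ∘ (q ∘ zeta S (T X)) = (q' ∘ zeta S (T X')) ∘ T $ f.
Proof. drw f_lin. drw (zeta_natural S (Hom_fmap T Hf)). diag. Qed.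

Lemma double_mor_Z : f ∘ (q ∘ Z $ eta T X) = (q' ∘ Z $ eta T X') ∘ Z $ f.
Proof. drw f_lin. drw (eta_nat T Hf). diag. Qed.

End DoubleMor.

Program Definition I_mor (f : ModMor DT) : CenterMor (ModMon T) :=
  {| csrc := I_ob (msrc f); ctgt := I_ob (mtgt f);
     cmor := {| msrc := cob (I_ob (msrc f)) : Module T; mtgt := cob (I_ob (mtgt f)) : Module T;
                mmor := mmor f; mmor_hom := mmor_hom f |} : mor (ModMon T) |}.
Next Obligation.
  intros f. exact (double_mor_T (act_hom (msrc f)) (act_hom (mtgt f)) (mmor_hom f) (mmor_lin f)).
Qed.
Next Obligation. intros f; split; reflexivity. Qed.
Next Obligation.
  intros f N; cbn. apply modmor_ext;
    [rewrite !msrc_comp | rewrite !mtgt_comp | rewrite !mmor_comp]; trivial.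
  apply (pbraid_natl (M := paired_of_double (msrc f)) (M' := paired_of_double (mtgt f)));
    [exact (mmor_hom f)|].
  exact (double_mor_Z (act_hom (msrc f)) (act_hom (mtgt f)) (mmor_hom f) (mmor_lin f)).
Qed.

Section CenterMor.
Variable f : CenterMor (ModMon T).
#[local] Notation M := (cob (csrc f)).
#[local] Notation M' := (cob (ctgt f)).
#[local] Notation g := (mmor (cmor f)).

Lemma cmor_src : msrc (cmor f) = M.
Proof. apply (cmor_hom f). Qed.

Lemma cmor_tgt : mtgt (cmor f) = M'.
Proof. apply (cmor_hom f). Qed.

Lemma Hom_cmor : Hom g (carrier M) (carrier M').
Proof. pose proof (mmor_hom (cmor f)) as H. rewrite cmor_src, cmor_tgt in H. exact H. Qed.

Lemma cmor_lin : g ∘ act M = act M' ∘ T $ g.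
Proof. pose proof (mmor_lin (cmor f)) as H. rewrite cmor_src, cmor_tgt in H. exact H. Qed.

Lemma cmor_chb N :
  (idm (carrier N) ⊗ g) ∘ chb (csrc f) N = chb (ctgt f) N ∘ (g ⊗ idm (carrier N)).
Proof.
  pose proof (f_equal (@mmor C T) (cmor_hb f N)) as H.
  cbn in H; rewrite !mmor_comp in H; [exact H|..];
    cbn; now rewrite ?hb_src, ?hb_tgt, ?cmor_src, ?cmor_tgt.
Qed.

(** Both actions are read off from the half braidings at free modules, with which [f] is
    compatible. *)
Lemma cmor_center_act : g ∘ center_act Z (csrc f) = center_act Z (ctgt f) ∘ Z $ g.
Proof.
  pose proof Hom_cmor as Hg.
  pose proof (Hom_center_act Z (csrc f)) as H1. pose proof (Hom_center_act Z (ctgt f)) as H2.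
  apply (proj2 (dense_del Z (carrier M)) (carrier M')); [homt|homt|]. intros V.
  pose proof (center_actE Z (csrc f) V) as E1. pose proof (center_actE Z (ctgt f) V) as E2.
  pose proof (Hom_chb (csrc f) (free_mod T V)) as H3.
  pose proof (Hom_chb (ctgt f) (free_mod T V)) as H4.
  pose proof (cmor_chb (free_mod T V)) as E3. cbn in E3, H3, H4.
  drw (eq_sym E1). drw E3. symmetry. drw (del_nat_l Z V Hg). drw (eq_sym E2). diag.
Qed.

End CenterMor.

Program Definition G_mor (f : CenterMor (ModMon T)) : ModMor DT :=
  {| msrc := G_ob (csrc f); mtgt := G_ob (ctgt f); mmor := mmor (cmor f);
     mmor_hom := Hom_cmor f |}.
Next Obligation.
  intros f; cbn. pose proof (Hom_cmor f) as Hg.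
  pose proof (Hom_center_act Z (csrc f)) as H1. pose proof (Hom_center_act Z (ctgt f)) as H2.
  pose proof (cmor_lin f) as E1. pose proof (cmor_center_act f) as E2.
  drw E2. drw E1. diag.
Qed.

Program Definition I_functor : Functor (ModMon DT) (Center (ModMon T)) :=
  {| fob := I_ob : ob (ModMon DT) -> ob (Center (ModMon T));
     fmap := I_mor : mor (ModMon DT) -> mor (Center (ModMon T)) |}.
Next Obligation. reflexivity. Qed.
Next Obligation. reflexivity. Qed.
Next Obligation.
  intros M. apply centermor_ext; [reflexivity..|]. now apply modmor_ext.
Qed.
Next Obligation.
  cbn; intros g f e. rewrite (mod_compE e).
  rewrite (@center_compE _ (I_mor g) (I_mor f) (f_equal I_ob e)).
  apply centermor_ext; [reflexivity..|]; cbn. symmetry.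
  assert (e' : pmod (paired_of_double (msrc g)) = pmod (paired_of_double (mtgt f)))
    by (now rewrite e).
  apply modmor_ext; [rewrite msrc_comp | rewrite mtgt_comp | rewrite mmor_comp]; trivial.
Qed.

Program Definition G_functor : Functor (Center (ModMon T)) (ModMon DT) :=
  {| fob := G_ob : ob (Center (ModMon T)) -> ob (ModMon DT);
     fmap := G_mor : mor (Center (ModMon T)) -> mor (ModMon DT) |}.
Next Obligation. reflexivity. Qed.
Next Obligation. reflexivity. Qed.
Next Obligation. intros c. now apply modmor_ext. Qed.
Next Obligation.
  cbn; intros g f e. rewrite (center_compE e).
  rewrite (@mod_compE _ _ (G_mor g) (G_mor f) (f_equal G_ob e)).
  apply modmor_ext; [reflexivity..|]; cbn. apply mmor_comp.
  now rewrite cmor_src, cmor_tgt, e.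
Qed.

Lemma I_morK f : G_mor (I_mor f) = f.
Proof. apply modmor_ext; [apply I_obK..|reflexivity]. Qed.

Lemma G_morK f : I_mor (G_mor f) = f.
Proof.
  apply centermor_ext; [apply G_obK..|]. apply modmor_ext; [| |reflexivity].
  - etransitivity; [|symmetry; apply cmor_src]. exact (f_equal (@cob _) (G_obK (csrc f))).
  - etransitivity; [|symmetry; apply cmor_tgt]. exact (f_equal (@cob _) (G_obK (ctgt f))).
Qed.

Lemma I_mor_tensor f g : I_mor (mod_tensor_mor f g) = center_tensor_mor (I_mor f) (I_mor g).
Proof.
  apply centermor_ext; [apply I_ob_tensor..|].
  apply modmor_ext; [| |reflexivity].
  - exact (f_equal (@cob _) (I_ob_tensor (msrc f) (msrc g))).
  - exact (f_equal (@cob _) (I_ob_tensor (mtgt f) (mtgt g))).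
Qed.

(** The left side is the half braiding of the image of [(X, q)] at the [T]-module underlying
    [(X', q')]. *)
Lemma double_braid X X' q q' : hom (Z (T X)) X q -> hom (Z (T X')) X' q' ->
  ((q' ∘ zeta S (T X')) ⊗ (q ∘ Z $ eta T X)) ∘ del Z X X' = (q' ⊗ q) ∘ double_R S X X'.
Proof. intros Hq Hq'. unfold double_R. diag. Qed.

End Isomorphism.

Unset Implicit Arguments.

Theorem theorem6p5 (C : AutonomousCat) (T : HopfMonad C) (Z : Centralizer T)
    (S : CentralizerStructure Z) (Omega : CanonicalLaw Z) :
  exists hD : is_bimonad (double S Omega),
    let DT : Bimonad C := {| bdata := double S Omega; bimonadP := hD |} in
  exists (tau : ob (ModMon DT) -> ob (ModMon DT) -> mor (ModMon DT)) (htau : is_braiding tau),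
    (forall M N : Module DT,
       mmor (tau M N) = (act N ⊗ act M) ∘ double_R S (carrier M) (carrier N)) /\
    let DTC : BraidedCat := {| bmon := ModMon DT; braid := tau; braidP := htau |} in
  exists I : MonFunctor DTC (Center (ModMon T)),
    ((forall M : Module DT,
        carrier (cob (I M)) = carrier M /\
        act (cob (I M)) = act M ∘ zeta S (T (carrier M)) /\
        forall N : Module T,
          mmor (hb (I M) N)
          = (act N ⊗ (act M ∘ Z $ eta T (carrier M))) ∘ del Z (carrier M) (carrier N)) /\
     (forall f : ModMor DT, mmor (cmor (I $ f)) = mmor f)) /\
    strict I /\
    braided_isomorphism I /\
    comp_mon (center_mod_forget T) I = mod_forget DT.
Proof.
  exists (double_bimonad S Omega). cbv zeta.
  set (I := I_functor S Omega). set (G := G_functor S Omega).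
  exists (transport_braid (B := Center (ModMon T)) I G).
  pose (GI := @I_obK C T Z S Omega : forall M, G (I M) = M).
  pose (IG := @G_obK C T Z S Omega : forall c, I (G c) = c).
  pose (GIm := @I_morK C T Z S Omega : forall f, G $ (I $ f) = f).
  pose (IGm := @G_morK C T Z S Omega : forall f, I $ (G $ f) = f).
  pose (I2 := @I_ob_tensor C T Z S Omega : forall M N, I (M ⊠ N) = I M ⊠ I N).
  pose (Im := @I_mor_tensor C T Z S Omega : forall f g, I $ (f ⊗ g) = I $ f ⊗ I $ g).
  pose (I0 := @I_ob_one C T Z S Omega : I one = one).
  exists (transport_is_braiding (B := Center (ModMon T)) GI IG GIm IGm I2 Im). split.
  (* The morphism in [C] underlying the transported braiding is, by computation, the half braiding
     of [I M] at the [T]-module underlying [I N]. *)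
  { intros M N. exact (double_braid S (act_hom M) (act_hom N)). }
  exists (strict_functor I2 Im I0). split; [split; [|reflexivity]|].
  { intros M. repeat split. }
  split; [|split].
  - split; [intros M N; split; [apply I2|reflexivity]|split; [exact I0|reflexivity]].
  - apply transport_isomorphism.
  (* On objects and morphisms the two functors agree by computation; the structure morphisms of the
     composite are composites of identities. *)
  - apply monfunctor_ext; cbn; trivial.
    + intros M N. apply comp_id_l'; apply cod_id.
    + apply comp_id_l'; apply cod_id.
Qed.
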